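(* Let $\pi_2$ be a generator of $\mathrm{LT}[\pi^2]$. The reduction of the space $\mathbf{Y}^{\pi_2}_{3,1,c}$ is a disjoint union of $(q-1)$ affine curves, each defined by the equation $$-x^qy^{q^2}+xy^{q^3}=1.$$
   Context: $F$ is a non-archimedean local field of equal characteristic $p>0$ with residue field $\mathbb{F}_q$ and uniformizer $\pi$; $\mathbf{C}$ is the completion of an algebraic closure of $F$, $v$ the valuation on $\mathbf{C}$ with $v(\pi)=1$. All spaces are rigid analytic curves considered over $\mathbf{C}$. For $u\in\mathbf{C}$ with $v(u)>0$ put $[\pi]_u(X)=X^{q^2}+uX^q+\pi X$ and $[\pi^2]_u=[\pi]_u\circ[\pi]_u$. Put $[\pi]_{\mathrm{LT}}(X)=\pi X-X^q$; a generator of $\mathrm{LT}[\pi^2]$ is an element $\pi_2\in\mathbf{C}$ with $[\pi]_{\mathrm{LT}}([\pi]_{\mathrm{LT}}(\pi_2))=0$ and $[\pi]_{\mathrm{LT}}(\pi_2)\neq 0$; then $v(\pi_2)=\frac{1}{q(q-1)}$. For $X_2,Y_2$ with $[\pi^2]_u(X_2)=[\pi^2]_u(Y_2)=0$ write $X_1=[\pi]_u(X_2)$, $Y_1=[\pi]_u(Y_2)$ and $$\mu_2(X_2,Y_2)=X_1Y_2^q-X_1^qY_2-X_2^qY_1+X_2Y_1^q .$$ $\mathcal{X}^{\pi_2}(\pi^2)$ is the rigid analytic curve with $\mathbf{C}$-points $\{(u,X_2,Y_2): v(u)>0,\ [\pi^2]_u(X_2)=[\pi^2]_u(Y_2)=0,\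 \mu_2(X_2,Y_2)=\pi_2\}$ (a connected component of the Lubin-Tate space of level $\pi^2$ and height $2$). $\mathbf{Y}^{\pi_2}_{3,1,c}$ is the subspace of $\mathcal{X}^{\pi_2}(\pi^2)$ defined by $v(u)=\frac1{q+1}$, $v(X_1)=v(Y_1)=\frac{1}{q(q^2-1)}$, $v(X_2)=v(Y_2)=\frac{1}{q^3(q^2-1)}$. The reduction of a reduced affinoid over $\mathbf{C}$ is $\mathrm{Spec}$ of the ring of power-bounded functions modulo the topologically nilpotent functions, a scheme over the residue field of $\mathbf{C}$. *)

(* Defs.v *)
From HB Require Import structures.
From mathcomp Require Import all_boot all_order all_algebra.
(* the notations of mpoly and of constructive_ereal clash when they are imported
   in the other order *)
From mathcomp Require Import mpoly.
From mathcomp Require Import boolp functions reals constructive_ereal.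

Set Implicit Arguments.
Unset Strict Implicit.
Unset Printing Implicit Defensive.

Import Order.TTheory GRing.Theory Num.Theory.

Local Open Scope ring_scope.

(* The quotients of ring_quotient.v require proper ideals; here the unit ideal
   is allowed, so that quotients of arbitrary presented algebras make sense. *)
HB.mixin Record isRingIdeal (A : comPzRingType) (S : A -> bool) := {
  ideal_mulr_subproof : forall a, {in S, forall x, a * x \in S}
}.

#[short(type="ringIdeal")]
HB.structure Definition RingIdeal (A : comPzRingType) :=
  {S of GRing.ZmodClosed A S & isRingIdeal A S}.

Section RingQuotient.
Local Open Scope quotient_scope.
Variables (A : comPzRingType) (I : ringIdeal A).

Definition ring_quot : Type := @Quotient.quot A I.
HB.instance Definition _ := GRing.Zmodule.on ring_quot.

Definition to_quot (x : A) : ring_quot := \pi_(@Quotient.quot A I) x.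
Definition quot_repr (x : ring_quot) : A := repr (x : @Quotient.quot A I).

Lemma quot_reprK : cancel quot_repr to_quot.
Proof. exact: (@reprK A (@Quotient.quot A I)). Qed.

Lemma to_quotE x y : (to_quot x == to_quot y) = (x - y \in (I : {pred A})).
Proof. by rewrite Quotient.idealrBE. Qed.

Lemma to_quotP x y : x - y \in (I : {pred A}) -> to_quot x = to_quot y.
Proof. by rewrite -to_quotE => /eqP. Qed.

Fact to_quot_is_additive : zmod_morphism to_quot.
Proof. exact: (pi_is_zmod_morphism (@Quotient.quot A I)). Qed.

Definition quot_one : ring_quot := to_quot 1.
Definition quot_mul (x y : ring_quot) : ring_quot :=
  to_quot (quot_repr x * quot_repr y).

Fact to_quotM x y : to_quot (x * y) = quot_mul (to_quot x) (to_quot y).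
Proof.
have rI z : z - quot_repr (to_quot z) \in (I : {pred A}).
  by rewrite -to_quotE quot_reprK.
apply: to_quotP.
set x' := quot_repr (to_quot x); set y' := quot_repr (to_quot y).
have -> : x * y - x' * y' = y * (x - x') + x' * (y - y').
  by rewrite !mulrBr addrA [y * x]mulrC [y * x']mulrC subrK.
by apply: rpredD; apply: ideal_mulr_subproof; apply: rI.
Qed.

Fact quot_mulA : associative quot_mul.
Proof.
move=> x y z; rewrite -[x]quot_reprK -[y]quot_reprK -[z]quot_reprK.
by rewrite -!to_quotM mulrA.
Qed.
Fact quot_mulC : commutative quot_mul.
Proof. by move=> x y; rewrite /quot_mul mulrC. Qed.
Fact quot_mul1 : left_id quot_one quot_mul.
Proof. by move=> x; rewrite -[x]quot_reprK -to_quotM mul1r. Qed.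
Fact quot_mulDl : left_distributive quot_mul +%R.
Proof.
have toD u w : to_quot u + to_quot w = to_quot (u + w).
  by have := to_quot_is_additive (u + w) w; rewrite addrK => ->; rewrite subrK.
move=> x y z; rewrite -[x]quot_reprK -[y]quot_reprK -[z]quot_reprK.
by rewrite toD -!to_quotM toD mulrDl.
Qed.

HB.instance Definition _ := GRing.Zmodule_isComPzRing.Build ring_quot
  quot_mulA quot_mulC quot_mul1 quot_mulDl.
HB.instance Definition _ :=
  GRing.isZmodMorphism.Build A ring_quot to_quot to_quot_is_additive.
HB.instance Definition _ :=
  GRing.isMonoidMorphism.Build A ring_quot to_quot (conj (erefl _) to_quotM).
End RingQuotient.

Section GeneratedIdeal.
Variables (A : comPzRingType) (gs : seq A).

Definition gen_ideal : {pred A} :=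
  fun x => `[< exists c : 'I_(size gs) -> A, x = \sum_i c i * gs`_i >].

Fact gen_ideal_zmod : zmod_closed gen_ideal.
Proof.
split=> [|x y /asboolP[c ->] /asboolP[d ->]]; apply/asboolP.
  by exists (fun=> 0); rewrite big1 // => i _; rewrite mul0r.
exists (fun i => c i - d i); rewrite -sumrB.
by apply: eq_bigr => i _; rewrite mulrBl.
Qed.

Fact gen_ideal_mulr a : {in gen_ideal, forall x, a * x \in gen_ideal}.
Proof.
move=> x /asboolP[c ->]; apply/asboolP; exists (fun i => a * c i).
by rewrite mulr_sumr; apply: eq_bigr => i _; rewrite mulrA.
Qed.

HB.instance Definition _ := GRing.isZmodClosed.Build A gen_ideal gen_ideal_zmod.
HB.instance Definition _ := isRingIdeal.Build A gen_ideal gen_ideal_mulr.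
End GeneratedIdeal.

Definition quot_by (A : comPzRingType) (gs : seq A) : comPzRingType :=
  ring_quot (gen_ideal gs).

(* A ring topologised by a decreasing exhaustive filtration by additive
   subgroups, [fil M a] standing for "a has a representative of valuation at
   least M"; the [fil M], for M large, form a basis of neighbourhoods of 0. *)
HB.mixin Record isFiltered (R : realType) A of GRing.ComPzRing A := {
  fil : R -> A -> Prop;
  fil_le : forall M N a, M <= N -> fil N a -> fil M a;
  fil_ex : forall a, exists M, fil M a;
  fil0 : forall M, fil M 0;
  filB : forall M a b, fil M a -> fil M b -> fil M (a - b);
  filM : forall M N a b, fil M a -> fil N b -> fil (M + N) (a * b)
}.

#[short(type="filteredRing")]
HB.structure Definition FilteredRing (R : realType) :=
  {A of GRing.ComPzRing A & isFiltered R A}.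

Section Reduction.
Variables (R : realType) (A : filteredRing R).
Implicit Types a b : A.
Local Notation U := (@fil R A).

Definition power_bounded : {pred A} :=
  fun a => `[< exists M : R, forall n, U M (a ^+ n) >].

Definition top_nilpotent : {pred A} :=
  fun a => `[< forall M : R, exists N, forall n, (N <= n)%N -> U M (a ^+ n) >].

Lemma filN M a : U M a -> U M (- a).
Proof. by move=> Ua; rewrite -[- a]sub0r; apply: filB => //; apply: fil0. Qed.

Lemma filD M a b : U M a -> U M b -> U M (a + b).
Proof. by move=> Ua Ub; rewrite -[b]opprK; apply: filB => //; apply: filN. Qed.

Lemma filMn M a n : U M a -> U M (a *+ n).
Proof.
move=> Ua; elim: n => [|n IHn]; first by rewrite mulr0n; apply: fil0.
by rewrite mulrS; apply: filD.
Qed.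

Lemma fil_sum M (I : Type) (s : seq I) (P : pred I) (F : I -> A) :
  (forall i, P i -> U M (F i)) -> U M (\sum_(i <- s | P i) F i).
Proof. by move=> UF; apply: big_ind => //; [apply: fil0 | apply: filD]. Qed.

Fact power_boundedD a b :
  a \in power_bounded -> b \in power_bounded -> a + b \in power_bounded.
Proof.
move=> /asboolP[M Ma] /asboolP[N Nb]; apply/asboolP; exists (M + N) => n.
by rewrite exprDn; apply: fil_sum => i _; apply/filMn/filM.
Qed.

Fact filXN M a n : U M (a ^+ n) -> U M ((- a) ^+ n).
Proof.
rewrite exprNn => Ua; rewrite -signr_odd; case: (odd n).
  by rewrite mulN1r; apply: filN.
by rewrite mul1r.
Qed.

Fact power_boundedN a : a \in power_bounded -> - a \in power_bounded.
Proof. by move=> /asboolP[M Ma]; apply/asboolP; exists M => n; apply/filXN. Qed.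

Fact power_bounded_subring : subring_closed power_bounded.
Proof.
split=> [|a b pa pb|a b /asboolP[M Ma] /asboolP[N Nb]].
- apply/asboolP; have [M UM] := fil_ex (1 : A).
  by exists M => n; rewrite expr1n.
- by apply: power_boundedD => //; apply: power_boundedN.
- by apply/asboolP; exists (M + N) => n; rewrite exprMn; apply: filM.
Qed.

HB.instance Definition _ :=
  GRing.isSubringClosed.Build A power_bounded power_bounded_subring.

Fact top_nilpotent0 : 0 \in top_nilpotent.
Proof.
apply/asboolP=> M; exists 1%N => n n_gt0.
by rewrite expr0n eqn0Ngt n_gt0; apply: fil0.
Qed.

Fact top_nilpotentN a : a \in top_nilpotent -> - a \in top_nilpotent.
Proof.
move=> /asboolP Ta; apply/asboolP=> M; have [N TN] := Ta M.
by exists N => n leNn; apply/filXN/TN.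
Qed.

Fact top_nilpotentD a b : a \in power_bounded -> b \in power_bounded ->
  a \in top_nilpotent -> b \in top_nilpotent -> a + b \in top_nilpotent.
Proof.
move=> /asboolP[Ma Pa] /asboolP[Mb Pb] /asboolP Ta /asboolP Tb.
apply/asboolP=> M.
have [[Na Ha] [Nb Hb]] := (Ta (M - Mb), Tb (M - Ma)).
exists (Na + Nb)%N => n len; rewrite exprDn; apply: fil_sum => i _.
apply: filMn; have [leNi|ltiN] := leqP Nb i.
  by rewrite -[M](subrK Ma) addrC; apply: filM => //; apply: Hb.
rewrite -[M](subrK Mb); apply: filM => //; apply: Ha.
rewrite -(leq_add2r i) subnK; last by rewrite -ltnS.
by rewrite (leq_trans _ len) // leq_add2l ltnW.
Qed.

Fact top_nilpotentM a b : a \in power_bounded ->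
  b \in top_nilpotent -> a * b \in top_nilpotent.
Proof.
move=> /asboolP[Ma Pa] /asboolP Tb; apply/asboolP=> M.
have [N HN] := Tb (M - Ma); exists N => n leNn.
by rewrite exprMn -[M](subrK Ma) addrC; apply: filM => //; apply: HN.
Qed.

Record power_bounded_type :=
  PowerBounded { pb_val :> A; pb_valP : pb_val \in power_bounded }.
HB.instance Definition _ := [isSub for pb_val].
HB.instance Definition _ := [Choice of power_bounded_type by <:].
HB.instance Definition _ := GRing.SubChoice_isSubComPzRing.Build A
  power_bounded power_bounded_type power_bounded_subring.

Definition top_nilpotent_ideal : {pred power_bounded_type} :=
  fun x => pb_val x \in top_nilpotent.

Fact top_nilpotent_zmod : zmod_closed top_nilpotent_ideal.
Proof.
split=> [|x y Tx Ty]; first exact: top_nilpotent0.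
change (pb_val x - pb_val y \in top_nilpotent).
apply: top_nilpotentD; [exact: pb_valP | | exact: Tx | exact: top_nilpotentN].
by apply: power_boundedN; apply: pb_valP.
Qed.

Fact top_nilpotent_mulr y :
  {in top_nilpotent_ideal, forall x, y * x \in top_nilpotent_ideal}.
Proof. by move=> x Tx; apply: top_nilpotentM => //; apply: pb_valP. Qed.

HB.instance Definition _ := GRing.isZmodClosed.Build power_bounded_type
  top_nilpotent_ideal top_nilpotent_zmod.
HB.instance Definition _ := isRingIdeal.Build power_bounded_type
  top_nilpotent_ideal top_nilpotent_mulr.

Definition reduction : comPzRingType := ring_quot top_nilpotent_ideal.

Definition reduce (x : power_bounded_type) : reduction :=
  to_quot top_nilpotent_ideal x.
End Reduction.

Record valuation (R : realType) (K : fieldType) := Valuation {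
  val_fun :> K -> \bar R;
  val_neq_ninfty : forall x, val_fun x != -oo%E;
  val_eq_pinfty : forall x, val_fun x = +oo%E <-> x = 0;
  val_mul : forall x y, val_fun (x * y) = (val_fun x + val_fun y)%E;
  val_add : forall x y, (Order.min (val_fun x) (val_fun y) <= val_fun (x + y))%E
}.

Section ValuationRing.
Local Open Scope ereal_scope.
Variables (R : realType) (K : fieldType) (v : valuation R K).

Lemma val0 : v 0%R = +oo.
Proof. by apply/val_eq_pinfty. Qed.

Lemma val_fin x : x != 0%R -> v x \is a fin_num.
Proof.
move=> x0; rewrite fin_numE val_neq_ninfty /=.
by apply/eqP => /val_eq_pinfty/eqP; rewrite (negPf x0).
Qed.

Lemma val1 : v 1%R = 0.
Proof.
have f1 : v 1%R \is a fin_num by rewrite val_fin ?oner_neq0.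
have := val_mul v 1 1; rewrite mulr1.
by rewrite -(fineK f1) -EFinD => -[] /eqP; rewrite -subr_eq0 opprD addNKr oppr_eq0
  => /eqP ->.
Qed.

Lemma valN x : v (- x)%R = v x.
Proof.
suff vN1 : v (-1)%R = 0 by rewrite -mulN1r val_mul vN1 add0e.
have f1 : v (-1)%R \is a fin_num by rewrite val_fin ?oppr_eq0 ?oner_neq0.
have := val_mul v (-1) (-1); rewrite mulrNN mulr1 val1.
rewrite -(fineK f1) -EFinD => -[] /esym/eqP.
by rewrite -mulr2n mulrn_eq0 /= => /eqP ->.
Qed.

Lemma val_geB M x y : M <= v x -> M <= v y -> M <= v (x - y)%R.
Proof.
move=> Mx My; apply: le_trans (val_add v x (- y)).
by rewrite valN le_min Mx.
Qed.

Lemma valX_ge0 x n : 0 <= v x -> 0 <= v (x ^+ n)%R.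
Proof.
by move=> x0; elim: n => [|n IHn]; rewrite ?expr0 ?val1 // exprS val_mul adde_ge0.
Qed.

Definition integral_elt : {pred K} := fun x => 0 <= v x.

Lemma integral_eltE x : (x \in integral_elt) = (0 <= v x).
Proof. by []. Qed.

Fact integral_elt_subring : subring_closed integral_elt.
Proof.
split=> [|x y|x y]; rewrite ?integral_eltE; first by rewrite val1.
  exact: val_geB.
by rewrite val_mul; apply: adde_ge0.
Qed.

HB.instance Definition _ :=
  GRing.isSubringClosed.Build K integral_elt integral_elt_subring.

Record valuation_ring :=
  ValuationRing { vr_val :> K; vr_valP : vr_val \in integral_elt }.
HB.instance Definition _ := [isSub for vr_val].
HB.instance Definition _ := [Choice of valuation_ring by <:].
HB.instance Definition _ := GRing.SubChoice_isSubComPzRing.Build K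
  integral_elt valuation_ring integral_elt_subring.

Definition maximal_ideal : {pred valuation_ring} := fun x => 0 < v (vr_val x).

Lemma maximal_idealE x : (x \in maximal_ideal) = (0 < v (vr_val x)).
Proof. by []. Qed.

Fact maximal_ideal_zmod : zmod_closed maximal_ideal.
Proof.
split=> [|x y]; rewrite !maximal_idealE; first by rewrite val0 lt0y.
move=> vx vy; apply: lt_le_trans (val_add v (vr_val x) (- vr_val y)%R).
by rewrite valN lt_min vx.
Qed.

Fact maximal_ideal_mulr a : {in maximal_ideal, forall x, (a * x)%R \in maximal_ideal}.
Proof.
move=> x; rewrite !maximal_idealE /= => vx; rewrite val_mul.
by apply: lt_le_trans vx _; rewrite leeDr //; apply: vr_valP.
Qed.

HB.instance Definition _ :=
  GRing.isZmodClosed.Build valuation_ring maximal_ideal maximal_ideal_zmod.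
HB.instance Definition _ :=
  isRingIdeal.Build valuation_ring maximal_ideal maximal_ideal_mulr.

Definition residue_field : Type := ring_quot maximal_ideal.
HB.instance Definition _ := GRing.ComPzRing.on residue_field.

Definition residue (x : valuation_ring) : residue_field :=
  to_quot maximal_ideal x.

Fact residue_oner_neq0 : (1 : residue_field)%R != 0%R.
Proof.
apply/eqP => /eqP.
have -> : (1 : residue_field)%R = to_quot maximal_ideal 1%R by [].
have -> : (0 : residue_field)%R = to_quot maximal_ideal 0%R by rewrite raddf0.
by rewrite to_quotE subr0 maximal_idealE /= val1 ltxx.
Qed.
HB.instance Definition _ :=
  GRing.PzSemiRing_isNonZero.Build residue_field residue_oner_neq0.

Definition residue_inv (x : residue_field) : residue_field :=
  if pselect (exists y, (y * x)%R = 1%R) is left ex then projT1 (cid ex) else 0%R.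

Fact residue_mulVf x : x != 0%R -> (residue_inv x * x)%R = 1%R.
Proof.
move=> x0; rewrite /residue_inv.
case: pselect => [ex|[]]; first by case: cid.
move: x0; rewrite -[x](@quot_reprK _ maximal_ideal).
set z := quot_repr x => x0.
have vz : v (vr_val z) = 0.
  apply/eqP; rewrite eq_le [X in _ && X](vr_valP z) andbT leNgt.
  apply: contra x0 => vz; rewrite -(raddf0 (to_quot maximal_ideal)).
  by rewrite to_quotE subr0.
have z0 : vr_val z != 0%R by apply: contra_eq_neq vz => /= ->; rewrite val0.
have iz : (vr_val z)^-1%R \in integral_elt.
  have := val_mul v (vr_val z) (vr_val z)^-1%R.
  by rewrite mulfV // val1 vz add0e integral_eltE => <-.
exists (to_quot maximal_ideal (ValuationRing iz)).
rewrite -[LHS](@rmorphM _ _ (to_quot maximal_ideal)).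
by rewrite -[RHS](rmorph1 (to_quot maximal_ideal)); congr to_quot; apply/val_inj/mulVf.
Qed.

Fact residue_inv0 : residue_inv 0%R = 0%R.
Proof.
rewrite /residue_inv; case: pselect => // ex; case: (cid ex) => y /= /esym/eqP.
by rewrite mulr0 oner_eq0.
Qed.

HB.instance Definition _ :=
  GRing.ComNzRing_isField.Build residue_field residue_mulVf residue_inv0.

Definition complete := forall s : nat -> K,
  (forall M : R, exists N, forall m n, (N <= m)%N -> (N <= n)%N ->
     M%:E <= v (s m - s n)%R) ->
  exists l, forall M : R, exists N, forall n, (N <= n)%N -> M%:E <= v (s n - l)%R.
End ValuationRing.


Record mseries (n : nat) (K : comNzRingType) :=
  MSeries { mscoef :> 'X_{1..n} -> K }.

Section MSeries.
Variables (n : nat) (K : comNzRingType).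
Local Notation S := (mseries n K).
Implicit Types f g h : S.

Lemma mseriesP f g : (forall m, f m = g m) -> f = g.
Proof. by case: f g => [f] [g] /= /funext ->. Qed.

HB.instance Definition _ := gen_eqMixin S.
HB.instance Definition _ := gen_choiceMixin S.

Definition ms_zero : S := MSeries (fun=> 0).
Definition ms_opp f : S := MSeries (fun m => - f m).
Definition ms_add f g : S := MSeries (fun m => f m + g m).

Fact ms_addA : associative ms_add.
Proof. by move=> f g h; apply: mseriesP => m /=; rewrite addrA. Qed.
Fact ms_addC : commutative ms_add.
Proof. by move=> f g; apply: mseriesP => m /=; rewrite addrC. Qed.
Fact ms_add0 : left_id ms_zero ms_add.
Proof. by move=> f; apply: mseriesP => m /=; rewrite add0r. Qed.
Fact ms_addN : left_inverse ms_zero ms_opp ms_add.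
Proof. by move=> f; apply: mseriesP => m /=; rewrite addNr. Qed.
HB.instance Definition _ :=
  GRing.isZmodule.Build S ms_addA ms_addC ms_add0 ms_addN.

Definition mpoly_ms (p : {mpoly K[n]}) : S := MSeries (fun m => p@_m).

Definition ms_mul f g : S := MSeries (fun m =>
  \sum_(k : 'X_{1..n < (mdeg m).+1, (mdeg m).+1} | m == (k.1 + k.2)%MM)
     f k.1 * g k.2).

Definition ms_trunc d f : {mpoly K[n]} :=
  \sum_(m : 'X_{1..n < d}) f m *: 'X_[m].

Fact ms_truncE d f m : (mdeg m < d)%N -> (ms_trunc d f)@_m = f m.
Proof. exact: mcoeff_mpoly. Qed.

Fact ms_mulE f g (p q : {mpoly K[n]}) m :
    (forall k, (mdeg k <= mdeg m)%N -> p@_k = f k) ->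
    (forall k, (mdeg k <= mdeg m)%N -> q@_k = g k) ->
  ms_mul f g m = (p * q)@_m.
Proof.
move=> pf qg; rewrite mcoeffM; apply: eq_bigr => -[k1 k2] /= _.
by rewrite pf ?qg // -ltnS bmdeg.
Qed.

Fact ms_mulA : associative ms_mul.
Proof.
move=> f g h; apply: mseriesP => m; set t := ms_trunc (mdeg m).+1.
have tE a k : (mdeg k <= mdeg m)%N -> (t a)@_k = a k.
  by move=> le_km; rewrite ms_truncE.
have mE a b k : (mdeg k <= mdeg m)%N -> (t a * t b)@_k = ms_mul a b k.
  move=> le_km; apply/esym/ms_mulE => l le_lk; apply: tE;
  exact: leq_trans le_km.
rewrite (ms_mulE (p := t f) (q := t g * t h)) //; [|exact: tE|exact: mE].
by rewrite (ms_mulE (p := t f * t g) (q := t h)) ?mulrA //; [exact: mE|exact: tE].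
Qed.

Fact ms_mulC : commutative ms_mul.
Proof.
move=> f g; apply: mseriesP => m; set t := ms_trunc (mdeg m).+1.
have tE a k : (mdeg k <= mdeg m)%N -> (t a)@_k = a k.
  by move=> le_km; rewrite ms_truncE.
rewrite (ms_mulE (p := t f) (q := t g)); [|exact: tE|exact: tE].
by rewrite (ms_mulE (p := t g) (q := t f)) ?[t f * _]mulrC //; exact: tE.
Qed.

Fact ms_mul1 : left_id (mpoly_ms 1) ms_mul.
Proof.
move=> f; apply: mseriesP => m; set t := ms_trunc (mdeg m).+1.
have tE a k : (mdeg k <= mdeg m)%N -> (t a)@_k = a k.
  by move=> le_km; rewrite ms_truncE.
by rewrite (ms_mulE (p := 1) (q := t f)) ?mul1r //; [rewrite tE|exact: tE].
Qed.

Fact ms_mulDl : left_distributive ms_mul +%R.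
Proof.
move=> f g h; apply: mseriesP => m /=; rewrite -big_split.
by apply: eq_bigr => k _; rewrite mulrDl.
Qed.

HB.instance Definition _ := GRing.Zmodule_isComPzRing.Build S
  ms_mulA ms_mulC ms_mul1 ms_mulDl.

Lemma mscoefB f g m : (f - g) m = f m - g m.
Proof. by []. Qed.

Lemma mscoefM f g m : (f * g) m =
  \sum_(k : 'X_{1..n < (mdeg m).+1, (mdeg m).+1} | m == (k.1 + k.2)%MM)
     f k.1 * g k.2.
Proof. by []. Qed.

Fact mpoly_ms_zmod : zmod_morphism mpoly_ms.
Proof. by move=> p q; apply: mseriesP => m /=; rewrite mcoeffB. Qed.
Fact mpoly_ms_monoid : monoid_morphism mpoly_ms.
Proof. by split=> // p q; apply: mseriesP => m; rewrite mscoefM /= mcoeffM. Qed.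
HB.instance Definition _ :=
  GRing.isZmodMorphism.Build {mpoly K[n]} S mpoly_ms mpoly_ms_zmod.
HB.instance Definition _ :=
  GRing.isMonoidMorphism.Build {mpoly K[n]} S mpoly_ms mpoly_ms_monoid.
End MSeries.

Section TateAlgebra.
Variables (R : realType) (K : fieldType) (v : valuation R K).
Variables (n : nat) (r : 'I_n -> R).
Local Notation S := (mseries n K).
Implicit Types f g : S.

Definition mweight (m : 'X_{1..n}) : R := \sum_i (m i)%:R * r i.

(* least valuation of the term f_m X^m on the polydisc v(X_i) >= r_i *)
Definition term_val f (m : 'X_{1..n}) : \bar R := (v (f m) + (mweight m)%:E)%E.

Lemma mweightD m1 m2 : mweight (m1 + m2)%MM = mweight m1 + mweight m2.
Proof.
rewrite /mweight -big_split; apply: eq_bigr => i _.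
by rewrite mnmDE natrD mulrDl.
Qed.

Lemma term_valB f g m M :
  (M%:E <= term_val f m -> M%:E <= term_val g m -> M%:E <= term_val (f - g)%R m)%E.
Proof.
by rewrite /term_val -!leeBlDr // -!EFinB mscoefB; apply: val_geB.
Qed.

Lemma term_val_monomial f g m1 m2 M N :
    (M%:E <= term_val f m1 -> N%:E <= term_val g m2 ->
     (M + N)%:E <= v (f m1 * g m2)%R + (mweight (m1 + m2)%MM)%:E)%E.
Proof.
move=> Mf Ng; rewrite val_mul mweightD EFinD [(mweight _ + _)%:E]EFinD addeACA.
exact: leeD.
Qed.

Lemma val_ge_sum (I : Type) (s : seq I) (P : pred I) (F : I -> K) (M : \bar R) :
  (forall i, P i -> (M <= v (F i))%E) -> (M <= v (\sum_(i <- s | P i) F i)%R)%E.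
Proof.
move=> MF; apply: (big_ind (fun z => (M <= v z)%E)) => //; first by rewrite val0 leey.
by move=> x y Mx My; apply: le_trans (val_add v x y); rewrite le_min Mx.
Qed.

Lemma term_valM f g m M :
    (forall m1 m2, m = (m1 + m2)%MM ->
       (M%:E <= v (f m1 * g m2)%R + (mweight m)%:E)%E) ->
  (M%:E <= term_val (f * g)%R m)%E.
Proof.
move=> H; rewrite /term_val -leeBlDr // mscoefM -EFinB.
apply: val_ge_sum => k /eqP mk; rewrite EFinB leeBlDr //; exact: H.
Qed.

Definition gauss_ge M f : Prop := forall m, (M%:E <= term_val f m)%E.

Definition restricted : {pred S} :=
  fun f => `[< forall M : R, exists N, forall m, (N <= mdeg m)%N ->
                 (M%:E <= term_val f m)%E >].

Lemma term_val_ex f m : exists M : R, (M%:E <= term_val f m)%E.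
Proof.
rewrite /term_val; case E: (v (f m)) => [x| |].
- by exists (x + mweight m).
- by exists 0; rewrite leey.
- by have := val_neq_ninfty v (f m); rewrite E.
Qed.

Lemma gauss_ex f : f \in restricted -> exists M, gauss_ge M f.
Proof.
move=> /asboolP/(_ 0)[N HN].
have [M HM] : exists M : R, forall m : 'X_{1..n < N}, (M%:E <= term_val f m)%E.
  have [F HF] := choice (fun m : 'X_{1..n < N} => term_val_ex f m).
  exists (\sum_m - `|F m|) => m; apply: le_trans (HF m); rewrite lee_fin.
  rewrite (bigD1 m) //=; apply: le_trans (_ : - `|F m| <= _); last first.
    by rewrite lerNl; apply: le_trans (ler_norm _) _; rewrite normrN.
  by rewrite gerDl; apply: sumr_le0 => i _; rewrite oppr_le0.
exists (Num.min M 0) => m; have [leNm|ltmN] := leqP N (mdeg m).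
  by apply: le_trans (HN m leNm); rewrite lee_fin ge_min lexx orbT.
by apply: le_trans (HM (BMultinom ltmN)); rewrite lee_fin ge_min lexx.
Qed.

Lemma gauss_geB M f g : gauss_ge M f -> gauss_ge M g -> gauss_ge M (f - g).
Proof. by move=> Hf Hg m; apply: term_valB. Qed.

Lemma gauss_geM M N f g : gauss_ge M f -> gauss_ge N g -> gauss_ge (M + N) (f * g).
Proof.
move=> Hf Hg m; apply: term_valM => m1 m2 ->.
exact: term_val_monomial.
Qed.

Lemma mpoly_restricted (p : {mpoly K[n]}) : mpoly_ms p \in restricted.
Proof.
apply/asboolP => M; exists (msize p) => m le_pm.
by rewrite /term_val /= memN_msupp_eq0 ?msize_mdeg_ge // val0 leey.
Qed.

Fact restricted_subring : subring_closed restricted.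
Proof.
split=> [|f g /asboolP Rf /asboolP Rg|f g Rf Rg].
- exact: mpoly_restricted.
- apply/asboolP => M; have [[Nf Hf] [Ng Hg]] := (Rf M, Rg M).
  exists (Nf + Ng)%N => m le_m; apply: term_valB; [apply: Hf|apply: Hg].
    exact: leq_trans (leq_addr _ _) le_m.
  exact: leq_trans (leq_addl _ _) le_m.
- apply/asboolP => M; have [[Bf BfP] [Bg BgP]] := (gauss_ex Rf, gauss_ex Rg).
  move/asboolP/(_ (M - Bg)): Rf => [Nf Hf]; move/asboolP/(_ (M - Bf)): Rg => [Ng Hg].
  exists (Nf + Ng)%N => m le_m; apply: term_valM => m1 m2 def_m.
  have [leNf|ltNf] := leqP Nf (mdeg m1).
    by rewrite def_m -[M](subrK Bg); apply: term_val_monomial => //; apply: Hf.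
  rewrite def_m -[M](subrK Bf) addrC; apply: term_val_monomial => //.
  apply: Hg; rewrite -(leq_add2l (mdeg m1)) -mdegD -def_m.
  by rewrite (leq_trans _ le_m) // leq_add2r ltnW.
Qed.

HB.instance Definition _ :=
  GRing.isSubringClosed.Build S restricted restricted_subring.

Record tate := Tate { tate_val :> S; tate_valP : tate_val \in restricted }.
HB.instance Definition _ := [isSub for tate_val].
HB.instance Definition _ := [Choice of tate by <:].
HB.instance Definition _ := GRing.SubChoice_isSubComPzRing.Build S
  restricted tate restricted_subring.

Definition tate_poly (p : {mpoly K[n]}) : tate := Tate (mpoly_restricted p).

Section Affinoid.
Variable gs : seq tate.

Definition affinoid : Type := quot_by gs.
HB.instance Definition _ := GRing.ComPzRing.on affinoid.

Definition to_affinoid (f : tate) : affinoid := to_quot (gen_ideal gs) f.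

(* the filtration attached to the residue norm of the Gauss norm *)
Definition affinoid_fil (M : R) (a : affinoid) : Prop :=
  exists2 f : tate, to_affinoid f = a & gauss_ge M f.

Fact affinoid_fil_le M N a : M <= N -> affinoid_fil N a -> affinoid_fil M a.
Proof.
move=> leMN [f fa Nf]; exists f => // m.
by apply: le_trans (Nf m); rewrite lee_fin.
Qed.

Fact affinoid_fil_ex a : exists M, affinoid_fil M a.
Proof.
have [M HM] := gauss_ex (tate_valP (quot_repr a)).
by exists M, (quot_repr a) => //; apply: quot_reprK.
Qed.

Fact affinoid_fil0 M : affinoid_fil M 0.
Proof.
exists 0; first exact: raddf0.
by move=> m; rewrite /term_val val0 leey.
Qed.

Fact affinoid_filB M a b :
  affinoid_fil M a -> affinoid_fil M b -> affinoid_fil M (a - b).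
Proof.
move=> [f <- Mf] [g <- Mg]; exists (f - g); first exact: raddfB.
exact: gauss_geB.
Qed.

Fact affinoid_filM M N a b :
  affinoid_fil M a -> affinoid_fil N b -> affinoid_fil (M + N) (a * b).
Proof.
move=> [f <- Mf] [g <- Ng]; exists (f * g); first exact: rmorphM.
exact: gauss_geM.
Qed.

HB.instance Definition _ := isFiltered.Build R affinoid
  affinoid_fil_le affinoid_fil_ex affinoid_fil0 affinoid_filB affinoid_filM.

Definition affinoid_const (c : K) : affinoid := to_affinoid (tate_poly c%:MP).

Fact affinoid_const_pb (c : valuation_ring v) :
  affinoid_const (vr_val c) \in @power_bounded R affinoid.
Proof.
apply/asboolP; exists 0 => k.
exists (tate_poly (vr_val c ^+ k)%:MP).
  rewrite /affinoid_const -[RHS](rmorphXn (to_quot (gen_ideal gs))).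
  congr to_quot; apply/val_inj.
  rewrite [RHS](rmorphXn val); by rewrite /= -rmorphXn -rmorphXn.
move=> m; rewrite /term_val /= mcoeffC; case: eqP => [->|_].
  rewrite mulr1 /mweight big1 ?adde0; last by move=> i _; rewrite mnm0E mul0r.
  by apply: valX_ge0; apply: vr_valP.
by rewrite mulr0 val0 leey.
Qed.

Definition pb_const (c : valuation_ring v) : power_bounded_type affinoid :=
  PowerBounded (affinoid_const_pb c).
End Affinoid.
End TateAlgebra.

Section LaurentDomain.
Variables (R : realType) (K : fieldType) (v : valuation R K).
Variables (n : nat) (r : 'I_n -> R).

Definition laurent_radius (k : 'I_(n + n)) : R :=
  match fintype.split k with inl i => r i | inr i => - r i end.

(* Series in X_1, ..., X_n and Z_1, ..., Z_n, convergent for v(X_i) >= r_i and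
   v(Z_i) >= - r_i. *)
Definition laurent_tate := tate v laurent_radius.

Definition coord (i : 'I_n) : laurent_tate :=
  tate_poly v laurent_radius 'X_(lshift n i).
Definition coord_inv (i : 'I_n) : laurent_tate :=
  tate_poly v laurent_radius 'X_(rshift n i).

Definition laurent_const (c : K) : laurent_tate :=
  tate_poly v laurent_radius c%:MP.

Definition laurent_rel : seq laurent_tate :=
  [seq coord i * coord_inv i - 1 | i <- enum 'I_n].

(* The affinoid algebra of the subspace of the polyannulus v(X_i) = r_i cut out
   by the equations gs. *)
Definition laurent_affinoid (gs : seq laurent_tate) : filteredRing R :=
  affinoid (laurent_rel ++ gs).
End LaurentDomain.

Section LubinTate.
Variables (q : nat) (A : comPzRingType).

Definition pi_u (pi u X : A) : A := X ^+ (q ^ 2) + u * X ^+ q + pi * X.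
Definition pi2_u (pi u X : A) : A := pi_u pi u (pi_u pi u X).

Definition mu2 (pi u X2 Y2 : A) : A :=
  let X1 := pi_u pi u X2 in let Y1 := pi_u pi u Y2 in
  X1 * Y2 ^+ q - X1 ^+ q * Y2 - X2 ^+ q * Y1 + X2 * Y1 ^+ q.

Definition pi_LT (pi X : A) : A := pi * X - X ^+ q.

Definition LT_generator2 (pi pi2 : A) : Prop :=
  pi_LT pi (pi_LT pi pi2) = 0 /\ pi_LT pi pi2 <> 0.
End LubinTate.

Section Y31c.
Variables (R : realType) (C : fieldType) (v : valuation R C).
Variables (q : nat) (pi pi2 : C).

(* The coordinates are u, X_1, Y_1, X_2, Y_2, in this order: X_1 and Y_1 are
   functions of the others, but their valuations are prescribed too.  The
   derivative of [pi^2]_u is the constant pi^2 and mu_2 is locally constant on the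
   torsion points, so the algebra Y31c below is etale over the functions on the
   annulus v(u) = 1/(q+1), hence reduced: there is no nilradical to divide out. *)
Definition Y31c_radius (i : 'I_5) : R :=
  let q : R := q%:R in
  [:: (q + 1)^-1;
      (q * (q ^+ 2 - 1))^-1; (q * (q ^+ 2 - 1))^-1;
      (q ^+ 3 * (q ^+ 2 - 1))^-1; (q ^+ 3 * (q ^+ 2 - 1))^-1]`_i.

Definition Y31c_equations : seq (laurent_tate v Y31c_radius) :=
  let x i := coord v Y31c_radius (@inord 4 i) in
  let u := x 0%N in
  let X1 := x 1%N in let Y1 := x 2%N in
  let X2 := x 3%N in let Y2 := x 4%N in
  let c := laurent_const v Y31c_radius in
  [:: X1 - pi_u q (c pi) u X2;
      Y1 - pi_u q (c pi) u Y2;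
      pi2_u q (c pi) u X2;
      pi2_u q (c pi) u Y2;
      mu2 q (c pi) u X2 Y2 - c pi2].

Definition Y31c : filteredRing R := laurent_affinoid Y31c_equations.

Definition Y31c_scalar (c : valuation_ring v) : reduction Y31c :=
  reduce (pb_const _ c : power_bounded_type Y31c).
End Y31c.

Section Curve.
Variables (k : fieldType) (q : nat).

Definition curve_poly : {mpoly k[2]} :=
  let x := 'X_(inord 0 : 'I_2) in let y := 'X_(inord 1 : 'I_2) in
  - x ^+ q * y ^+ (q ^ 2) + x * y ^+ (q ^ 3) - 1.

Definition curve_ring : comPzRingType := quot_by [:: curve_poly].

Definition curve_const (c : k) : curve_ring :=
  to_quot (gen_ideal [:: curve_poly]) c%:MP.
End Curve.

(* Spec of the product of a finite family of rings is the disjoint union of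
   their spectra. *)
Definition prod_ring (n : nat) (A : comPzRingType) : comPzRingType := 'I_n -> A.

(* [vF] is the normalised valuation of a local field [F] of characteristic [p]
   with uniformizer [pi] and residue field of cardinality [q]. *)
Record local_field (R : realType) (F : fieldType) (vF : valuation R F)
    (p q : nat) (pi : F) : Prop := LocalField {
  lf_char : p \in [pchar F];
  lf_complete : complete vF;
  lf_discrete : forall x, x != 0 -> exists n : int, vF x = (n%:~R)%:E;
  lf_uniformizer : vF pi = 1%:E;
  lf_residue : exists s : seq (residue_field vF),
    [/\ uniq s, size s = q & forall x, x \in s]
}.

(* [C] is the completion of the algebraic closure [Fbar] of [F] *)
Record completed_closure (R : realType) (F : fieldType) (vF : valuation R F)
    (Fbar : closedFieldType) (iota : {rmorphism F -> Fbar})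
    (C : fieldType) (v : valuation R C) (j : {rmorphism Fbar -> C}) : Prop :=
  CompletedClosure {
  cc_algebraic : forall x, algebraicOver iota x;
  cc_extends : forall x, v (j (iota x)) = vF x;
  cc_complete : complete v;
  cc_dense : forall x (M : R), exists y, (M%:E <= v (x - j y)%R)%E
}.

(* Main.v *)
From HB Require Import structures.
Require Import Defs.
From mathcomp Require Import all_boot all_order all_algebra all_field.
From mathcomp Require Import mpoly.
From mathcomp Require Import boolp functions reals constructive_ereal.
From mathcomp Require Import ring.

Set Implicit Arguments.
Unset Strict Implicit.
Unset Printing Implicit Defensive.

Import Order.TTheory GRing.Theory Num.Theory.
Local Open Scope ring_scope.

(** Why the theorem is true.  Choose a constant [k] with [k ^ (q^2 (q+1)) = - pi2]; its
    valuation is the prescribed valuation of [X_2], and every coordinate becomes a unit of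
    the unit ball when it is divided by a suitable power of [k]:
      [u = k^wt_u U], [X_1 = k^(q^2) X], [Y_1 = k^(q^2) V], [X_2 = k y], [Y_2 = k H].
    Two more functions govern the curve,
      [E = Y_1 / X_1]  and  [W = (Y_2 - E X_2) / X_1].
    Everything in sight is additive for the [q]-Frobenius, so the equations of the curve can
    be rewritten exactly in terms of them ([normalised_X1], [normalised_torsion],
    [normalised_D], [normalised_W], [normalised_D_W]).  Modulo [k] they say that
      [E^(q-1) = 1],  [X = y^(q^2)]  and  [W^q = W - y^-(q^2 (q+1))],
    the last of these being the equation [mu_2 = pi2].  The first equation splits the
    reduction into [q-1] pieces, and on each of them the last one is, with
    [x = y^(q^2) W], the equation [- x^q y^(q^2) + x y^(q^3) = 1].

    To see that these relations describe the whole reduction, let [e_i] be the interpolation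
    polynomials in [E] that cut out the pieces, [t = y^-1], and consider the combinations
      [sum_i e_i sum_(l < q) W^l c_il(t)]
    with polynomial coefficients [c_il].

    They span.  The unit ball, enlarged by [W] and by the quotient [D] of [E^q - E] by a
    constant of its size, is a bounded ring because [D] and [W] satisfy monic equations
    ([generated_subring]).  Modulo [k] all its generators are polynomials in
    [t], [y], [W] and [E], so that a power of [t] brings each of its elements into the form
    of a combination with integral coefficients ([A0_spanned]).

    They are independent.  For given [z_i], unit [y0] and solution [w0] of the
    Artin-Schreier equation there is a point of the curve at which [E], [y], [W] are
    congruent to [z_i], [y0], [w0] ([exists_point]).  Evaluation at a point is continuous,
    so a topologically nilpotent function has infinitesimal values; a combination with
    integral coefficients that is topologically nilpotent therefore vanishes at enough
    residual points to force all its coefficients to be infinitesimal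
    ([combination_independent]).

    Independence also shows that the combination which approximates a power-bounded function
    has integral coefficients, since otherwise dividing by the largest one would give a
    contradiction ([power_bounded_expansion]).  Hence the normal form is valid in the
    reduction, with uniqueness, and the same normal form holds in the product of [q-1]
    copies of the curve; matching the two gives the isomorphism ([reduction_iso]).  What
    remains is arithmetic of constants: [pi2] is algebraic with the expected valuation
    ([val_LT_generator2]). *)

(** * Valuations, units and residues *)

Section ValuationFacts.
Variables (R : realType) (K : fieldType) (v : valuation R K).
Local Notation O := (integral_elt v).
Implicit Types x y : K.

Definition infinitesimal : {pred K} := fun x => (0 < v x)%E.
Local Notation m := infinitesimal.

Lemma infinitesimalE x : (x \in m) = (0 < v x)%E.
Proof. by []. Qed.

Lemma infinitesimal_integral x : x \in m -> x \in O.
Proof. exact: ltW. Qed.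

Lemma infinitesimal0 : 0 \in m.
Proof. by rewrite infinitesimalE val0 lt0y. Qed.

Lemma infinitesimalD x y : x \in m -> y \in m -> x + y \in m.
Proof.
by move=> mx my; apply: lt_le_trans (val_add v x y); rewrite lt_min [X in X && _]mx.
Qed.

Lemma infinitesimalN x : (- x \in m) = (x \in m).
Proof. by rewrite !infinitesimalE valN. Qed.

Lemma infinitesimalB x y : x \in m -> y \in m -> x - y \in m.
Proof. by move=> mx my; rewrite infinitesimalD ?infinitesimalN. Qed.

Lemma infinitesimalMr x y : x \in O -> y \in m -> x * y \in m.
Proof. by move=> Ox my; rewrite infinitesimalE val_mul; apply: lt_le_trans my _; rewrite leeDr. Qed.

Lemma infinitesimalMl x y : x \in m -> y \in O -> x * y \in m.
Proof. by move=> mx Oy; rewrite mulrC infinitesimalMr. Qed.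

Lemma infinitesimal1 : 1 \notin m.
Proof. by rewrite infinitesimalE Defs.val1 ltxx. Qed.

Lemma integralV x : x \notin O -> x^-1 \in m.
Proof.
rewrite integral_eltE -ltNge => vx; have x0 : x != 0.
  by apply: contraTneq vx => ->; rewrite val0.
have := val_mul v x x^-1; rewrite mulfV // Defs.val1 infinitesimalE.
case: ltP => // vi; move: vx; rewrite -[X in (X < 0)%E]adde0 => vx e0.
suff: (0 < 0 :> \bar R)%E by rewrite ltxx.
by rewrite [X in (X < _)%E]e0; apply: le_lt_trans vx; apply: leeD.
Qed.

Definition vunit : {pred K} := fun x => v x == 0%E.

Lemma vunitE x : (x \in vunit) = (x \in O) && (x \notin m).
Proof. by rewrite infinitesimalE integral_eltE -leNgt andbC -eq_le. Qed.

Lemma vunit_neq0 x : x \in vunit -> x != 0.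
Proof. by apply: contraTneq => ->; rewrite vunitE infinitesimal0 andbF. Qed.

Lemma vunit_integral x : x \in vunit -> x \in O.
Proof. by rewrite vunitE => /andP[]. Qed.

Lemma vunit1 : 1 \in vunit.
Proof. exact/eqP/Defs.val1. Qed.

Lemma vunitM x y : x \in vunit -> y \in vunit -> x * y \in vunit.
Proof. by move=> /eqP vx /eqP vy; apply/eqP; rewrite val_mul vx vy adde0. Qed.

Lemma vunitN x : (- x \in vunit) = (x \in vunit).
Proof.
have E z : (z \in vunit) = (v z == 0%E) by [].
by rewrite !E valN.
Qed.

Lemma vunitX n x : x \in vunit -> x ^+ n \in vunit.
Proof.
by move=> ux; elim: n => [|n IHn]; rewrite ?expr0 ?vunit1 // exprS vunitM.
Qed.

Lemma vunitV x : x \in vunit -> x^-1 \in vunit.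
Proof.
move=> ux; apply/eqP; have := val_mul v x x^-1.
by rewrite mulfV ?vunit_neq0 // Defs.val1 (eqP ux) add0e.
Qed.

Lemma vunitD x y : x \in vunit -> y \in m -> x + y \in vunit.
Proof.
rewrite !vunitE => /andP[Ox mx] my.
apply/andP; split; first by rewrite rpredD // infinitesimal_integral.
apply: contra mx => mxy.
by rewrite -[x](addrK y) infinitesimalB.
Qed.

Lemma vunit_from x y : x \in vunit -> y - x \in m -> y \in vunit.
Proof. by move=> ux myx; rewrite -[y](subrK x) addrC vunitD. Qed.

(** If [x] is not integral, then [1 = x ^+ n * x^-1 ^+ n] is infinitesimal. *)
Lemma integralX n x : (0 < n)%N -> (x ^+ n \in O) = (x \in O).
Proof.
move=> n0; apply/idP/idP => [Oxn|]; last exact: rpredX.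
apply: contraT => nOx; have mx := integralV nOx.
have x0 : x != 0 by apply: contraNneq nOx => ->; rewrite rpred0.
case: n n0 Oxn => // n _ Oxn; suff: 1 \in m by rewrite (negPf infinitesimal1).
have -> : 1 = x ^+ n.+1 * (x^-1 * x^-1 ^+ n).
  by rewrite -exprS exprVn mulfV // expf_neq0.
apply: infinitesimalMr => //; apply: infinitesimalMl => //; apply: rpredX.
exact: infinitesimal_integral.
Qed.

Lemma infinitesimalX n x : (0 < n)%N -> (x ^+ n \in m) = (x \in m).
Proof.
move=> n0; apply/idP/idP => [mxn|mx].
  have Ox : x \in O by rewrite -(integralX x n0) infinitesimal_integral.
  apply: contraLR mxn => mx; have := @vunitX n x; rewrite !vunitE Ox mx.
  by case/(_ isT)/andP.
case: n n0 => // n _; rewrite exprS infinitesimalMl // rpredX //.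
exact: infinitesimal_integral.
Qed.

Lemma infinitesimal_pmul n x a : (0 < n)%N -> x \in m -> a \in O -> x ^+ n * a \in m.
Proof. by move=> n0 mx Oa; rewrite infinitesimalMl ?infinitesimalX. Qed.

Lemma vunit_root_of_unity n x : (0 < n)%N -> x ^+ n = 1 -> x \in vunit.
Proof.
move=> n0 xn; rewrite vunitE -(integralX x n0) -(infinitesimalX x n0) xn.
by rewrite rpred1 infinitesimal1.
Qed.

Lemma valXn x n : x != 0 -> v (x ^+ n) = (fine (v x) *+ n)%:E.
Proof.
move=> x0; elim: n => [|n IHn]; first by rewrite expr0 Defs.val1.
by rewrite exprS val_mul IHn mulrS EFinD fineK // val_fin.
Qed.

Lemma val_fine x : x != 0 -> v x = (fine (v x))%:E.
Proof. by move=> x0; rewrite fineK // val_fin. Qed.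

Lemma val_inv x : x != 0 -> v x^-1 = (- fine (v x))%:E.
Proof.
move=> x0; have xV0 : x^-1 != 0 by rewrite invr_eq0.
have := val_mul v x x^-1; rewrite mulfV // Defs.val1 (val_fine x0) (val_fine xV0) -EFinD.
by case=> /esym/eqP; rewrite addrC addr_eq0 => /eqP ->.
Qed.

Lemma val_div x y : y != 0 -> v x = v y -> x / y \in vunit.
Proof.
move=> y0 vxy; apply/eqP; have := val_mul v (x / y) y.
rewrite divfK // vxy => H; rewrite -[v (x / y)](@addeK _ (v y) _) ?val_fin //.
by rewrite -H subee ?val_fin.
Qed.

(** Extended by [0] outside the valuation ring, so that residues can be taken without
    carrying proofs of integrality. *)
Definition res (x : K) : residue_field v := residue (insubd (0 : valuation_ring v) x).

Lemma resE (c : valuation_ring v) : res (vr_val c) = residue c.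
Proof. by rewrite /res -[vr_val c]/(val c) valKd. Qed.

Lemma resD x y : x \in O -> y \in O -> res (x + y) = res x + res y.
Proof.
move=> Ox Oy; rewrite -[x]/(vr_val (ValuationRing Ox)) -[y]/(vr_val (ValuationRing Oy)).
rewrite !resE -[RHS](rmorphD (to_quot (@maximal_ideal _ _ v))).
exact: (resE (ValuationRing Ox + ValuationRing Oy)).
Qed.

Lemma resM x y : x \in O -> y \in O -> res (x * y) = res x * res y.
Proof.
move=> Ox Oy; rewrite -[x]/(vr_val (ValuationRing Ox)) -[y]/(vr_val (ValuationRing Oy)).
rewrite !resE -[RHS](rmorphM (to_quot (@maximal_ideal _ _ v))).
exact: (resE (ValuationRing Ox * ValuationRing Oy)).
Qed.

Lemma res_eq0 x : x \in O -> (res x == 0) = (x \in m).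
Proof.
move=> Ox; rewrite -[x]/(vr_val (ValuationRing Ox)) resE.
have -> : (0 : residue_field v) = to_quot (@maximal_ideal _ _ v) 0 by rewrite raddf0.
by rewrite to_quotE subr0.
Qed.

Lemma res1 : res 1 = 1.
Proof. by rewrite -[1]/(vr_val (1 : valuation_ring v)) resE. Qed.

Lemma res0 : res 0 = 0.
Proof. by apply/eqP; rewrite res_eq0 ?rpred0 // infinitesimal0. Qed.

Lemma resN x : x \in O -> res (- x) = - res x.
Proof.
move=> Ox; apply/eqP; rewrite -addr_eq0 -resD ?rpredN //.
by rewrite addNr res0.
Qed.

Lemma resX n x : x \in O -> res (x ^+ n) = res x ^+ n.
Proof.
by move=> Ox; elim: n => [|n IHn]; rewrite ?res1 // !exprS resM ?rpredX // IHn.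
Qed.

Lemma res_surj (z : residue_field v) : exists2 x, x \in O & res x = z.
Proof.
by exists (vr_val (quot_repr z)); [exact: vr_valP|rewrite resE; apply: quot_reprK].
Qed.

Lemma res_eq x y : x \in O -> y \in O -> (res x == res y) = (x - y \in m).
Proof.
by move=> Ox Oy; rewrite -subr_eq0 -resN // -resD ?rpredN // res_eq0 ?rpredB.
Qed.

Lemma resV x : x \in vunit -> res x^-1 = (res x)^-1.
Proof.
move=> ux; have Ox := vunit_integral ux; have x0 := vunit_neq0 ux.
have rx0 : res x != 0 by rewrite res_eq0 //; move: ux; rewrite vunitE => /andP[].
apply: (mulfI rx0); rewrite mulfV // -resM ?mulfV ?res1 //.
exact/vunit_integral/vunitV.
Qed.

Lemma res_sum (I : Type) (r : seq I) (F : I -> K) :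
  (forall i, F i \in O) -> res (\sum_(i <- r) F i) = \sum_(i <- r) res (F i).
Proof.
move=> OF; elim: r => [|i r IHr]; first by rewrite !big_nil res0.
by rewrite !big_cons resD ?IHr ?rpred_sum.
Qed.

Lemma res_horner (P : {poly K}) x : P \is a polyOver O -> x \in O ->
  res P.[x] = (map_poly res P).[res x].
Proof.
move=> /polyOverP OP Ox; rewrite horner_coef res_sum => [|i]; last by rewrite rpredM ?rpredX.
rewrite (@horner_coef_wide _ (size P)) ?size_poly //; apply: eq_bigr => i _.
by rewrite resM ?rpredX // resX // coef_map_id0 ?res0.
Qed.

Lemma integral_horner (P : {poly K}) x : P \is a polyOver O -> x \in O -> P.[x] \in O.
Proof.
by move=> /polyOverP OP Ox; rewrite horner_coef rpred_sum // => i _; rewrite rpredM ?rpredX.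
Qed.

Lemma res_polyP (P : {poly K}) : P \is a polyOver O ->
  map_poly res P = 0 -> forall i, P`_i \in m.
Proof.
move=> /polyOverP OP P0 i; rewrite -res_eq0 //.
by rewrite -(coef_map_id0 P i res0) P0 coef0.
Qed.

End ValuationFacts.

(** * Evaluating affinoid functions at points *)

Section TatePoly.
Variables (R : realType) (K : fieldType) (v : valuation R K).
Variables (n : nat) (r : 'I_n -> R).

Fact tate_poly_zmod : zmod_morphism (tate_poly v r).
Proof. by move=> p q; apply/val_inj; rewrite /= [mpoly_ms (p - q)]rmorphB. Qed.
Fact tate_poly_monoid : monoid_morphism (tate_poly v r).
Proof.
by split=> [|p q]; apply/val_inj; rewrite ?[RHS](rmorphM val) /= ?[mpoly_ms (p * q)]rmorphM.
Qed.
HB.instance Definition _ :=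
  GRing.isZmodMorphism.Build {mpoly K[n]} (tate v r) (tate_poly v r) tate_poly_zmod.
HB.instance Definition _ :=
  GRing.isMonoidMorphism.Build {mpoly K[n]} (tate v r) (tate_poly v r) tate_poly_monoid.

Variable gs : seq (tate v r).
Fact affinoid_const_zmod : zmod_morphism (affinoid_const gs).
Proof. by move=> c d; rewrite /affinoid_const /to_affinoid mpolyCB !raddfB. Qed.
Fact affinoid_const_monoid : monoid_morphism (affinoid_const gs).
Proof.
by split=> [|c d]; rewrite /affinoid_const /to_affinoid ?mpolyC1 ?mpolyCM ?rmorph1 ?rmorphM.
Qed.
HB.instance Definition _ :=
  GRing.isZmodMorphism.Build K (affinoid gs) (affinoid_const gs) affinoid_const_zmod.
HB.instance Definition _ :=
  GRing.isMonoidMorphism.Build K (affinoid gs) (affinoid_const gs) affinoid_const_monoid.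
End TatePoly.

Section Evaluation.
Variables (R : realType) (K : fieldType) (v : valuation R K).
Variables (n : nat) (r : 'I_n -> R) (P : 'I_n -> K).
Hypotheses (cpl : complete v) (rP : forall i, ((r i)%:E <= v (P i))%E).
Local Notation S := (mseries n K).
Implicit Types (f g : S) (p : {mpoly K[n]}).

Lemma val_monomial (m : 'X_{1..n}) :
  ((Defs.mweight r m)%:E <= v (\prod_i P i ^+ m i)%R)%E.
Proof.
have vX i k : ((k%:R * r i)%:E <= v (P i ^+ k)%R)%E.
  elim: k => [|k IHk]; first by rewrite mul0r Defs.val1.
  by rewrite exprS val_mul -natr1 addrC mulrDl mul1r EFinD leeD.
rewrite /Defs.mweight; elim/big_rec2: _ => [|i x y _ IH]; first by rewrite Defs.val1.
by rewrite val_mul EFinD leeD.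
Qed.

Lemma gauss_ge_eval M p : gauss_ge v r M (mpoly_ms p) -> (M%:E <= v p.@[P])%E.
Proof.
move=> Mp; rewrite mevalE; apply: val_ge_sum => m _.
apply: le_trans (Mp m) _; rewrite val_mul; apply: leeD => //.
exact: val_monomial.
Qed.

Lemma gauss_ge_le M N f : M <= N -> gauss_ge v r N f -> gauss_ge v r M f.
Proof. by move=> leMN Nf m; apply: le_trans (Nf m); rewrite lee_fin. Qed.

Lemma gauss_geN M f : gauss_ge v r M f -> gauss_ge v r M (- f).
Proof.
move=> Mf m; apply: le_trans (Mf m) _.
by rewrite /term_val -[(- f) m]/(- f m) valN.
Qed.

Lemma gauss_geD M f g :
  gauss_ge v r M f -> gauss_ge v r M g -> gauss_ge v r M (f + g).
Proof. by move=> Mf Mg; rewrite -[g]opprK; apply: gauss_geB => //; apply: gauss_geN. Qed.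

Lemma gauss_trunc f : f \in restricted v r ->
  forall M, exists N, gauss_ge v r M (f - mpoly_ms (ms_trunc N f)).
Proof.
move=> /asboolP Rf M; have [N HN] := Rf M; exists N => m.
rewrite /term_val mscoefB /=; have [le_Nm|lt_mN] := leqP N (mdeg m).
  rewrite [X in f m - X](_ : _ = 0) ?subr0; first exact: HN.
  rewrite /ms_trunc raddf_sum big1 // => k _ /=.
  rewrite mcoeffZ mcoeffX; case: eqP => [e|_]; last by rewrite mulr0.
  by move: (bmdeg k); rewrite e ltnNge le_Nm.
by rewrite ms_truncE // subrr val0 leey.
Qed.

(** Values are pinned down by polynomial approximation, which makes them unique and
    compatible with the ring operations before any limit is taken. *)
Definition series_value f (c : K) := forall M : R,
  exists p, gauss_ge v r M (f - mpoly_ms p) /\ (M%:E <= v (c - p.@[P])%R)%E.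

Lemma series_value_bound f c M :
  gauss_ge v r M f -> series_value f c -> (M%:E <= v c)%E.
Proof.
move=> Mf /(_ M)[p [Mfp Mcp]].
have Mp : gauss_ge v r M (mpoly_ms p).
  have -> : mpoly_ms p = f - (f - mpoly_ms p) by ring.
  exact: gauss_geB.
rewrite -[c](subrK p.@[P]); apply: le_trans (val_add v _ _).
by rewrite le_min Mcp gauss_ge_eval.
Qed.

Lemma series_value_poly p : series_value (mpoly_ms p) p.@[P].
Proof.
by move=> M; exists p; rewrite !subrr val0 leey; split=> // m; rewrite /term_val val0 leey.
Qed.

Lemma series_valueB f g c d :
  series_value f c -> series_value g d -> series_value (f - g) (c - d).
Proof.
move=> fc gd M; have [[p [Mp vp]] [q [Mq vq]]] := (fc M, gd M).
exists (p - q); rewrite mevalB rmorphB /=; split.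
  have -> : f - g - (mpoly_ms p - mpoly_ms q) = (f - mpoly_ms p) - (g - mpoly_ms q).
    by ring.
  exact: gauss_geB.
have -> : c - d - (p.@[P] - q.@[P]) = (c - p.@[P]) - (d - q.@[P]) by ring.
exact: val_geB.
Qed.

Lemma series_value_unique f c d : series_value f c -> series_value f d -> c = d.
Proof.
move=> fc fd; have := series_valueB fc fd; rewrite subrr => f0.
apply/eqP; rewrite -subr_eq0; apply: contraT => cd0; have e := val_fine v cd0.
have : ((fine (v (c - d)) + 1)%R%:E <= v (c - d)%R)%E.
  by apply: series_value_bound f0 => m; rewrite /term_val val0 leey.
by rewrite {2}e lee_fin gerDl ler10.
Qed.

(** Each factor is approximated to a precision that makes up for the lower bound [B] on
    the other one. *)
Lemma series_valueM f g c d : f \in restricted v r -> g \in restricted v r ->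
  series_value f c -> series_value g d -> series_value (f * g) (c * d).
Proof.
move=> Rf Rg fc gd M.
have [Bf HBf] := gauss_ex Rf; have [Bg HBg] := gauss_ex Rg.
pose B := Num.min (Num.min Bf Bg) 0.
have Hf : gauss_ge v r B f by apply: gauss_ge_le HBf; rewrite !ge_min lexx.
have Hg : gauss_ge v r B g by apply: gauss_ge_le HBg; rewrite !ge_min lexx orbT.
pose N := Num.max (M - B) B.
have [[p [Np vp]] [q [Nq vq]]] := (fc N, gd N).
have NB : gauss_ge v r B (g - mpoly_ms q) by apply: gauss_ge_le Nq; rewrite le_max lexx orbT.
have NM : gauss_ge v r (M - B) (g - mpoly_ms q) by apply: gauss_ge_le Nq; rewrite le_max lexx.
have PM : gauss_ge v r (M - B) (f - mpoly_ms p) by apply: gauss_ge_le Np; rewrite le_max lexx.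
have Bq : gauss_ge v r B (mpoly_ms q).
  have -> : mpoly_ms q = g - (g - mpoly_ms q) by ring.
  exact: gauss_geB.
exists (p * q); rewrite rmorphM mevalM /=; split.
  have -> : f * g - mpoly_ms p * mpoly_ms q =
    f * (g - mpoly_ms q) + (f - mpoly_ms p) * mpoly_ms q by ring.
  apply: gauss_geD; last by rewrite -[M](subrK B); apply: gauss_geM.
  by rewrite -[M](subrK B) addrC; apply: gauss_geM.
have -> : c * d - p.@[P] * q.@[P] = (d - q.@[P]) * c + (c - p.@[P]) * q.@[P] by ring.
apply: le_trans (val_add v _ _); rewrite le_min !val_mul -[M](subrK B) EFinD.
have le1 : ((M - B)%:E <= N%:E)%E by rewrite lee_fin le_max lexx.
by rewrite !leeD ?(le_trans le1) ?(series_value_bound Hf fc) ?gauss_ge_eval.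
Qed.

(** The values of the truncations of [f] form a Cauchy sequence. *)
Lemma series_value_ex f : f \in restricted v r -> exists c, series_value f c.
Proof.
move=> Rf; have [N HN] := choice (fun k : nat => gauss_trunc Rf k%:R).
pose s k := (ms_trunc (N k) f).@[P].
have bnd (M : R) k l : M <= k%:R -> M <= l%:R -> (M%:E <= v (s k - s l)%R)%E.
  move=> Mk Ml; rewrite /s -mevalB; apply: gauss_ge_eval; rewrite rmorphB /=.
  set a := mpoly_ms _; set b := mpoly_ms _.
  have -> : a - b = (f - b) - (f - a) by ring.
  by apply: gauss_geB; apply: gauss_ge_le (HN _).
have archi (M : R) : exists k : nat, M <= k%:R.
  by exists (Num.truncn `|M|).+1; apply: le_trans (ler_norm M) _; rewrite ltW // truncnS_gt.
have [M|c Hc] := cpl (s := s).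
  have [k Mk] := archi M; exists k => i j le_ki le_kj.
  by apply: bnd; apply: le_trans Mk _; rewrite ler_nat.
exists c => M; have [k Mk] := archi M; have [l Hl] := Hc M.
exists (ms_trunc (N (maxn k l)) f); split.
  by apply: gauss_ge_le (HN _); apply: le_trans Mk _; rewrite ler_nat leq_maxl.
by rewrite -valN opprB; apply: Hl; rewrite leq_maxr.
Qed.

Definition tate_eval (f : tate v r) : K := projT1 (cid (series_value_ex (tate_valP f))).

Lemma tate_evalP (f : tate v r) : series_value (tate_val f) (tate_eval f).
Proof. by rewrite /tate_eval; case: cid. Qed.

Fact tate_eval_zmod : zmod_morphism tate_eval.
Proof.
move=> f g; apply: (series_value_unique (tate_evalP (f - g))).
exact: series_valueB (tate_evalP f) (tate_evalP g).
Qed.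

Lemma tate_eval_poly p : tate_eval (tate_poly v r p) = p.@[P].
Proof. exact: (series_value_unique (tate_evalP (tate_poly v r p)) (series_value_poly p)). Qed.

Fact tate_eval_monoid : monoid_morphism tate_eval.
Proof.
split=> [|f g]; first by rewrite -(rmorph1 (tate_poly v r)) tate_eval_poly meval1.
apply: (series_value_unique (tate_evalP (f * g))).
exact: series_valueM (tate_valP f) (tate_valP g) (tate_evalP f) (tate_evalP g).
Qed.

HB.instance Definition _ := GRing.isZmodMorphism.Build (tate v r) K tate_eval tate_eval_zmod.
HB.instance Definition _ :=
  GRing.isMonoidMorphism.Build (tate v r) K tate_eval tate_eval_monoid.

Section Quotient.
Variable gs : seq (tate v r).
Hypothesis gsP : forall h : tate v r, h \in gs -> tate_eval h = 0.

Lemma tate_eval_ideal (f : tate v r) : f \in gen_ideal gs -> tate_eval f = 0.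
Proof.
move=> /asboolP[c ->]; rewrite rmorph_sum big1 // => i _.
by rewrite rmorphM /= [X in _ * X]gsP ?mulr0 // mem_nth.
Qed.

(** The vanishing of [gs] is made part of the definition so that the ring morphism
    structure below can be inferred from the function alone. *)
Definition affinoid_eval (a : affinoid gs) : K := let _ := gsP in tate_eval (quot_repr a).

Lemma affinoid_evalE (f : tate v r) : affinoid_eval (to_affinoid gs f) = tate_eval f.
Proof.
apply/eqP; rewrite -subr_eq0 -rmorphB; apply/eqP/tate_eval_ideal.
by rewrite -to_quotE quot_reprK.
Qed.

Fact affinoid_eval_zmod : zmod_morphism affinoid_eval.
Proof.
move=> a b; rewrite -[a]quot_reprK -[b]quot_reprK.
have E (f : tate v r) : affinoid_eval (to_quot (gen_ideal gs) f) = tate_eval f.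
  exact: affinoid_evalE.
by rewrite -raddfB /= !E raddfB.
Qed.

Fact affinoid_eval_monoid : monoid_morphism affinoid_eval.
Proof.
have E (f : tate v r) : affinoid_eval (to_quot (gen_ideal gs) f) = tate_eval f.
  exact: affinoid_evalE.
split=> [|a b]; first by rewrite -(rmorph1 (to_quot (gen_ideal gs))) /= E rmorph1.
by rewrite -[a]quot_reprK -[b]quot_reprK -rmorphM /= !E rmorphM.
Qed.

HB.instance Definition _ :=
  GRing.isZmodMorphism.Build (affinoid gs) K affinoid_eval affinoid_eval_zmod.
HB.instance Definition _ :=
  GRing.isMonoidMorphism.Build (affinoid gs) K affinoid_eval affinoid_eval_monoid.

Lemma affinoid_eval_bound M a : affinoid_fil M a -> (M%:E <= v (affinoid_eval a))%E.
Proof.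
move=> [f <- Mf]; rewrite affinoid_evalE.
exact: series_value_bound Mf (tate_evalP f).
Qed.

Lemma affinoid_eval_const c : affinoid_eval (affinoid_const gs c) = c.
Proof. by rewrite affinoid_evalE tate_eval_poly mevalC. Qed.

(** Some power of the value has valuation at least [1]. *)
Lemma affinoid_eval_tn (a : affinoid gs) :
  a \in @top_nilpotent R (affinoid gs) -> affinoid_eval a \in infinitesimal v.
Proof.
move=> /asboolP/(_ 1)[N HN].
have := affinoid_eval_bound (HN N.+1 (leqnSn N)); rewrite rmorphXn => vN.
rewrite -(@infinitesimalX _ _ _ N.+1) // infinitesimalE.
by apply: lt_le_trans vN; rewrite lte_fin ltr01.
Qed.

End Quotient.
End Evaluation.

(** * Frobenius and roots in algebraically closed fields *)

Section Characteristic.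

(** The enumeration makes [K] a finite ring, and those of prime characteristic have prime
    power order. *)
Lemma finite_field_card (K : fieldType) (p : nat) (s : seq K) :
  p \in [pchar K] -> uniq s -> (forall x, x \in s) ->
  exists2 f, (0 < f)%N & size s = (p ^ f)%N.
Proof.
move=> pK us sP.
have gK : pcancel (index^~ s) (fun n => Some (nth 0 s n)).
  by move=> x; rewrite /= nth_index.
have sF : Finite.axiom s by move=> x; rewrite count_uniq_mem // sP.
pose K' : finNzRingType := HB.pack K (PCanIsCountable gK) (isFinite.Build K sF).
have sz : size s = #|K'|.
  rewrite cardE; apply/perm_size/uniq_perm => //; first exact: enum_uniq.
  by move=> x; rewrite sP; apply/esym; rewrite (@mem_enum K').
have pK' : p \in [pchar K'] by [].
rewrite sz (card_pprimeChar pK'); exists (logn p #|K'|) => //.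
rewrite lt0n; apply/eqP => l0; have := card_pprimeChar pK'.
by rewrite l0 expn0 => c1; have := finNzRing_gt1 K'; rewrite c1.
Qed.

Lemma frobeniusD (A : comPzRingType) (p f q : nat) : q = (p ^ f)%N -> prime p ->
  p%:R = 0 :> A -> {morph (fun x : A => x ^+ q) : x y / x + y}.
Proof.
move=> -> pp p0 x y.
(* the zero ring has no characteristic and is treated apart *)
have [A1|A1] := eqVneq (1 : A) 0.
  by have A0 (z : A) : z = 0; [rewrite -[z]mul1r A1 mul0r | rewrite [LHS]A0 [RHS]A0].
pose A' : comNzRingType := HB.pack A (GRing.PzSemiRing_isNonZero.Build A A1).
have pA' : p \in [pchar A'] by rewrite inE pp; apply/eqP.
by rewrite /= (@exprDn_pchar A') // pnatX pnatE // pA'.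
Qed.

End Characteristic.

Section ClosedFieldRoots.

(** The derivative of ['X^q - 'X] is [-1], so its roots are simple. *)
Lemma frobenius_roots (K : closedFieldType) (p f : nat) : p \in [pchar K] ->
  (0 < f)%N -> exists s : seq K,
  [/\ uniq s, size s = (p ^ f)%N & forall z, z \in s -> z ^+ (p ^ f) = z].
Proof.
move=> pK f0; set q := (p ^ f)%N.
have pp : prime p := pcharf_prime pK.
have q1 : (1 < q)%N by rewrite -(exp1n f) ltn_exp2r // prime_gt1.
pose P : {poly K} := 'X^q - 'X.
have sP : size P = q.+1.
  by rewrite size_polyDl size_polyXn // size_polyN size_polyX ltnS.
have mP : P \is monic.
  rewrite monicE lead_coefDl ?lead_coefXn // size_polyXn size_polyN size_polyX.
  by rewrite ltnS.
have [r rP] := closed_field_poly_normal P.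
move: rP; rewrite (monicP mP) scale1r => rP.
exists r; split.
- rewrite -separable_prod_XsubC -rP unlock derivB derivXn derivX.
  have -> : ('X^(q.-1) : {poly K}) *+ q = 0.
    rewrite -mulr_natr -polyC_natr natrX (pcharf0 pK) expr0n.
    by rewrite eqn0Ngt f0 mulr0.
  by rewrite sub0r -scaleN1r coprimepZr ?coprimep1 // oppr_eq0 oner_eq0.
- by have := congr1 (fun Q : {poly K} => size Q) rP; rewrite sP size_prod_XsubC => -[].
- move=> z; rewrite -root_prod_XsubC -rP rootE !hornerE.
  by rewrite subr_eq0 => /eqP.
Qed.

Lemma closed_root_exp (K : closedFieldType) (n : nat) (a : K) : (0 < n)%N ->
  exists x, x ^+ n = a.
Proof.
move=> n0; have /closed_rootP[x] : size ('X^n - a%:P : {poly K}) != 1.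
  rewrite size_polyDl size_polyXn ?eqSS -?lt0n //.
  by rewrite size_polyN size_polyC ltnS (leq_trans (leq_b1 _)).
by rewrite rootE !hornerE subr_eq0 => /eqP xn; exists x.
Qed.

Variables (R : realType) (K : closedFieldType) (v : valuation R K).
Local Notation O := (integral_elt v).
Local Notation m := (infinitesimal v).

(** The logarithmic derivative is the sum of the [1 / (a - r)], which are integral. *)
Lemma deriv_prod_XsubC (s : seq K) (a : K) : (forall r, r \in s -> a - r \notin m) ->
  exists2 b, b \in O &
    ((\prod_(r <- s) ('X - r%:P))^`()).[a] = (\prod_(r <- s) ('X - r%:P)).[a] * b.
Proof.
elim: s => [|r s IHs] sP; first by exists 0; rewrite ?rpred0 // big_nil mulr0 derivC horner0.
have [b Ob Hb] := IHs (fun x xs => sP x (mem_behead (s := r :: s) xs)).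
have ar : a - r \notin m by apply: sP; rewrite mem_head.
have ar0 : a - r != 0 by apply: contraNneq ar => ->; apply: infinitesimal0.
exists ((a - r)^-1 + b).
  rewrite rpredD //; apply: contraR ar => /integralV.
  by rewrite invrK.
rewrite big_cons derivM derivXsubC mul1r hornerD !hornerM hornerXsubC Hb.
by field.
Qed.

(** A form of Hensel's lemma: if no root of [P] were congruent to [a], the logarithmic
    derivative of [P] at [a] would be integral. *)
Lemma near_root (P : {poly K}) (a : K) :
  P.[a] \in m -> P^`().[a] \in vunit v -> exists2 r, P.[r] = 0 & a - r \in m.
Proof.
move=> Pa dPa; have [s sP] := closed_field_poly_normal P.
have [/hasP[r rs mr]|/hasPn nos] := boolP (has (fun r => a - r \in m) s).
  exists r => //; apply/eqP; rewrite sP hornerZ mulf_eq0; apply/orP; right.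
  by rewrite -[_ == 0]/(root _ r) root_prod_XsubC.
have [b Ob Hb] := deriv_prod_XsubC nos.
move: dPa; rewrite vunitE => /andP[_ /negP[]].
by rewrite sP derivZ hornerZ Hb mulrA -hornerZ -sP infinitesimalMl.
Qed.

(** For a root [x] that is not integral, dividing the equation by the leading power of [x]
    would write [1] as a sum of infinitesimals. *)
Lemma monic_integral_root (P : {poly K}) : P \is monic -> (1 < size P)%N ->
  P \is a polyOver O -> exists2 x, P.[x] = 0 & x \in O.
Proof.
move=> mP sP OP.
have /closed_rootP[x rx] : size P != 1 by rewrite neq_ltn sP orbT.
exists x; first exact/eqP.
apply: contraT => nOx; have mx := integralV nOx.
have x0 : x != 0 by apply: contraNneq nOx => ->; rewrite rpred0.
have: 1 \in m; last by rewrite (negPf (infinitesimal1 v)).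
have [n sn] : exists n, size P = n.+2 by case: (size P) sP => [|[|n]] // _; exists n.
have := rx; rewrite rootE horner_coef sn big_ord_recr /=.
have -> : P`_n.+1 = 1 by move/monicP: mP; rewrite lead_coefE sn.
rewrite mul1r addr_eq0 -eqr_oppLR => /eqP e.
have -> : 1 = - \sum_(i < n.+1) P`_i * x^-1 ^+ (n.+1 - i).
  rewrite -(mulfV (expf_neq0 n.+1 x0)) -{1}e mulNr mulr_suml.
  congr (- _); apply: eq_bigr => i _; rewrite -mulrA; congr (_ * _).
  rewrite exprVn; apply: (mulfI (expf_neq0 (n.+1 - i) x0)).
  by rewrite mulrA -exprD subnK ?mulfV ?expf_neq0 // ltnW.
rewrite infinitesimalN; apply: (big_ind (fun z => z \in m)) => [||i _].
- exact: infinitesimal0.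
- by move=> *; apply: infinitesimalD.
- rewrite infinitesimalMr ?infinitesimalX ?subn_gt0 //.
  exact: (polyOverP OP).
Qed.

End ClosedFieldRoots.

(** * Identities for the Lubin-Tate pairing *)

Section LubinTateIdentities.
Variables (A : comPzRingType) (q : nat).
Hypotheses (q_gt0 : (0 < q)%N) (frD : {morph (fun x : A => x ^+ q) : x y / x + y}).
Variables (pi u : A).
Local Notation "[ 'pi' ]" := (pi_u q pi u).

Lemma frE (x y : A) : (x + y) ^+ q = x ^+ q + y ^+ q.
Proof. exact: frD. Qed.

Lemma frM (x y : A) : (x * y) ^+ q = x ^+ q * y ^+ q.
Proof. exact: exprMn. Qed.

Lemma frN (x : A) : (- x) ^+ q = - x ^+ q.
Proof.
apply/eqP; rewrite -addr_eq0; apply/eqP.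
by have := frD (- x) x; rewrite addNr expr0n gtn_eqF.
Qed.

Lemma frB (x y : A) : (x - y) ^+ q = x ^+ q - y ^+ q.
Proof. by have /= -> := frD x (- y); rewrite frN. Qed.

(** In terms of iterated [q]-th powers, so that additivity of the Frobenius applies. *)
Lemma pi_uE (x : A) : [pi] x = (x ^+ q) ^+ q + u * x ^+ q + pi * x.
Proof. by rewrite /pi_u -exprM mulnn. Qed.

Lemma pi_u_factor (x : A) : [pi] x = x * (x ^+ (q ^ 2).-1 + u * x ^+ q.-1 + pi).
Proof.
have e a : (0 < a)%N -> x ^+ a = x * x ^+ a.-1 by move=> a0; rewrite -exprS prednK.
by rewrite /pi_u (e q) // (e (q ^ 2)%N) ?expn_gt0 ?q_gt0 //; ring.
Qed.

Lemma pi_uD (x y : A) : [pi] (x + y) = [pi] x + [pi] y.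
Proof. by rewrite !pi_uE !frE; ring. Qed.

Lemma pi_uZ (z x : A) : z ^+ q = z -> [pi] (z * x) = z * [pi] x.
Proof. by move=> zq; rewrite !pi_uE !frM !zq; ring. Qed.

Lemma mu2E (x y : A) : mu2 q pi u x y =
  [pi] x * y ^+ q - [pi] x ^+ q * y - x ^+ q * [pi] y + x * [pi] y ^+ q.
Proof. by []. Qed.

(** The pairing of two [pi]-torsion points is a [pi]-torsion point of the Lubin-Tate group:
    the right-hand side measures how far [y] is from being torsion. *)
Lemma pi_LT_pairing1 (x y : A) : [pi] x = 0 ->
  pi_LT q pi (x * y ^+ q - x ^+ q * y) = - (x ^+ q * [pi] y).
Proof.
rewrite !pi_uE /pi_LT frB !frM => x0.
have -> : (x ^+ q) ^+ q = - (u * x ^+ q + pi * x).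
  by apply/eqP; rewrite -addr_eq0 addrA x0.
by ring.
Qed.

(** The analogue for [pi^2]-torsion: up to the defect of torsion of [y], the Lubin-Tate
    endomorphism carries [mu2] to the pairing of the images under [pi]_u. *)
Lemma pi_LT_mu2 (x y : A) : pi2_u q pi u x = 0 ->
  pi_LT q pi (mu2 q pi u x y) =
  ([pi] x * [pi] y ^+ q - [pi] x ^+ q * [pi] y) - x ^+ q * pi2_u q pi u y.
Proof.
rewrite /pi2_u mu2E /pi_LT.
have [[x1 ex] [y1 ey]] : (exists z, z = [pi] x) /\ (exists z, z = [pi] y).
  by split; eexists.
rewrite -!ex -!ey => xx.
have X : (x ^+ q) ^+ q = x1 - u * x ^+ q - pi * x by rewrite ex pi_uE; ring.
have Y : (y ^+ q) ^+ q = y1 - u * y ^+ q - pi * y by rewrite ey pi_uE; ring.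
have X1 : (x1 ^+ q) ^+ q = - (u * x1 ^+ q) - pi * x1.
  by move: xx; rewrite pi_uE => /eqP; rewrite -addrA addr_eq0 => /eqP ->; ring.
rewrite pi_uE frE !frB !frM X Y X1.
by ring.
Qed.

(** [mu2] is bilinear over the fixed points of the Frobenius, and alternating. *)
Lemma mu2_shift (z x y : A) : z ^+ q = z ->
  mu2 q pi u x (z * x + y) = mu2 q pi u x y.
Proof.
move=> zq; rewrite !mu2E pi_uD pi_uZ //; move: ([pi] x) ([pi] y) => x1 y1.
rewrite !frE !frM !zq.
by ring.
Qed.

End LubinTateIdentities.

Section LubinTateMorphisms.
Variables (A B : comPzRingType) (g : {rmorphism A -> B}) (q : nat).

Lemma rmorph_pi_u pi u x : g (pi_u q pi u x) = pi_u q (g pi) (g u) (g x).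
Proof. by rewrite /pi_u !rmorphD !rmorphM !rmorphXn. Qed.

Lemma rmorph_mu2 pi u x y : g (mu2 q pi u x y) = mu2 q (g pi) (g u) (g x) (g y).
Proof.
by rewrite !mu2E rmorphD !rmorphB !rmorphM !rmorphXn !rmorph_pi_u.
Qed.
End LubinTateMorphisms.

(** * The equations of the curve in normalised coordinates *)

Section Exponents.
Local Open Scope nat_scope.
Variable q : nat.
(** The valuations of [u], of [pi] and of [E^q - E] for [E = Y_1 / X_1], in units of
    [v(X_2)]. *)
Definition wt_u := q ^ 3 * q.-1.
Definition wt_pi := q ^ 3 * (q.-1 * q.+1).
Definition wt_D := q ^ 2 * (q.-1 * q.+1).
(** By how much the secondary terms of the normalised equations exceed the dominant
    ones, in the same unit. *)
Definition gap1 := q * (q.-1 * (q.-1 * q.+1)).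
Definition gap2 := (q.-1 * q.+1) ^ 2.
Definition gap3 := q ^ 2 * (q.-1 * (q.-1 * q.+1)).
Definition gap4 := (q.-1 * q.+1) * (q.-1 * (q ^ 2 + q + 1)).

Lemma gaps_gt0 : 1 < q -> [/\ 0 < gap1, 0 < gap2, 0 < gap3 & 0 < gap4].
Proof.
move=> q1; have q0 : 0 < q by apply: ltnW.
have s0 : 0 < q.-1 by rewrite -ltnS prednK.
by split; rewrite ?muln_gt0 ?expn_gt0 /= ?muln_gt0 /= ?q0 ?s0 // addn1.
Qed.
End Exponents.

Section ExactIdentities.
Variables (A : comPzRingType) (q : nat).
Hypotheses (frD : {morph (fun x : A => x ^+ q) : x y / x + y}).
Variables (pi pi2 u X1 Y1 X2 Y2 E D W : A).
Hypotheses (X1E : X1 = pi_u q pi u X2) (Y1E : Y1 = pi_u q pi u Y2).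
Hypotheses (X2E : pi2_u q pi u X2 = 0) (Y2E : pi2_u q pi u Y2 = 0).
Hypothesis mu2E : mu2 q pi u X2 Y2 = pi2.
Hypotheses (Y1X1 : Y1 = E * X1) (Y2W : Y2 = X1 * W + E * X2) (frEq : E ^+ q = E + D).

Let frfrE : (E ^+ q) ^+ q = E + D + D ^+ q.
Proof. by rewrite frEq frE // frEq. Qed.

Lemma X1_torsion : (X1 ^+ q) ^+ q + u * X1 ^+ q + pi * X1 = 0.
Proof. by rewrite -pi_uE X1E. Qed.

(** [X1] and [E * X1] are both torsion; subtracting [E + D] times the first torsion equation
    from the second leaves [D] only. *)
Lemma D_identity : D ^+ q * (X1 ^+ q) ^+ q = pi * X1 * D.
Proof.
have Y : (E + D + D ^+ q) * (X1 ^+ q) ^+ q + u * ((E + D) * X1 ^+ q) + pi * (E * X1) = 0.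
  by have := Y2E; rewrite /pi2_u -Y1E Y1X1 pi_uE !frM // frfrE frEq.
have -> : D ^+ q * (X1 ^+ q) ^+ q =
    ((E + D + D ^+ q) * (X1 ^+ q) ^+ q + u * ((E + D) * X1 ^+ q) + pi * (E * X1))
    - (E + D) * ((X1 ^+ q) ^+ q + u * X1 ^+ q + pi * X1) + pi * X1 * D by ring.
by rewrite Y X1_torsion; ring.
Qed.

(** After substitution of [Y2], the function [E] enters [mu2] only through
    [D = E ^+ q - E]. *)
Lemma W_identity :
  X1 * X1 ^+ q * (W ^+ q - W) + D * (X1 * X2 ^+ q + X2 * X1 ^+ q) = pi2.
Proof.
have := mu2E; rewrite /mu2 -X1E -Y1E Y2W Y1X1 frE // !frM // frEq => <-.
by ring.
Qed.

(** This is [Y1 = pi_u q pi u Y2] with [Y2] substituted, minus [E] times the same equation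
    for [X1]. *)
Lemma D_W_identity :
  (X1 ^+ q) ^+ q * (W ^+ q) ^+ q + u * (X1 ^+ q * W ^+ q) + pi * (X1 * W)
    + (D ^+ q + D) * (X2 ^+ q) ^+ q + u * D * X2 ^+ q = 0.
Proof.
have Y : E * X1 = (X1 ^+ q) ^+ q * (W ^+ q) ^+ q + (E + D + D ^+ q) * (X2 ^+ q) ^+ q
    + u * (X1 ^+ q * W ^+ q + (E + D) * X2 ^+ q) + pi * (X1 * W + E * X2).
  rewrite -Y1X1 Y1E pi_uE Y2W !frE // !frM frfrE frEq.
  by [].
have X : X1 = (X2 ^+ q) ^+ q + u * X2 ^+ q + pi * X2 by rewrite X1E pi_uE.
have -> : (X1 ^+ q) ^+ q * (W ^+ q) ^+ q + u * (X1 ^+ q * W ^+ q) + pi * (X1 * W)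
    + (D ^+ q + D) * (X2 ^+ q) ^+ q + u * D * X2 ^+ q =
    ((X1 ^+ q) ^+ q * (W ^+ q) ^+ q + (E + D + D ^+ q) * (X2 ^+ q) ^+ q
    + u * (X1 ^+ q * W ^+ q + (E + D) * X2 ^+ q) + pi * (X1 * W + E * X2))
    - E * ((X2 ^+ q) ^+ q + u * X2 ^+ q + pi * X2) by ring.
by rewrite -Y -X subrr.
Qed.

End ExactIdentities.

Section NormalisedIdentities.
Variables (A : comPzRingType) (q : nat).
Hypotheses (q_gt1 : (1 < q)%N) (frD : {morph (fun x : A => x ^+ q) : x y / x + y}).
Variables (k k' U P X V y H E D W : A).
Hypothesis kK : k' * k = 1.
Let pi := k ^+ wt_pi q * P.
Let u := k ^+ wt_u q * U.
Hypotheses (X1E : k ^+ (q ^ 2) * X = pi_u q pi u (k * y))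
  (Y1E : k ^+ (q ^ 2) * V = pi_u q pi u (k * H))
  (X2E : pi2_u q pi u (k * y) = 0) (Y2E : pi2_u q pi u (k * H) = 0)
  (mu2E : mu2 q pi u (k * y) (k * H) = - k ^+ (q ^ 2 * q.+1)).
Hypotheses (VX : V = E * X) (HW : k * H = k ^+ (q ^ 2) * X * W + E * (k * y))
  (frEq : E ^+ q = E + k ^+ wt_D q * D).

Lemma exp_cancel n (a b : A) : k ^+ n * a = k ^+ n * b -> a = b.
Proof.
move=> e; have kKn : k' ^+ n * k ^+ n = 1 by rewrite -exprMn kK expr1n.
by rewrite -[a]mul1r -[b]mul1r -kKn -!mulrA e.
Qed.

Let q0 : (0 < q)%N := ltnW q_gt1.
Let kM n l h : (n + l = h)%N -> k ^+ n * k ^+ l = k ^+ h.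
Proof. by move=> <-; rewrite exprD. Qed.
Let kX n l : (n * q = l)%N -> (k ^+ n) ^+ q = k ^+ l.
Proof. by move=> <-; rewrite exprM. Qed.
Let X1q : (k ^+ (q ^ 2) * X) ^+ q = k ^+ (q ^ 3) * X ^+ q.
Proof. by rewrite frM (@kX _ (q ^ 3)) // -expnSr. Qed.
Let X1qq : (k ^+ (q ^ 3) * X ^+ q) ^+ q = k ^+ (q ^ 4) * (X ^+ q) ^+ q.
Proof. by rewrite frM (@kX _ (q ^ 4)) // -expnSr. Qed.
Let Dq : (k ^+ wt_D q * D) ^+ q = k ^+ (wt_D q * q) * D ^+ q.
Proof. by rewrite frM (@kX _ (wt_D q * q)). Qed.

Ltac wt := case: q q_gt1 => // s _; rewrite /wt_D /wt_pi /wt_u /gap1 /gap2 /gap3 /gap4 /=; ring.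

(** This equation and the next four are exact ones, divided by their dominant power of [k]. *)
Lemma normalised_X1 :
  X = (y ^+ q) ^+ q + k ^+ gap1 q * (U * y ^+ q) + k ^+ gap4 q * (P * y).
Proof.
apply: (@exp_cancel (q ^ 2)); rewrite X1E pi_uE /u /pi !frM.
rewrite (_ : (k ^+ q) ^+ q = k ^+ (q ^ 2)); last by rewrite -exprM mulnn.
have e1 : k ^+ wt_u q * k ^+ q = k ^+ (q ^ 2) * k ^+ gap1 q by rewrite -!exprD; congr (_ ^+ _); wt.
have e2 : k ^+ wt_pi q * k = k ^+ (q ^ 2) * k ^+ gap4 q.
  by rewrite -{2}[k]expr1 -!exprD; congr (_ ^+ _); wt.
by ring: e1 e2.
Qed.

Lemma normalised_torsion :
  (X ^+ q) ^+ q + U * X ^+ q + k ^+ gap3 q * (P * X) = 0.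
Proof.
have := X1_torsion X1E X2E; rewrite X1q X1qq /u /pi => T.
apply: (@exp_cancel (q ^ 4)); rewrite mulr0 -{}T.
have e1 : k ^+ wt_u q * k ^+ (q ^ 3) = k ^+ (q ^ 4) by apply: kM; wt.
have e2 : k ^+ wt_pi q * k ^+ (q ^ 2) = k ^+ (q ^ 4) * k ^+ gap3 q.
  by rewrite -!exprD; congr (_ ^+ _); wt.
by ring: e1 e2.
Qed.

Let Y1X1 : k ^+ (q ^ 2) * V = E * (k ^+ (q ^ 2) * X).
Proof. by rewrite VX; ring. Qed.

Lemma normalised_D : D ^+ q * (X ^+ q) ^+ q = P * X * D.
Proof.
have := D_identity frD X1E Y1E X2E Y2E Y1X1 frEq; rewrite X1q X1qq Dq /pi => T.
apply: (@exp_cancel (wt_D q * q + q ^ 4)).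
have e1 : k ^+ (wt_D q * q) * k ^+ (q ^ 4) = k ^+ (wt_D q * q + q ^ 4) by apply: kM.
have e2 : k ^+ wt_pi q * (k ^+ (q ^ 2) * k ^+ wt_D q) = k ^+ (wt_D q * q + q ^ 4).
  by rewrite -!exprD; congr (_ ^+ _); wt.
have -> : k ^+ (wt_D q * q + q ^ 4) * (P * X * D) =
  k ^+ wt_pi q * P * (k ^+ (q ^ 2) * X) * (k ^+ wt_D q * D) by rewrite -e2; ring.
by rewrite -T -e1; ring.
Qed.

(** Modulo [k] this is an Artin-Schreier equation for [W]. *)
Lemma normalised_W :
  X * X ^+ q * (W ^+ q - W) + D * (k ^+ gap1 q * (X * y ^+ q) + k ^+ gap2 q * (y * X ^+ q))
  = -1.
Proof.
have := W_identity frD X1E Y1E mu2E Y1X1 HW frEq; rewrite X1q !frM => T.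
apply: (@exp_cancel (q ^ 2 * q.+1)); rewrite mulrN1 -{}T.
have e1 : k ^+ (q ^ 2 * q.+1) = k ^+ (q ^ 2) * k ^+ (q ^ 3).
  by rewrite -exprD; congr (_ ^+ _); wt.
have e2 : k ^+ wt_D q * k ^+ (q ^ 2) * k ^+ q = k ^+ (q ^ 2 * q.+1) * k ^+ gap1 q.
  by rewrite -!exprD; congr (_ ^+ _); wt.
have e3 : k ^+ wt_D q * k * k ^+ (q ^ 3) = k ^+ (q ^ 2 * q.+1) * k ^+ gap2 q.
  by rewrite -{2}[k]expr1 -!exprD; congr (_ ^+ _); wt.
have -> : k ^+ (q ^ 2 * q.+1) * (X * X ^+ q * (W ^+ q - W) +
    D * (k ^+ gap1 q * (X * y ^+ q) + k ^+ gap2 q * (y * X ^+ q))) =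
  k ^+ (q ^ 2 * q.+1) * (X * X ^+ q * (W ^+ q - W))
  + D * X * y ^+ q * (k ^+ (q ^ 2 * q.+1) * k ^+ gap1 q)
  + D * y * X ^+ q * (k ^+ (q ^ 2 * q.+1) * k ^+ gap2 q) by ring.
by rewrite -e2 -e3 e1; ring.
Qed.

(** Modulo [k] this solves for [D], which therefore contributes nothing new to the
    reduction. *)
Lemma normalised_D_W :
  (X ^+ q) ^+ q * (W ^+ q) ^+ q + U * (X ^+ q * W ^+ q) + D * (y ^+ q) ^+ q
   + k ^+ gap3 q * (P * X * W + D ^+ q * (y ^+ q) ^+ q) + k ^+ gap1 q * (U * D * y ^+ q) = 0.
Proof.
have := D_W_identity frD X1E Y1E Y1X1 HW frEq; rewrite X1q X1qq Dq !frM /u /pi => T.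
apply: (@exp_cancel (q ^ 4)); rewrite mulr0 -{}T.
rewrite (_ : (k ^+ q) ^+ q = k ^+ (q ^ 2)); last by rewrite -exprM mulnn.
have e1 : k ^+ wt_u q * k ^+ (q ^ 3) = k ^+ (q ^ 4) by apply: kM; wt.
have e2 : k ^+ wt_pi q * k ^+ (q ^ 2) = k ^+ (q ^ 4) * k ^+ gap3 q.
  by rewrite -!exprD; congr (_ ^+ _); wt.
have e3 : k ^+ (wt_D q * q) * k ^+ (q ^ 2) = k ^+ (q ^ 4) * k ^+ gap3 q.
  by rewrite -!exprD; congr (_ ^+ _); wt.
have e4 : k ^+ wt_D q * k ^+ (q ^ 2) = k ^+ (q ^ 4) by apply: kM; wt.
have e5 : k ^+ wt_u q * k ^+ wt_D q * k ^+ q = k ^+ (q ^ 4) * k ^+ gap1 q.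
  by rewrite -!exprD; congr (_ ^+ _); wt.
have -> : forall a b c d e f : A, a * (X ^+ q) ^+ q * (W ^+ q) ^+ q
     + b * U * (c * X ^+ q * W ^+ q) + d * P * (e * X * W)
     + (f * D ^+ q + k ^+ wt_D q * D) * (e * (y ^+ q) ^+ q)
     + b * U * (k ^+ wt_D q * D) * (k ^+ q * y ^+ q) =
   a * ((X ^+ q) ^+ q * (W ^+ q) ^+ q) + (b * c) * (U * (X ^+ q * W ^+ q))
   + (d * e) * (P * X * W) + (f * e) * (D ^+ q * (y ^+ q) ^+ q)
   + (k ^+ wt_D q * e) * (D * (y ^+ q) ^+ q)
   + (b * k ^+ wt_D q * k ^+ q) * (U * D * y ^+ q) by move=> *; ring.
by rewrite e1 e2 e3 e4 e5; ring.
Qed.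
End NormalisedIdentities.

(** * Spanning modulo an ideal *)

Section Subrings.
Variable A : comPzRingType.
Record is_subring (S : A -> Prop) : Prop := IsSubring {
  subring_1 : S 1;
  subring_B : forall a b, S a -> S b -> S (a - b);
  subring_M : forall a b, S a -> S b -> S (a * b)
}.

Section Closure.
Variables (S : A -> Prop) (SS : is_subring S).
Lemma subring_0 : S 0. Proof. by rewrite -(subrr 1); apply: (subring_B SS); apply: (subring_1 SS). Qed.
Lemma subring_N a : S a -> S (- a).
Proof. by move=> Sa; rewrite -sub0r; apply: (subring_B SS) => //; apply: subring_0. Qed.
Lemma subring_D a b : S a -> S b -> S (a + b).
Proof. by move=> Sa Sb; rewrite -[b]opprK; apply: (subring_B SS) => //; apply: subring_N. Qed.
Lemma subring_X a n : S a -> S (a ^+ n).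
Proof.
move=> Sa; elim: n => [|n IHn]; first exact: (subring_1 SS).
by rewrite exprS; apply: (subring_M SS).
Qed.
End Closure.

Record is_ideal (S J : A -> Prop) : Prop := IsIdeal {
  ideal_sub : forall a, J a -> S a;
  ideal_0 : J 0;
  ideal_B : forall a b, J a -> J b -> J (a - b);
  ideal_M : forall a b, S a -> J b -> J (a * b)
}.

Section IdealClosure.
Variables (S J : A -> Prop) (IJ : is_ideal S J).
Lemma ideal_N a : J a -> J (- a).
Proof. by move=> Ja; rewrite -sub0r; apply: (ideal_B IJ) => //; apply: (ideal_0 IJ). Qed.
Lemma ideal_D a b : J a -> J b -> J (a + b).
Proof. by move=> Ja Jb; rewrite -[b]opprK; apply: (ideal_B IJ) => //; apply: ideal_N. Qed.
End IdealClosure.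
End Subrings.

Section PolyEval.
Variables (A : comPzRingType) (K : fieldType) (rho : {rmorphism K -> A}).

(** [rho] stands for an algebra structure on [A], which the affinoid algebras and their
    reductions do not carry. *)
Definition poly_eval (r : A) (p : {poly K}) : A := \sum_(m < size p) rho p`_m * r ^+ m.
Lemma poly_evalE (r : A) (p : {poly K}) B : (size p <= B)%N -> poly_eval r p = \sum_(m < B) rho p`_m * r ^+ m.
Proof.
move=> sB; rewrite /poly_eval -!(big_mkord xpredT (fun m => rho p`_m * r ^+ m)).
rewrite [RHS](big_cat_nat _ (n := size p)) //= -[LHS]addr0; congr (_ + _).
rewrite big_nat_cond big1 // => m /andP[/andP[le_m _] _].
by rewrite nth_default // rmorph0 mul0r.
Qed.

Fact poly_eval_zmod (r : A) : zmod_morphism (poly_eval r).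
Proof.
move=> p p'; pose B := maxn (size (p - p')) (maxn (size p) (size p')).
rewrite !(@poly_evalE _ _ B) ?leq_max ?leqnn ?orbT // -sumrB.
by apply: eq_bigr => m _; rewrite coefB rmorphB mulrBl.
Qed.
HB.instance Definition _ (r : A) :=
  GRing.isZmodMorphism.Build {poly K} A (poly_eval r) (poly_eval_zmod r).

Lemma poly_evalZ (r : A) x p : poly_eval r (x *: p) = rho x * poly_eval r p.
Proof.
rewrite (@poly_evalE _ _ (size p)) ?size_scale_leq // mulr_sumr.
by apply: eq_bigr => m _; rewrite coefZ rmorphM mulrA.
Qed.

Lemma poly_evalMX (r : A) p : poly_eval r (p * 'X) = poly_eval r p * r.
Proof.
rewrite (@poly_evalE _ _ (size p).+1); last first.
  by rewrite (leq_trans (size_polyMleq _ _)) // size_polyX addnC.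
rewrite big_ord_recl coefMX eqxx rmorph0 mul0r add0r mulr_suml.
by apply: eq_bigr => m _; rewrite coefMX /= exprSr mulrA.
Qed.

Lemma poly_evalMXn (r : A) p m : poly_eval r (p * 'X^m) = poly_eval r p * r ^+ m.
Proof.
elim: m => [|m IHm]; first by rewrite !mulr1.
by rewrite exprSr mulrA poly_evalMX IHm exprSr mulrA.
Qed.

Lemma poly_evalC (r : A) x : poly_eval r x%:P = rho x.
Proof.
rewrite (@poly_evalE _ _ 1) ?size_polyC ?leq_b1 // big_ord1 coefC eqxx.
by rewrite mulr1.
Qed.

End PolyEval.

Section Spanning.
Variables (A : comPzRingType) (K : fieldType) (rho : {rmorphism K -> A}).
Variables (Ko : subringClosed K) (A0 J : A -> Prop).
Hypotheses (SA : is_subring A0) (IJ : is_ideal A0 J).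
Hypothesis rhoA0 : forall x, x \in Ko -> A0 (rho x).
Variables (n s N : nat) (e : 'I_n -> A) (z : 'I_n -> K) (E t y w : A).
Hypotheses (A0e : forall i, A0 (e i)) (zKo : forall i, z i \in Ko).
Hypotheses (A0t : A0 t) (A0y : A0 y) (A0w : A0 w) (A0E : A0 E).
Hypotheses (ty : t * y = 1) (e1 : J (1 - \sum_i e i))
  (eE : forall i, J (e i * E - rho (z i) * e i)) (wq : J (w ^+ s.+2 - (w - t ^+ N))).

Let A0_1 := subring_1 SA.
Let A0B := subring_B SA.
Let A0M := subring_M SA.
Let A0_0 := subring_0 SA.
Let A0D := subring_D SA.
Let A0X := subring_X SA.
Let JA0 := ideal_sub IJ.
Let J0 := ideal_0 IJ.
Let JB := ideal_B IJ.
Let JM := ideal_M IJ.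
Let JD := ideal_D IJ.
Let A0sum I r (F : I -> A) : (forall i, A0 (F i)) -> A0 (\sum_(i <- r) F i).
Proof. by move=> AF; apply: (big_ind A0). Qed.
Let Jsum I r (F : I -> A) : (forall i, J (F i)) -> J (\sum_(i <- r) F i).
Proof. by move=> AF; apply: (big_ind J). Qed.

Local Notation pev := (poly_eval rho t).

(** [s.+2] plays the role of [q]: writing the degree of [w] in this way exposes the top power
    and shows that the degree is at least [2]. *)
Definition combination (c : 'I_n -> nat -> {poly K}) : A :=
  \sum_i e i * \sum_(l < s.+2) w ^+ l * pev (c i l).
Definition integral_coefs (c : 'I_n -> nat -> {poly K}) :=
  forall i l, c i l \is a polyOver Ko.

Lemma combinationB c d :
  combination (fun i l => c i l - d i l) = combination c - combination d.
Proof.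
rewrite /combination -sumrB; apply: eq_bigr => i _; rewrite -mulrBr -sumrB.
by congr (_ * _); apply: eq_bigr => l _; rewrite raddfB mulrBr.
Qed.

Lemma combinationD c d :
  combination (fun i l => c i l + d i l) = combination c + combination d.
Proof.
rewrite /combination -big_split /=; apply: eq_bigr => i _; rewrite -mulrDr -big_split /=.
by congr (_ * _); apply: eq_bigr => l _; rewrite raddfD mulrDr.
Qed.

Lemma combinationZ x c : combination (fun i l => x *: c i l) = rho x * combination c.
Proof.
rewrite /combination mulr_sumr; apply: eq_bigr => i _; rewrite mulrCA; congr (_ * _).
by rewrite mulr_sumr; apply: eq_bigr => l _; rewrite poly_evalZ mulrCA.
Qed.

Lemma combinationMXn m c :
  combination (fun i l => c i l * 'X^m) = t ^+ m * combination c.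
Proof.
rewrite /combination mulr_sumr; apply: eq_bigr => i _; rewrite mulrCA; congr (_ * _).
rewrite mulr_sumr; apply: eq_bigr => l _; rewrite poly_evalMXn.
by rewrite [pev _ * _]mulrC mulrCA.
Qed.

Let shift (c : 'I_n -> nat -> {poly K}) i l := if l is l'.+1 then c i l' else 0.
Let single (p : 'I_n -> {poly K}) (j : nat) i (l : nat) := if l == j then p i else 0.

Let combination_single p (j : 'I_s.+2) :
  combination (single p j) = \sum_i e i * (w ^+ j * pev (p i)).
Proof.
rewrite /combination; apply: eq_bigr => i _; congr (_ * _).
rewrite (bigD1 j) //= /single eqxx big1 ?addr0 // => l lj.
rewrite (_ : (l == j :> nat) = false) ?raddf0 ?mulr0 //.
exact: negbTE lj.
Qed.

Let combination_shift c : w * combination c =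
  combination (shift c) + \sum_i e i * (w ^+ s.+2 * pev (c i s.+1)).
Proof.
rewrite /combination mulr_sumr -big_split; apply: eq_bigr => i _ /=.
rewrite mulrCA -mulrDr; congr (_ * _).
rewrite big_ord_recr mulrDr mulrA -exprS /=; congr (_ + _).
rewrite [RHS]big_ord_recl /= raddf0 mulr0 add0r mulr_sumr.
by apply: eq_bigr => l _; rewrite mulrA -exprS.
Qed.

(** Since [t] is invertible, the power of [t] only clears the denominators. *)
Definition spanned a := A0 a /\ exists M c, integral_coefs c /\ J (t ^+ M * a - combination c).

Let A0_pev p : p \is a polyOver Ko -> A0 (pev p).
Proof.
move=> /polyOverP Kp; apply: A0sum => m; apply: A0M; last exact: A0X.
exact: rhoA0.
Qed.

Lemma spanned_J a : J a -> spanned a.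
Proof.
move=> Ja; split; first exact: JA0.
exists 0%N, (fun _ _ => 0); split=> [i l|]; first exact: rpred0.
rewrite /combination big1 ?subr0 ?mul1r // => i _.
by rewrite big1 ?mulr0 // => l _; rewrite raddf0 mulr0.
Qed.

Lemma spanned1 : spanned 1.
Proof.
split=> //; exists 0%N, (single (fun=> 1) 0); split=> [i l|].
  by rewrite /single; case: eqP; rewrite ?rpred0 ?rpred1.
rewrite mul1r (combination_single _ ord0) (eq_bigr e) // => i _.
by rewrite mul1r (poly_evalC rho t 1) rmorph1 mulr1.
Qed.

Lemma spannedB a b : spanned a -> spanned b -> spanned (a - b).
Proof.
move=> [Aa [M [c [Kc Jc]]]] [Ab [M' [d [Kd Jd]]]]; split; first exact: A0B.
exists (M + M')%N, (fun i l => c i l * 'X^M' - d i l * 'X^M); split=> [i l|].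
  by rewrite rpredB // rpredM ?rpredX ?polyOverX.
rewrite combinationB !combinationMXn.
have -> : t ^+ (M + M') * (a - b) - (t ^+ M' * combination c - t ^+ M * combination d) =
  t ^+ M' * (t ^+ M * a - combination c) - t ^+ M * (t ^+ M' * b - combination d).
  by rewrite exprD; ring.
by apply: JB; apply: JM => //; apply: A0X.
Qed.

Lemma spannedZ x a : x \in Ko -> spanned a -> spanned (rho x * a).
Proof.
move=> Kx [Aa [M [c [Kc Jc]]]]; split; first by apply: A0M => //; apply: rhoA0.
exists M, (fun i l => x *: c i l); split=> [i l|].
  by rewrite -mul_polyC rpredM ?polyOverC.
by rewrite combinationZ mulrCA -mulrBr; apply: JM => //; apply: rhoA0.
Qed.

Lemma spanned_t a : spanned a -> spanned (t * a).
Proof.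
move=> [Aa [M [c [Kc Jc]]]]; split; first exact: A0M.
exists M, (fun i l => c i l * 'X^1); split=> [i l|].
  by rewrite rpredM ?rpredX ?polyOverX.
by rewrite combinationMXn mulrCA -mulrBr; apply: JM.
Qed.

Lemma spanned_y a : spanned a -> spanned (y * a).
Proof.
move=> [Aa [M [c [Kc Jc]]]]; split; first exact: A0M.
by exists M.+1, c; split=> //; rewrite exprSr mulrA -[_ * t * y]mulrA ty mulr1.
Qed.

(** [E] acts on the image of [e i] as the scalar [z i]. *)
Lemma spanned_E a : spanned a -> spanned (E * a).
Proof.
move=> [Aa [M [c [Kc Jc]]]]; split; first exact: A0M.
exists M, (fun i l => z i *: c i l); split=> [i l|].
  by rewrite -mul_polyC rpredM ?polyOverC.
have -> : combination (fun i l => z i *: c i l) =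
    E * combination c - \sum_i (\sum_(l < s.+2) w ^+ l * pev (c i l)) * (e i * E - rho (z i) * e i).
  rewrite /combination mulr_sumr -sumrB; apply: eq_bigr => i _.
  rewrite (eq_bigr (fun l : 'I__ => rho (z i) * (w ^+ l * pev (c i l)))).
    by rewrite -mulr_sumr; ring.
  by move=> l _; rewrite poly_evalZ mulrCA.
have -> (b c' d : A) : b * (E * a) - (E * c' - d) = d + E * (b * a - c') by ring.
apply: JD; last exact: JM.
apply: Jsum => i; apply: JM => //; apply: A0sum => l.
by apply: A0M; [apply: A0X|apply: A0_pev].
Qed.

(** The coefficients are shifted; the top one comes back through [w ^+ s.+2 = w - t ^+ N]. *)
Lemma spanned_w a : spanned a -> spanned (w * a).
Proof.
move=> [Aa [M [c [Kc Jc]]]]; split; first exact: A0M.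
pose d i l : {poly K} := shift c i l + single (c^~ s.+1) 1 i l
                         - single (fun i => c i s.+1 * 'X^N) 0 i l.
exists M, d; split=> [i l|].
  rewrite /d rpredB ?rpredD //.
  - by rewrite /shift; case: l => [|l]; rewrite ?rpred0.
  - by rewrite /single; case: eqP; rewrite ?rpred0.
  - by rewrite /single; case: eqP; rewrite ?rpred0 // rpredM ?rpredX ?polyOverX.
have -> : combination d = w * combination c -
    \sum_i e i * pev (c i s.+1) * (w ^+ s.+2 - (w - t ^+ N)).
  rewrite /d combinationB combinationD combination_shift.
  rewrite (combination_single _ (Ordinal (isT : (1 < s.+2)%N))).
  rewrite (combination_single _ ord0) -!addrA; congr (_ + _).
  rewrite -!sumrB; apply: eq_bigr => i _; rewrite poly_evalMXn.
  rewrite /= expr1 mul1r; ring.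
have -> (b c' f : A) : b * (w * a) - (w * c' - f) = f + w * (b * a - c') by ring.
apply: JD; last exact: JM.
apply: Jsum => i; apply: JM => //; apply: A0M => //.
exact: A0_pev.
Qed.

(** Products of combinations are not combinations on the nose.  The elements that preserve
    the span form a ring, so it is enough to find generators among them. *)
Definition multiplier a := A0 a /\ forall b, spanned b -> spanned (a * b).

Lemma multiplier_spanned a : multiplier a -> spanned a.
Proof. by move=> [_ /(_ 1 spanned1)]; rewrite mulr1. Qed.

Lemma multiplierJ a : J a -> multiplier a.
Proof.
move=> Ja; split; first exact: JA0.
by move=> b [Ab _]; apply: spanned_J; rewrite mulrC; apply: JM.
Qed.

Lemma multiplier_subring : is_subring multiplier.
Proof.
split; first by split=> // b; rewrite mul1r.
  move=> a b [Aa Ha] [Ab Hb]; split=> [|c Sc]; first exact: A0B.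
  by rewrite mulrBl; apply: spannedB; [apply: Ha|apply: Hb].
move=> a b [Aa Ha] [Ab Hb]; split=> [|c Sc]; first exact: A0M.
by rewrite -mulrA; apply/Ha/Hb.
Qed.

Lemma multiplier_congr a b : multiplier a -> J (b - a) -> multiplier b.
Proof.
move=> ma Jba; rewrite -[b](subrK a).
by apply: (subring_D multiplier_subring) => //; apply: multiplierJ.
Qed.

Lemma multiplier_rho x : x \in Ko -> multiplier (rho x).
Proof. by move=> Kx; split; [exact: rhoA0|move=> b; apply: spannedZ]. Qed.
Lemma multiplier_t : multiplier t. Proof. by split; last exact: spanned_t. Qed.
Lemma multiplier_y : multiplier y. Proof. by split; last exact: spanned_y. Qed.
Lemma multiplier_w : multiplier w. Proof. by split; last exact: spanned_w. Qed.
Lemma multiplier_E : multiplier E. Proof. by split; last exact: spanned_E. Qed.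

End Spanning.

(** * Bounded rings *)

Section IntegralExtension.
Variable A : comPzRingType.
Variables (S : A -> Prop) (SS : is_subring S) (z : A) (n : nat).
Hypothesis n0 : (0 < n)%N.
Hypothesis zn : exists2 c : nat -> A, forall i, S (c i) & z ^+ n = \sum_(i < n) c i * z ^+ i.

Definition adjoin (a : A) : Prop :=
  exists2 c : nat -> A, forall i, S (c i) & a = \sum_(i < n) c i * z ^+ i.

Lemma adjoinB a b : adjoin a -> adjoin b -> adjoin (a - b).
Proof.
move=> [c Sc ->] [d Sd ->]; exists (fun i => c i - d i) => [i|].
  exact: (subring_B SS).
by rewrite -sumrB; apply: eq_bigr => i _; rewrite mulrBl.
Qed.

Lemma adjoin0 : adjoin 0.
Proof.
exists (fun=> 0) => [i|]; first exact: (subring_0 SS).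
by rewrite big1 // => i _; rewrite mul0r.
Qed.

Lemma adjoinD a b : adjoin a -> adjoin b -> adjoin (a + b).
Proof.
move=> Sa Sb; rewrite -[b]opprK; apply: adjoinB => //.
by rewrite -sub0r; apply: adjoinB => //; apply: adjoin0.
Qed.

Lemma adjoinZ s a : S s -> adjoin a -> adjoin (s * a).
Proof.
move=> Ss [c Sc ->]; exists (fun i => s * c i) => [i|]; first exact: (subring_M SS).
by rewrite mulr_sumr; apply: eq_bigr => i _; rewrite mulrA.
Qed.

(** The top coefficient is lowered by the monic equation of [z]. *)
Lemma adjoinz a : adjoin a -> adjoin (z * a).
Proof.
move=> [c Sc ->]; have [m En] : exists m, n = m.+1 by case: n n0 => // m; exists m.
pose d j := if j is j'.+1 then c j' else 0.
have -> : z * (\sum_(i < n) c i * z ^+ i) = \sum_(i < n) d i * z ^+ i + c m * z ^+ n.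
  rewrite En [in LHS]big_ord_recr [in RHS]big_ord_recl mulrDr mulr_sumr /= mul0r add0r.
  congr (_ + _); last by rewrite mulrCA exprS.
  by apply: eq_bigr => i _; rewrite mulrCA exprS.
apply: adjoinD.
  by exists d => // -[|i]; [apply: (subring_0 SS)|apply: Sc].
by apply: adjoinZ.
Qed.

Lemma adjoin_base s : S s -> adjoin s.
Proof.
move=> Ss; have [m En] : exists m, n = m.+1 by case: n n0 => // m; exists m.
exists (fun i => if i == 0%N then s else 0) => [i|].
  by case: eqP => // _; apply: (subring_0 SS).
rewrite En big_ord_recl mulr1 big1 ?addr0 // => i _.
by rewrite mul0r.
Qed.

Lemma adjoin_gen : adjoin z.
Proof. by rewrite -[z]mulr1; apply/adjoinz/adjoin_base/(subring_1 SS). Qed.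

Lemma adjoin_subring : is_subring adjoin.
Proof.
split; [exact/adjoin_base/(subring_1 SS)|exact: adjoinB|].
move=> a b [c Sc ->] Sb; rewrite mulr_suml.
apply: (big_ind adjoin); [exact: adjoin0|exact: adjoinD|move=> i _].
rewrite -mulrA; apply: adjoinZ => //.
elim: (nat_of_ord i) => [|j IHj]; first by rewrite mul1r.
by rewrite exprS -mulrA; apply: adjoinz.
Qed.
End IntegralExtension.

Section Bounded.
Variables (R : realType) (A : filteredRing R).
Definition bounded (S : A -> Prop) := exists M : R, forall a, S a -> fil M a.

Lemma adjoin_bounded (S : A -> Prop) z n : bounded S -> bounded (adjoin S z n).
Proof.
move=> [M SM]; have [F HF] := choice (fun i => fil_ex (z ^+ i : A)).
have [B HB] : exists B, forall i, (i < n)%N -> fil B (z ^+ i : A).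
  elim: n => [|n [B HB]]; first by exists 0.
  exists (Num.min B (F n)) => i; rewrite ltnS leq_eqVlt => /predU1P[->|/HB Bi].
    by apply: fil_le (HF n); rewrite ge_min lexx orbT.
  by apply: fil_le Bi; rewrite ge_min lexx.
exists (M + B) => a [c Sc ->]; apply: fil_sum => i _.
by apply: filM; [apply: SM|apply: HB].
Qed.

(** All powers of [a] stay in [S]. *)
Lemma bounded_pb (S : A -> Prop) a : is_subring S -> bounded S -> S a -> a \in @power_bounded R A.
Proof.
move=> SS [M SM] Sa; apply/asboolP; exists M => n.
by apply: SM; apply: subring_X.
Qed.

Lemma fil_archimedean (r M : R) : 0 < r -> exists N : nat, forall n, (N <= n)%N -> M <= r *+ n.
Proof.
move=> r0; exists (Num.truncn (`|M| / r)).+1 => n le_n.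
have : `|M| / r < n%:R by apply: lt_le_trans (truncnS_gt _) _; rewrite ler_nat.
rewrite ltr_pdivrMr // mulr_natl => /ltW; apply: le_trans; exact: ler_norm.
Qed.

Lemma fil_exp (r : R) (c : A) n : fil r c -> fil (r *+ n.+1) (c ^+ n.+1).
Proof.
move=> rc; elim: n => [|n IHn]; first by rewrite mulr1n expr1.
by rewrite exprS mulrS; apply: filM.
Qed.

Lemma fil_tn (r : R) (c : A) : 0 < r -> fil r c -> c \in @top_nilpotent R A.
Proof.
move=> r0 rc; apply/asboolP => M; have [N HN] := fil_archimedean M r0.
exists N.+1 => -[|n] // le_n.
by apply: fil_le (fil_exp n rc); apply: HN; apply: ltnW.
Qed.

End Bounded.

(** * Points with prescribed reduction *)

Section Points.
Variables (R : realType) (K : closedFieldType) (v : valuation R K) (p f q : nat).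
Hypotheses (pK : p \in [pchar K]) (q_def : q = (p ^ f)%N) (q_gt1 : (1 < q)%N).
Local Notation O := (integral_elt v).
Local Notation m := (infinitesimal v).
Local Notation unit := (vunit v).
Variables (k P pi2 : K).
Hypotheses (mk : k \in m) (k0 : k != 0) (uP : P \in unit).
Let pi := k ^+ wt_pi q * P.
Hypothesis pi2E : pi2 = - k ^+ (q ^ 2 * q.+1).
Hypothesis LTpi2 : pi_LT q pi (pi_LT q pi pi2) = 0.
Variables (zeta y0 w0 : K).
Hypotheses (zetaq : zeta ^+ q = zeta) (zeta0 : zeta != 0) (uy0 : y0 \in unit) (Ow0 : w0 \in O).
Hypothesis w0E : w0 ^+ q = w0 - y0^-1 ^+ (q ^ 2 * q.+1).

Let q0 : (0 < q)%N := ltnW q_gt1.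
Let frD : {morph (fun x : K => x ^+ q) : x y / x + y}.
Proof. by apply: (frobeniusD q_def); [exact: pcharf_prime pK|exact: pcharf0]. Qed.
Let qK : q%:R = 0 :> K.
Proof.
rewrite q_def natrX (pcharf0 pK) expr0n; case: f q_def => // q1.
by move: q_gt1; rewrite q1 expn0.
Qed.
Let Ok n : k ^+ n \in O. Proof. by rewrite rpredX // infinitesimal_integral. Qed.
Let mkn n a : (0 < n)%N -> a \in O -> k ^+ n * a \in m.
Proof. by move=> n0 Oa; apply: infinitesimal_pmul. Qed.
Let g1 : (0 < gap1 q)%N. Proof. by case: (gaps_gt0 q_gt1). Qed.
Let g2 : (0 < gap2 q)%N. Proof. by case: (gaps_gt0 q_gt1). Qed.
Let g3 : (0 < gap3 q)%N. Proof. by case: (gaps_gt0 q_gt1). Qed.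
Let g4 : (0 < gap4 q)%N. Proof. by case: (gaps_gt0 q_gt1). Qed.
Let OU a : a \in unit -> a \in O. Proof. exact: vunit_integral. Qed.
Let kM n l h : (n + l = h)%N -> k ^+ n * k ^+ l = k ^+ h.
Proof. by move=> <-; rewrite exprD. Qed.
Let kX n l : (n * q = l)%N -> (k ^+ n) ^+ q = k ^+ l.
Proof. by move=> <-; rewrite exprM. Qed.
Let kS n : k * k ^+ n = k ^+ n.+1. Proof. by rewrite exprS. Qed.
Let kq2 : (k ^+ q) ^+ q = k ^+ (q ^ 2). Proof. by rewrite (@kX _ (q ^ 2)) // mulnn. Qed.
Let kq3 : (k ^+ (q ^ 2)) ^+ q = k ^+ (q ^ 3). Proof. by rewrite (@kX _ (q ^ 3)) // -expnSr. Qed.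
Let kq4 : (k ^+ (q ^ 3)) ^+ q = k ^+ (q ^ 4). Proof. by rewrite (@kX _ (q ^ 4)) // -expnSr. Qed.

Ltac wt := case: q q_gt1 => // s _; rewrite /wt_D /wt_pi /wt_u /gap1 /gap2 /gap3 /gap4 /=; ring.
Ltac kwt := rewrite -?exprD ?kS; congr (_ ^+ _); wt.

(** [X] is what it has to be modulo [m]; the torsion equation of [X1], being linear in [U],
    then defines [U]. *)
Lemma exists_XU : exists X U : K, [/\ X = (y0 ^+ q) ^+ q, X \in unit, U \in unit &
  (X ^+ q) ^+ q + U * X ^+ q + k ^+ gap3 q * (P * X) = 0].
Proof.
have [X [XE uX]] : exists X, X = (y0 ^+ q) ^+ q /\ X \in unit.
  by exists ((y0 ^+ q) ^+ q); rewrite !vunitX.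
exists X, (- ((X ^+ q) ^+ q + k ^+ gap3 q * (P * X)) / X ^+ q); split=> //.
  rewrite vunitM ?vunitV ?vunitX // vunitN vunitD ?vunitX //.
  by apply: mkn => //; rewrite rpredM ?OU.
by rewrite divfK ?expf_neq0 ?(vunit_neq0 uX) // addrAC subrr.
Qed.

Variables X U : K.
Hypotheses (XE : X = (y0 ^+ q) ^+ q) (uX : X \in unit) (uU : U \in unit).
Hypothesis XU : (X ^+ q) ^+ q + U * X ^+ q + k ^+ gap3 q * (P * X) = 0.

(** The equation is monic in [y], and its roots satisfy [y ^+ (q ^ 2) = y0 ^+ (q ^ 2)] up to
    infinitesimals; the Frobenius is injective on residues. *)
Lemma exists_y : exists y, y - y0 \in m /\
  X = (y ^+ q) ^+ q + k ^+ gap1 q * (U * y ^+ q) + k ^+ gap4 q * (P * y).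
Proof.
pose F : {poly K} := 'X^(q * q) + ((k ^+ gap1 q * U) *: 'X^q + (k ^+ gap4 q * P) *: 'X - X%:P).
have sF : (size ((k ^+ gap1 q * U) *: 'X^q + (k ^+ gap4 q * P) *: 'X - X%:P : {poly K})%R <= q.+1)%N.
  rewrite (leq_trans (size_polyD _ _)) // geq_max size_polyN size_polyC.
  rewrite (leq_trans (leq_b1 _)) ?ltnS // andbT.
  rewrite (leq_trans (size_polyD _ _)) // geq_max.
  by rewrite !(leq_trans (size_scale_leq _ _)) ?size_polyXn ?size_polyX.
have qq : (q.+1 < (q * q).+1)%N by rewrite ltnS ltn_Pmulr.
have sF' : (size F = (q * q).+1) by rewrite size_polyDl size_polyXn // (leq_ltn_trans sF).
have mF : F \is monic.
  by rewrite monicE lead_coefDl ?lead_coefXn // size_polyXn (leq_ltn_trans sF).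
have [||y Fy Oy] := @monic_integral_root _ _ v F mF.
- by rewrite sF' ltnS muln_gt0 q0.
- rewrite !(rpredD, rpredN) ?polyOverXn ?polyOverC ?OU //.
  - by apply: polyOverZ; [rewrite rpredM // OU|apply: polyOverXn].
  - by apply: polyOverZ; [rewrite rpredM // OU|apply: polyOverX].
have Xy : X = (y ^+ q) ^+ q + k ^+ gap1 q * (U * y ^+ q) + k ^+ gap4 q * (P * y).
  move: Fy; rewrite /F !hornerE exprM /= => /eqP; rewrite subr_eq0 => /eqP <-.
  by [].
exists y; split=> //.
rewrite -(@infinitesimalX _ _ _ q) // -(@infinitesimalX _ _ _ q) //.
rewrite !(frB q0 frD) // -XE Xy.
rewrite (_ : _ - _ = - (k ^+ gap1 q * (U * y ^+ q) + k ^+ gap4 q * (P * y))); last by ring.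
rewrite infinitesimalN; apply: infinitesimalD; apply: mkn => //; apply: rpredM => //.
- exact: OU.
- exact: rpredX.
- exact: OU.
Qed.
Variable y : K.
Hypotheses (yy0 : y - y0 \in m)
  (Xy : X = (y ^+ q) ^+ q + k ^+ gap1 q * (U * y ^+ q) + k ^+ gap4 q * (P * y)).
Let u := k ^+ wt_u q * U.
Let X1 := k ^+ (q ^ 2) * X.
Let X2 := k * y.
Let uy : y \in unit. Proof. exact: vunit_from yy0. Qed.

(** [pi_u q pi u (X1 * w)], divided by its dominant power of [k]. *)
Let L w := (X ^+ q) ^+ q * (w ^+ q) ^+ q + U * (X ^+ q * w ^+ q) + k ^+ gap3 q * (P * X * w).

Ltac Oint := rewrite /L; repeat first [by [] | exact: OU | exact: Ok | apply: rpredD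
  | apply: rpredB | apply: rpredN | apply: rpredM | apply: rpredX].

Lemma L_integral w : w \in O -> L w \in O.
Proof. by move=> Ow; Oint. Qed.

Lemma pi_u_L w : pi_u q pi u (X1 * w) = k ^+ (q ^ 4) * L w.
Proof.
rewrite pi_uE /X1 !frM !kq3 kq4 /u /pi /L.
have e1 : k ^+ wt_u q * k ^+ (q ^ 3) = k ^+ (q ^ 4) by kwt.
have e2 : k ^+ wt_pi q * k ^+ (q ^ 2) = k ^+ (q ^ 4) * k ^+ gap3 q by kwt.
by ring: e1 e2.
Qed.

(** The equation is [mu2 X2 (X1 w) = pi2], normalised.  Apart from two linear terms all
    exponents are multiples of [q], so its derivative is a constant, and in fact a unit. *)
Lemma exists_w : exists w, w - w0 \in m /\
  X * X ^+ q * (w ^+ q - w) - k ^+ gap1 q * (y ^+ q * L w) + k ^+ gap4 q * (y * L w ^+ q) + 1 = 0.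
Proof.
have qP (Q : {poly K}) : Q *+ q = 0 by rewrite -mulr_natr -polyC_natr qK mulr0.
have [Lp [LpE dLp]] : exists Lp : {poly K}, (forall w, Lp.[w] = L w) /\
    Lp^`() = (k ^+ gap3 q * (P * X))%:P.
  exists (((X ^+ q) ^+ q) *: 'X^(q * q) + (U * X ^+ q) *: 'X^q + (k ^+ gap3 q * (P * X)) *: 'X).
  split=> [w|]; first by rewrite !hornerE exprM /L /= !mulrA.
  rewrite !derivD !derivZ !derivXn derivX mulrnA !qP !scaler0.
  by rewrite !add0r alg_polyC.
pose T : {poly K} := (X * X ^+ q) *: ('X^q - 'X) - (k ^+ gap1 q * y ^+ q) *: Lp
   + (k ^+ gap4 q * y) *: Lp ^+ q + 1.
have TE w : T.[w] = X * X ^+ q * (w ^+ q - w) - k ^+ gap1 q * (y ^+ q * L w)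
   + k ^+ gap4 q * (y * L w ^+ q) + 1.
  by rewrite /T !hornerE !LpE /= ?mulrA.
have dT : T^`() = (- (X * X ^+ q) - k ^+ gap1 q * y ^+ q * (k ^+ gap3 q * (P * X)))%:P.
  rewrite /T !derivD derivN !derivZ derivB derivXn derivX deriv_exp dLp !qP.
  rewrite sub0r scaler0 addr0 derivC addr0 scalerN -!mul_polyC polyCD !polyCN !polyCM mulr1.
  by [].
have [||w Tw mw] := @near_root _ _ v T w0.
- have -> : T.[w0] = - (k ^+ gap1 q * (y ^+ q * L w0)) + k ^+ gap4 q * (y * L w0 ^+ q).
    have e : X * X ^+ q * y0^-1 ^+ (q ^ 2 * q.+1) = 1.
      rewrite XE exprVn -!exprM -exprD (_ : (_ + _)%N = (q ^ 2 * q.+1)%N); last by ring.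
      by rewrite mulfV // expf_neq0 // (vunit_neq0 uy0).
    by rewrite TE w0E; move: (L w0) e => l e; ring: e.
  apply: infinitesimalD; rewrite ?infinitesimalN; apply: mkn => //; have := @L_integral w0 Ow0 => OL; move: (L w0) OL => l OL; Oint.
- rewrite dT hornerC vunitD ?vunitN ?vunitM ?vunitX // infinitesimalN.
  by rewrite -mulrA; apply: mkn => //; Oint.
by exists w; rewrite -TE Tw -infinitesimalN opprB.
Qed.

Variable w : K.
Hypothesis mw : w - w0 \in m.
Hypothesis wE : X * X ^+ q * (w ^+ q - w) - k ^+ gap1 q * (y ^+ q * L w)
  + k ^+ gap4 q * (y * L w ^+ q) + 1 = 0.
Let Z := X1 * w.
Let Z1 := k ^+ (q ^ 4) * L w.

Let Ow : w \in O.
Proof. by rewrite -[w](subrK w0) rpredD // infinitesimal_integral. Qed.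

Let X1E : X1 = pi_u q pi u X2.
Proof.
rewrite pi_uE /X1 /X2 !frM kq2 {1}Xy /u /pi.
have e1 : k ^+ wt_u q * k ^+ q = k ^+ (q ^ 2) * k ^+ gap1 q by kwt.
have e2 : k ^+ wt_pi q * k = k ^+ (q ^ 2) * k ^+ gap4 q.
  by rewrite -{2}[k]expr1; kwt.
by ring: e1 e2.
Qed.

Let X1tors : pi_u q pi u X1 = 0.
Proof.
rewrite pi_uE /X1 !frM kq3 kq4 /u /pi.
have e1 : k ^+ wt_u q * k ^+ (q ^ 3) = k ^+ (q ^ 4) by kwt.
have e2 : k ^+ wt_pi q * k ^+ (q ^ 2) = k ^+ (q ^ 4) * k ^+ gap3 q by kwt.
rewrite -[RHS](mulr0 (k ^+ (q ^ 4))) -XU.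
by ring: e1 e2.
Qed.

Let Z1E : pi_u q pi u Z = Z1. Proof. exact: pi_u_L. Qed.

Let mu2Z : mu2 q pi u X2 Z = pi2.
Proof.
rewrite mu2E -X1E Z1E pi2E /Z1 /Z /X1 /X2 !frM kq3.
rewrite (@kX (q ^ 4) (q ^ 5)); last by rewrite -expnSr.
have e1 : k ^+ (q ^ 2) * k ^+ (q ^ 3) = k ^+ (q ^ 2 * q.+1) by kwt.
have e2 : k ^+ q * k ^+ (q ^ 4) = k ^+ (q ^ 2 * q.+1) * k ^+ gap1 q by kwt.
have e3 : k * k ^+ (q ^ 5) = k ^+ (q ^ 2 * q.+1) * k ^+ gap4 q.
  by rewrite -{1}[k]expr1; kwt.
rewrite -[RHS]addr0 -[X in _ = _ + X](mulr0 (k ^+ (q ^ 2 * q.+1))) -wE.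
move: (L w) => l; by ring: e1 e2 e3.
Qed.

Let S := pi_u q pi u Z1.

(** [S] is the defect of torsion of [Z].  Applying the Lubin-Tate endomorphism twice to
    [mu2 X2 Z = pi2] kills the right-hand side, and on the left-hand side only terms with
    [S] are left. *)
Let S_relation : S * (X1 ^+ q + pi * X2 ^+ q) = (X2 ^+ q) ^+ q * S ^+ q.
Proof.
have h1 : pi2_u q pi u X2 = 0 by rewrite /pi2_u -X1E.
have := pi_LT_mu2 q0 frD Z h1; rewrite mu2Z -X1E Z1E /pi2_u Z1E -/S => e.
have := LTpi2; rewrite e.
have := pi_LT_pairing1 q0 frD Z1 X1tors; rewrite /pi_LT -/S.
move: (X1 * Z1 ^+ q - X1 ^+ q * Z1) => b hb.
rewrite [(b - _) ^+ q](frB q0 frD) [(X2 ^+ q * S) ^+ q]frM => hS.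
have -> : S * (X1 ^+ q + pi * X2 ^+ q) =
   (pi * b - b ^+ q) + X1 ^+ q * S - (pi * (b - X2 ^+ q * S) - (b ^+ q - (X2 ^+ q) ^+ q * S ^+ q))
   + (X2 ^+ q) ^+ q * S ^+ q by ring.
by rewrite hb hS; ring.
Qed.

(** If [S] were not zero it could be divided out of the relation; as [S] is divisible by
    [k ^+ (q ^ 4)], the right-hand side would then have larger valuation than the left-hand
    one. *)
Let S_eq0 : S = 0.
Proof.
apply/eqP; apply: contraT => S0.
have [r [Or rE]] : exists r, r \in O /\ S = k ^+ (q ^ 4) * r.
  have OL := L_integral Ow.
  exists (L w * (Z1 ^+ (q ^ 2).-1 + u * Z1 ^+ q.-1 + pi)); split.
    by rewrite /Z1 /u /pi; move: (L w) OL => l OL; Oint.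
  by rewrite /S pi_u_factor // mulrA.
have := S_relation; rewrite -[in S ^+ q](prednK q0) exprS mulrCA => /(mulfI S0).
have e1 : k ^+ wt_pi q * k ^+ q = k ^+ (q ^ 3) * k ^+ (q * gap2 q).
  by rewrite -!exprD; congr (_ ^+ _); rewrite /gap2; wt.
have e2 : k ^+ (q ^ 2) * (k ^+ (q ^ 4)) ^+ q.-1 = k ^+ (q ^ 3) * k ^+ gap3 q.
  by rewrite -exprM; kwt.
rewrite rE exprMn /X1 /X2 !frM kq3 kq2 /pi.
have -> : k ^+ (q ^ 3) * X ^+ q + k ^+ wt_pi q * P * (k ^+ q * y ^+ q) =
   k ^+ (q ^ 3) * (X ^+ q + k ^+ (q * gap2 q) * (P * y ^+ q)) by ring: e1.
have -> : k ^+ (q ^ 2) * (y ^+ q) ^+ q * ((k ^+ (q ^ 4)) ^+ q.-1 * r ^+ q.-1) =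
   k ^+ (q ^ 3) * (k ^+ gap3 q * ((y ^+ q) ^+ q * r ^+ q.-1)) by ring: e2.
move/(mulfI (expf_neq0 _ k0)) => e.
have : X ^+ q + k ^+ (q * gap2 q) * (P * y ^+ q) \in unit.
  apply: vunitD; first exact: vunitX.
  by apply: mkn; [rewrite muln_gt0 q0|Oint].
rewrite vunitE e => /andP[_ /negP[]]; by apply: mkn => //; Oint.
Qed.

Let E := zeta + k ^+ wt_D q * (L w / X).
Let V := zeta * X + k ^+ wt_D q * L w.
Let H := zeta * y + k ^+ (q.-1 * q.+1) * (X * w).

Let uzeta : zeta \in unit.
Proof.
have := integralX v zeta q0; have := infinitesimalX v zeta (n := q.-1).
have z1 : zeta ^+ q.-1 = 1.
  by apply: (mulfI zeta0); rewrite -exprS prednK // mulr1.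
have s0 : (0 < q.-1)%N by rewrite -ltnS prednK.
rewrite vunitE -(integralX v zeta s0) -(infinitesimalX v zeta s0) z1.
by rewrite rpred1 infinitesimal1.
Qed.

Let X0 : X != 0. Proof. exact: vunit_neq0 uX. Qed.

Let Y1E : k ^+ (q ^ 2) * V = zeta * X1 + Z1.
Proof.
have e1 : k ^+ (q ^ 2) * k ^+ wt_D q = k ^+ (q ^ 4) by kwt.
by rewrite /V /X1 /Z1; move: (L w) => l; ring: e1.
Qed.

Let Y2E : k * H = zeta * X2 + Z.
Proof.
have e1 : k * k ^+ (q.-1 * q.+1) = k ^+ (q ^ 2) by kwt.
by rewrite /H /X2 /Z /X1; ring: e1.
Qed.

(** [Y2 = zeta X2 + Z] inherits everything from [Z]: the equations are linear over the fixed
    points of the Frobenius, and [mu2] does not see the multiple of [X2]. *)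
Lemma point_complete : exists V H E W : K,
  [/\ [/\ V \in unit, H \in unit, y \in unit, X \in unit & U \in unit],
      [/\ X1 = pi_u q pi u X2, k ^+ (q ^ 2) * V = pi_u q pi u (k * H),
         pi2_u q pi u X2 = 0, pi2_u q pi u (k * H) = 0 & mu2 q pi u X2 (k * H) = pi2],
      V = E * X /\ k * H = X1 * W + E * (k * y)
    & [/\ y - y0 \in m, E - zeta \in m & W - w0 \in m]].
Proof.
have OL := L_integral Ow.
have wt0 : (0 < wt_D q)%N by rewrite /wt_D muln_gt0 expn_gt0 q0 /= muln_gt0 /= andbT -ltnS prednK.
have OX' : X^-1 \in O by rewrite OU // vunitV.
have pH : pi_u q pi u (k * H) = zeta * X1 + Z1.
  by rewrite Y2E (pi_uD frD) pi_uZ // -X1E Z1E.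
(* [E] is not exactly [zeta], whence a correction to [w] *)
exists V, H, E, (w - k ^+ gap2 q * (L w * y / X ^+ 2)); split.
- split=> //.
  + rewrite vunitD ?vunitM //; apply: mkn => //.
  + rewrite vunitD ?vunitM //; apply: mkn; last by Oint.
    by rewrite muln_gt0 /= andbT -ltnS prednK.
- split=> //.
  + by rewrite Y1E pH.
  + by rewrite /pi2_u -X1E.
  + by rewrite /pi2_u pH (pi_uD frD) pi_uZ // X1tors mulr0 add0r.
  + by rewrite Y2E mu2_shift.
- split; first by rewrite /E mulrDl -[_ * (_ / _) * X]mulrA divfK.
  have e1 : k ^+ (q ^ 2) * k ^+ gap2 q = k ^+ wt_D q * k by rewrite -{4}[k]expr1; kwt.
  rewrite Y2E /E /Z /X1 /X2; move: (L w) => l.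
  have -> : k ^+ (q ^ 2) * X * (w - k ^+ gap2 q * (l * y / X ^+ 2)) =
    k ^+ (q ^ 2) * X * w - (k ^+ (q ^ 2) * k ^+ gap2 q) * (l * y / X) by field.
  by rewrite e1; ring.
- split=> //.
  + by rewrite /E addrAC subrr add0r; apply: mkn => //; apply: rpredM.
  + rewrite addrAC; apply: infinitesimalB => //; apply: mkn => //.
    by rewrite -exprVn; move: (L w) OL => l OL; Oint.
Qed.

End Points.

(** The coordinates are found one after the other: [X] and [U], then [y], then [w] near
    [w0]; torsion of [Y2] is a consequence of the equation of [pi2]. *)
Theorem exists_point (R : realType) (K : closedFieldType) (v : valuation R K) (p f q : nat)
    (k P pi2 zeta y0 w0 : K) (pi := k ^+ wt_pi q * P) :
  p \in [pchar K] -> q = (p ^ f)%N -> (1 < q)%N ->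
  k \in infinitesimal v -> k != 0 -> P \in vunit v ->
  pi2 = - k ^+ (q ^ 2 * q.+1) -> pi_LT q pi (pi_LT q pi pi2) = 0 ->
  zeta ^+ q = zeta -> zeta != 0 -> y0 \in vunit v -> w0 \in integral_elt v ->
  w0 ^+ q = w0 - y0^-1 ^+ (q ^ 2 * q.+1) ->
  exists U X V y H E W : K, let u := k ^+ wt_u q * U in
  [/\ [/\ V \in vunit v, H \in vunit v, y \in vunit v, X \in vunit v & U \in vunit v],
      [/\ k ^+ (q ^ 2) * X = pi_u q pi u (k * y), k ^+ (q ^ 2) * V = pi_u q pi u (k * H),
         pi2_u q pi u (k * y) = 0, pi2_u q pi u (k * H) = 0 & mu2 q pi u (k * y) (k * H) = pi2],
      V = E * X /\ k * H = k ^+ (q ^ 2) * X * W + E * (k * y)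
    & [/\ y - y0 \in infinitesimal v, E - zeta \in infinitesimal v & W - w0 \in infinitesimal v]].
Proof.
move=> pK q_def q1 mk k0 uP pi2E LT zq z0 uy0 Ow0 w0E.
have [X [U [XE uX uU XU]]] := exists_XU q1 mk uP uy0.
have [y [yy0 Xy]] := exists_y pK q_def q1 mk uP XE uX uU.
have [w [mw wE]] := exists_w pK q_def q1 mk uP uy0 Ow0 w0E XE uX uU yy0.
have [V [H [E [W PP]]]] := point_complete pK q_def q1 mk k0 uP pi2E LT zq z0 uy0 Ow0 uX uU XU yy0 Xy mw wE.
by exists U, X, V, y, H, E, W.
Qed.

(** * Generators of the unit ball and projectors *)

Section AffinoidFacts.
Variables (R : realType) (K : fieldType) (v : valuation R K).
Variables (n : nat) (r : 'I_n -> R) (gs : seq (tate v r)).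
Local Notation A := (affinoid gs).
Local Notation c := (affinoid_const gs).

Lemma to_affinoid_eq0 g : g \in gs -> to_affinoid gs g = 0.
Proof.
move=> ggs; rewrite -(raddf0 (to_quot (gen_ideal gs))).
apply: to_quotP; rewrite subr0; apply/asboolP.
have ig : (index g gs < size gs)%N by rewrite index_mem.
exists (fun i => (i == Ordinal ig)%:R).
rewrite (bigD1 (Ordinal ig)) //= eqxx mul1r nth_index // big1 ?addr0 // => i /negPf ->.
by rewrite mul0r.
Qed.

Lemma affinoid_fil_const (M : R) x : (M%:E <= v x)%E -> @fil R A M (c x).
Proof.
move=> Mx; exists (tate_poly v r x%:MP) => // m; rewrite /term_val /= mcoeffC.
case: eqP => [->|_]; last by rewrite mulr0 val0 leey.
rewrite mulr1 /Defs.mweight big1 ?adde0 // => i _.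
by rewrite mnm0E mul0r.
Qed.

Lemma affinoid_fil_coord i : @fil R A (r i) (to_affinoid gs (tate_poly v r 'X_i)).
Proof.
exists (tate_poly v r 'X_i) => // m; rewrite /term_val /= mcoeffX.
case: eqP => [<-|_]; last by rewrite val0 leey.
rewrite Defs.val1 add0e /Defs.mweight (bigD1 i) //= big1 => [|j ji].
  by rewrite mnm1E eqxx mul1r addr0.
by rewrite mnm1E eq_sym (negPf ji) mul0r.
Qed.

Lemma affinoid_fil0_subring : is_subring (@fil R A 0).
Proof.
split=> [|a b|a b Ua Ub]; last by rewrite -[0]addr0; apply: filM.
  by rewrite -(rmorph1 c); apply: affinoid_fil_const; rewrite Defs.val1.
exact: filB.
Qed.

Lemma const_tate_polyM (p : {mpoly K[n]}) : to_affinoid gs (tate_poly v r p) =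
  \sum_(m <- msupp p) c p@_m * \prod_i (to_affinoid gs (tate_poly v r 'X_i)) ^+ m i.
Proof.
have -> : to_affinoid gs (tate_poly v r p) =
    \sum_(m <- msupp p) to_affinoid gs (tate_poly v r (p@_m *: 'X_[m])).
  by rewrite {1}[p]mpolyE /to_affinoid !raddf_sum.
apply: eq_bigr => m _; rewrite -mul_mpolyC rmorphM /= /to_affinoid rmorphM; congr (_ * _).
rewrite mpolyXE_id rmorph_prod /= rmorph_prod; apply: eq_bigr => i _.
by rewrite rmorphXn /= rmorphXn.
Qed.

(** Truncating a restricted series at a high degree changes it by a multiple of [k]; what
    remains is a polynomial in the coordinates divided by constants of their size. *)
Lemma affinoid_fil0_ind (G : A -> Prop) (kap : 'I_n -> K) (k : K) :
  is_subring G -> (forall i, v (kap i) = (r i)%:E) -> k != 0 -> k \in infinitesimal v ->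
  (forall x, x \in integral_elt v -> G (c x)) ->
  (forall i, G (c (kap i)^-1 * to_affinoid gs (tate_poly v r 'X_i))) ->
  (forall a, @fil R A 0 a -> G (c k * a)) -> forall a, @fil R A 0 a -> G a.
Proof.
move=> GS vkap k0 mk GO Gx Gk a [f <- f0].
pose nu := fine (v k); have vk : v k = nu%:E by rewrite val_fine.
have nu0 : 0 < nu by move: mk; rewrite infinitesimalE vk lte_fin.
have kap0 i : kap i != 0.
  by apply: contraTneq isT => e; have := vkap i; rewrite e val0.
have [N fN] := gauss_trunc (tate_valP f) nu; set p := ms_trunc N f in fN.
have p0 : gauss_ge v r 0 (mpoly_ms p).
  have -> : mpoly_ms p = tate_val f - (tate_val f - mpoly_ms p) by ring.
  by apply: gauss_geB => //; apply: gauss_ge_le fN; apply: ltW.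
have -> : to_affinoid gs f = to_affinoid gs (tate_poly v r p)
    + c k * (c k^-1 * to_affinoid gs (f - tate_poly v r p)).
  have kk : c k * c k^-1 = 1 by rewrite -[LHS]rmorphM mulfV // rmorph1.
  by rewrite mulrA kk mul1r /to_affinoid raddfB addrC subrK.
apply: (subring_D GS); last first.
  apply: Gk; rewrite -[0](addNr nu); apply: filM.
    by apply: affinoid_fil_const; rewrite val_inv // vk.
  by exists (f - tate_poly v r p).
rewrite const_tate_polyM; apply: (big_ind G) => [||m _].
- exact: subring_0.
- exact: subring_D.
pose g i := c (kap i)^-1 * to_affinoid gs (tate_poly v r 'X_i).
have -> : c p@_m * \prod_i (to_affinoid gs (tate_poly v r 'X_i)) ^+ m i =
    c (p@_m * \prod_i kap i ^+ m i) * \prod_i g i ^+ m i.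
  rewrite [c (_ * _)]rmorphM rmorph_prod -mulrA -big_split /=; congr (_ * _).
  apply: eq_bigr => i _; rewrite rmorphXn -exprMn /g mulrA /=; congr (_ ^+ _).
  by rewrite -[c _ * c _]rmorphM mulfV // rmorph1 mul1r.
apply: (subring_M GS).
  apply: GO; rewrite integral_eltE.
  have -> : v (p@_m * \prod_i kap i ^+ m i) = term_val v r (mpoly_ms p) m; last exact: p0.
  rewrite val_mul /term_val; congr (_ + _)%E; rewrite /Defs.mweight.
  elim/big_rec2: _ => [|i x z _ IH]; first by rewrite Defs.val1.
  by rewrite val_mul IH EFinD valXn // vkap mulr_natl.
apply: (big_ind G) => [||i _]; [exact: (subring_1 GS)|exact: (subring_M GS)|].
by apply: (subring_X GS); apply: Gx.
Qed.

End AffinoidFacts.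

Section RootOfUnityProjectors.
Variables (K : fieldType) (q : nat).
Hypotheses (q_gt1 : (1 < q)%N) (qK : q%:R = 0 :> K).

(** The Lagrange interpolation polynomial at [z] for the roots of unity of order dividing
    [q.-1]; the usual factor [1 / q.-1] is [-1] since [q%:R = 0]. *)
Definition root_projector (z : K) : {poly K} := - \sum_(j < q.-1) z^-1 ^+ j *: 'X^j.

Lemma root_projector_mulX z : z ^+ q.-1 = 1 ->
  root_projector z * 'X = z *: root_projector z - z *: ('X^(q.-1) - 1).
Proof.
move=> zq; have s0 : (0 < q.-1)%N by rewrite -ltnS prednK // (ltnW q_gt1).
have z0 : z != 0.
  by apply: contra_eq_neq zq => ->; rewrite expr0n gtn_eqF // eq_sym oner_eq0.
pose t : {poly K} := z^-1 *: 'X.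
have tE : root_projector z = - \sum_(j < q.-1) t ^+ j.
  by congr (- _); apply: eq_bigr => j _; rewrite /t exprZn.
have := subrX1 t q.-1; have -> : t ^+ q.-1 = 'X^(q.-1) by rewrite /t exprZn exprVn zq invr1 scale1r.
move=> ->; rewrite tE.
have -> : 'X = z *: t by rewrite /t scalerA mulfV ?scale1r.
rewrite -scalerAr -scalerBr; congr (_ *: _); ring.
Qed.

Lemma root_projector_eval z z' : z ^+ q.-1 = 1 -> z' ^+ q.-1 = 1 ->
  (root_projector z).[z'] = (z == z')%:R.
Proof.
move=> zq zq'; have s0 : (0 < q.-1)%N by rewrite -ltnS prednK // (ltnW q_gt1).
have z0 : z != 0.
  by apply: contra_eq_neq zq => ->; rewrite expr0n gtn_eqF // eq_sym oner_eq0.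
case: eqVneq => [<-|zz'].
  rewrite hornerN horner_sum (eq_bigr (fun=> 1)) => [|j _].
    have -> : \sum_(j < q.-1) 1 = -1 :> K.
      by apply/eqP; rewrite -addr_eq0 sumr_const card_ord -mulrSr prednK ?(ltnW q_gt1) // qK.
    by rewrite opprK.
  by rewrite hornerZ hornerXn exprVn mulVf ?expf_neq0.
have := congr1 (fun F : {poly K} => F.[z']) (root_projector_mulX zq).
move: (root_projector z) => r.
rewrite !hornerE zq' subrr mulr0 subr0 mulrC => /eqP.
by rewrite -subr_eq0 -mulrBl mulf_eq0 subr_eq0 eq_sym (negPf zz') /= => /eqP.
Qed.

Lemma root_projector_over (S : subringClosed K) z :
  z^-1 \in S -> root_projector z \is a polyOver S.
Proof.
move=> Sz; rewrite rpredN rpred_sum // => i _.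
by apply: polyOverZ; [exact: rpredX|exact: polyOverXn].
Qed.

Lemma root_projector_size z : (size (root_projector z) <= q.-1)%N.
Proof.
rewrite size_polyN; apply: (big_ind (fun F : {poly K} => size F <= q.-1)%N).
- by rewrite size_poly0.
- by move=> F G sF sG; rewrite (leq_trans (size_polyD _ _)) // geq_max sF.
- by move=> j _; rewrite (leq_trans (size_scale_leq _ _)) // size_polyXn.
Qed.

(** The difference has degree less than [q.-1] and vanishes at all the [z i]. *)
Lemma root_projector_sum (z : 'I_q.-1 -> K) : injective z -> (forall i, z i ^+ q.-1 = 1) ->
  \sum_i root_projector (z i) = 1.
Proof.
move=> zI zq; apply/eqP; rewrite -subr_eq0; apply: contraT => F0.
set F := _ - 1 in F0; pose rs := [seq z i | i <- enum 'I_q.-1].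
have /(max_poly_roots F0) : all (root F) rs.
  apply/allP => _ /mapP[i _ ->]; rewrite rootE /F hornerD hornerN hornerC horner_sum.
  rewrite (bigD1 i) //= root_projector_eval // eqxx big1 ?addr0 ?subrr // => j ji.
  by rewrite root_projector_eval // (inj_eq zI) (negPf ji).
have -> : uniq rs by rewrite map_inj_uniq ?enum_uniq.
rewrite size_map size_enum_ord => /(_ isT); rewrite ltnNge => /negP[].
rewrite (leq_trans (size_polyD _ _)) // geq_max size_polyN size_poly1 -[(1 <= q.-1)%N]ltnS prednK ?(ltnW q_gt1) // q_gt1 andbT.
apply: (big_ind (fun F : {poly K} => size F <= q.-1)%N).
- by rewrite size_poly0.
- by move=> G G' sG sG'; rewrite (leq_trans (size_polyD _ _)) // geq_max sG.
- by move=> j _; apply: root_projector_size.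
Qed.
End RootOfUnityProjectors.

Lemma laurent_radiusl (R : realType) n (r : 'I_n -> R) i : laurent_radius r (lshift n i) = r i.
Proof. by rewrite /laurent_radius -[lshift n i]/(unsplit (inl i)) unsplitK. Qed.

Lemma laurent_radiusr (R : realType) n (r : 'I_n -> R) i : laurent_radius r (rshift n i) = - r i.
Proof. by rewrite /laurent_radius -[rshift n i]/(unsplit (inr i)) unsplitK. Qed.

(** * Normalised coordinates *)

Section CurveAlgebra.
Variables (R : realType) (C : fieldType) (v : valuation R C) (q : nat).
Hypothesis q_gt1 : (1 < q)%N.
Variables (pi pi2 k P : C).
Let nu : R := (q%:R ^+ 3 * (q%:R ^+ 2 - 1))^-1.
Hypothesis vk : v k = nu%:E.
Hypotheses (piE : pi = k ^+ wt_pi q * P) (pi2E : pi2 = - k ^+ (q ^ 2 * q.+1)).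
Local Notation rad := (@Y31c_radius R q).
Local Notation gs := (laurent_rel v rad ++ Y31c_equations v q pi pi2).
Local Notation A := (affinoid gs).
Local Notation c := (affinoid_const gs).

Let q0 : (0 < q)%N := ltnW q_gt1.
Let qR1 : 1 < q%:R :> R. Proof. by rewrite ltr1n. Qed.
Lemma nu_gt0 : 0 < nu.
Proof.
have qR0 : 0 < q%:R :> R by apply: lt_trans ltr01 qR1.
rewrite invr_gt0; apply: mulr_gt0; first exact: exprn_gt0.
by rewrite subr_gt0 exprn_egt1.
Qed.
Let k0 : k != 0.
Proof. by apply: contraTneq isT => e; have := vk; rewrite e val0. Qed.

Definition coord_weight (j : nat) : nat := nth 0%N [:: wt_u q; q ^ 2; q ^ 2; 1; 1]%N j.

Lemma Y31c_radiusE (i : 'I_5) : rad i = nu *+ coord_weight i.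
Proof.
have q0R : q%:R != 0 :> R by rewrite pnatr_eq0 -lt0n.
have q1R : q%:R - 1 != 0 :> R by rewrite subr_eq0 gt_eqF.
have q2R : q%:R + 1 != 0 :> R by rewrite natr1 pnatr_eq0.
have qq : q%:R ^+ 2 - 1 = (q%:R - 1) * (q%:R + 1) :> R by ring.
have pq : q.-1%:R = q%:R - 1 :> R by rewrite -{2}(prednK q0) -natr1 addrK.
have q2m : q%:R ^+ 2 - 1 != 0 :> R by rewrite qq mulf_neq0.
rewrite -[nu *+ _]mulr_natr /Y31c_radius /nu /coord_weight.
case: i => [[|[|[|[|[|]]]]]] //= _; rewrite ?/wt_u ?natrM ?natrX ?pq.
all: field.
all: rewrite ?q0R ?q1R ?q2R ?q2m //.
Qed.

Lemma val_coord_weight (i : 'I_5) : v (k ^+ coord_weight i) = (rad i)%:E.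
Proof. by rewrite valXn // vk Y31c_radiusE. Qed.

Local Notation x i := (to_affinoid gs (Defs.coord v rad i)).
Local Notation z i := (to_affinoid gs (coord_inv v rad i)).

Definition ncoord (i : 'I_5) : A := c (k ^- coord_weight i) * x i.
Definition ncoord_inv (i : 'I_5) : A := c (k ^+ coord_weight i) * z i.

Let xz i : x i * z i = 1.
Proof.
have : to_affinoid gs (Defs.coord v rad i * coord_inv v rad i - 1) = 0.
  by apply: to_affinoid_eq0; rewrite mem_cat; apply/orP; left; apply/mapP; exists i; rewrite ?mem_enum.
by rewrite /to_affinoid rmorphB rmorphM rmorph1 => /eqP; rewrite subr_eq0 => /eqP.
Qed.

Let ckV n : c (k ^- n) * c (k ^+ n) = 1.
Proof. by rewrite -[LHS]rmorphM mulVf ?rmorph1 // expf_neq0. Qed.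

Lemma ncoordK i : ncoord i * ncoord_inv i = 1.
Proof. by rewrite /ncoord /ncoord_inv mulrACA ckV xz mulr1. Qed.

Lemma coordE i : x i = c k ^+ coord_weight i * ncoord i.
Proof.
have e : c (k ^- coord_weight i) * c k ^+ coord_weight i = 1.
  by rewrite -[RHS](ckV (coord_weight i)) [in RHS]rmorphXn.
by rewrite /ncoord mulrA [_ * c (_)]mulrC e mul1r.
Qed.

Let U := ncoord (inord 0).
Let X := ncoord (inord 1).
Let V := ncoord (inord 2).
Let y := ncoord (inord 3).
Let H := ncoord (inord 4).
Let iX := ncoord_inv (inord 1).
Let ck := c k.
Let cpi := ck ^+ wt_pi q * c P.
Let cu := ck ^+ wt_u q * U.

Let weightE (j : nat) : (j < 5)%N -> coord_weight (inord j : 'I_5) = coord_weight j.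
Proof. by move=> j5; rewrite inordK. Qed.

Lemma Y31c_relations : [/\ ck ^+ (q ^ 2) * X = pi_u q cpi cu (ck * y),
  ck ^+ (q ^ 2) * V = pi_u q cpi cu (ck * H), pi2_u q cpi cu (ck * y) = 0,
  pi2_u q cpi cu (ck * H) = 0 & mu2 q cpi cu (ck * y) (ck * H) = - ck ^+ (q ^ 2 * q.+1)].
Proof.
have E0 : x (inord 0) = cu by rewrite coordE weightE.
have E1 : x (inord 1) = ck ^+ (q ^ 2) * X by rewrite coordE weightE.
have E2 : x (inord 2) = ck ^+ (q ^ 2) * V by rewrite coordE weightE.
have E3 : x (inord 3) = ck * y by rewrite coordE weightE.
have E4 : x (inord 4) = ck * H by rewrite coordE weightE.
have cpiE : c pi = cpi by rewrite [LHS](congr1 c piE) rmorphM rmorphXn.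
have rpi a b d : to_affinoid gs (pi_u q a b d) =
    pi_u q (to_affinoid gs a) (to_affinoid gs b) (to_affinoid gs d).
  exact: (rmorph_pi_u (to_quot (gen_ideal gs))).
have gs0 g : g \in Y31c_equations v q pi pi2 -> to_affinoid gs g = 0.
  by move=> gg; apply: to_affinoid_eq0; rewrite mem_cat gg orbT.
have sub0 a b : to_affinoid gs (a - b) = 0 -> to_affinoid gs a = to_affinoid gs b.
  by rewrite /to_affinoid rmorphB => /eqP; rewrite subr_eq0 => /eqP.
split.
- rewrite -E1 -E3 -E0 -cpiE -rpi; apply: sub0; apply: gs0.
  by rewrite /Y31c_equations inE eqxx.
- rewrite -E2 -E4 -E0 -cpiE -rpi; apply: sub0; apply: gs0.
  by rewrite /Y31c_equations !inE eqxx !orbT.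
- rewrite -E3 -E0 -cpiE /pi2_u -!rpi; apply: gs0.
  by rewrite /Y31c_equations !inE /pi2_u eqxx !orbT.
- rewrite -E4 -E0 -cpiE /pi2_u -!rpi; apply: gs0.
  by rewrite /Y31c_equations !inE /pi2_u eqxx !orbT.
- have -> : - ck ^+ (q ^ 2 * q.+1) = c pi2 by rewrite [RHS](congr1 c pi2E) rmorphN rmorphXn.
  rewrite -E4 -E3 -E0 -cpiE.
  transitivity (to_affinoid gs (mu2 q (laurent_const v rad pi) (Defs.coord v rad (inord 0))
     (Defs.coord v rad (inord 3)) (Defs.coord v rad (inord 4)))).
    exact/esym/(rmorph_mu2 (to_quot (gen_ideal gs))).
  by apply: sub0; apply: gs0; rewrite /Y31c_equations !inE eqxx !orbT.
Qed.

End CurveAlgebra.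

(** * A bounded ring of generators *)

Section Generators.
Variables (A : comPzRingType) (C : fieldType) (c : {rmorphism C -> A}) (O : subringClosed C).
Variables (q : nat) (k P : C).
Hypotheses (q_gt1 : (1 < q)%N) (frA : {morph (fun a : A => a ^+ q) : a b / a + b}).
Hypotheses (qC : q%:R = 0 :> C) (k0 : k != 0) (Ok : k \in O) (OP : P \in O).
Variables (U X V y H iU iX iV t iH : A).
Hypotheses (UiU : U * iU = 1) (XiX : X * iX = 1) (ViV : V * iV = 1) (yt : y * t = 1) (HiH : H * iH = 1).
Let ck := c k.
Let cpi := ck ^+ wt_pi q * c P.
Let cu := ck ^+ wt_u q * U.
Hypotheses (h1 : ck ^+ (q ^ 2) * X = pi_u q cpi cu (ck * y))
  (h2 : ck ^+ (q ^ 2) * V = pi_u q cpi cu (ck * H)) (h3 : pi2_u q cpi cu (ck * y) = 0)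
  (h4 : pi2_u q cpi cu (ck * H) = 0)
  (h5 : mu2 q cpi cu (ck * y) (ck * H) = - ck ^+ (q ^ 2 * q.+1)).
Variable U0 : A -> Prop.
Hypotheses (U0S : is_subring U0) (U0c : forall x, x \in O -> U0 (c x)).
Hypotheses (U0U : U0 U) (U0X : U0 X) (U0V : U0 V) (U0y : U0 y)
  (U0iU : U0 iU) (U0iX : U0 iX) (U0iV : U0 iV) (U0t : U0 t) (U0iH : U0 iH).

Let q0 : (0 < q)%N := ltnW q_gt1.
Let g1 : (0 < gap1 q)%N. Proof. by case: (gaps_gt0 q_gt1). Qed.
Let g2 : (0 < gap2 q)%N. Proof. by case: (gaps_gt0 q_gt1). Qed.
Let g3 : (0 < gap3 q)%N. Proof. by case: (gaps_gt0 q_gt1). Qed.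
Let g4 : (0 < gap4 q)%N. Proof. by case: (gaps_gt0 q_gt1). Qed.

Definition ratioE : A := V * iX.
(** [(Y_2 - E X_2) / X_1]; the power of [k] is what is left of the powers of [k] that
    normalise [Y_2], [X_2] and [X_1]. *)
Definition scaledW : A := c k^-1 ^+ (q.-1 * q.+1) * (H - ratioE * y) * iX.
Definition scaledD : A := c k^-1 ^+ wt_D q * (ratioE ^+ q - ratioE).
Local Notation E := ratioE.
Local Notation W := scaledW.
Local Notation D := scaledD.
Let ckK : c k^-1 * ck = 1.
Proof. by rewrite -[LHS]rmorphM mulVf ?rmorph1. Qed.
Let ckKn n : ck ^+ n * c k^-1 ^+ n = 1.
Proof. by rewrite -exprMn mulrC ckK expr1n. Qed.

Let VX : V = E * X.
Proof. by rewrite /E -mulrA [iX * X]mulrC XiX mulr1. Qed.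

Let HW : ck * H = ck ^+ (q ^ 2) * X * W + E * (ck * y).
Proof.
have -> : ck ^+ (q ^ 2) = ck * ck ^+ (q.-1 * q.+1).
  by rewrite -exprS; congr (_ ^+ _); case: q q_gt1 => // s _ /=; ring.
have -> : ck * ck ^+ (q.-1 * q.+1) * X * W =
   ck * (ck ^+ (q.-1 * q.+1) * c k^-1 ^+ (q.-1 * q.+1)) * (X * iX) * (H - E * y).
  by rewrite /W; ring.
by rewrite ckKn XiX; ring.
Qed.

Let frEq : E ^+ q = E + ck ^+ wt_D q * D.
Proof. by rewrite /D mulrA ckKn mul1r addrC subrK. Qed.

Let nX : X = (y ^+ q) ^+ q + ck ^+ gap1 q * (U * y ^+ q) + ck ^+ gap4 q * (c P * y).
Proof. exact: (normalised_X1 q_gt1 ckK h1). Qed.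
Let nT : (X ^+ q) ^+ q + U * X ^+ q + ck ^+ gap3 q * (c P * X) = 0.
Proof. exact: (normalised_torsion q_gt1 ckK h1 h3). Qed.
Let nD : D ^+ q * (X ^+ q) ^+ q = c P * X * D.
Proof. exact: (normalised_D q_gt1 frA ckK h1 h2 h3 h4 VX frEq). Qed.
Let nW : X * X ^+ q * (W ^+ q - W)
   + D * (ck ^+ gap1 q * (X * y ^+ q) + ck ^+ gap2 q * (y * X ^+ q)) = -1.
Proof.
exact: (normalised_W q_gt1 frA ckK h1 h2 h5 VX HW frEq).
Qed.
Let nDW : (X ^+ q) ^+ q * (W ^+ q) ^+ q + U * (X ^+ q * W ^+ q) + D * (y ^+ q) ^+ q
   + ck ^+ gap3 q * (c P * X * W + D ^+ q * (y ^+ q) ^+ q) + ck ^+ gap1 q * (U * D * y ^+ q) = 0.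
Proof.
exact: (normalised_D_W q_gt1 frA ckK h1 h2 VX HW frEq).
Qed.

Let D_integral : exists2 b : nat -> A, forall i, U0 (b i) & D ^+ q = \sum_(i < q) b i * D ^+ i.
Proof.
exists (fun i => if i == 1%N then c P * X * ((iX ^+ q) ^+ q) else 0) => [i|].
  case: eqP => _; last exact: subring_0 U0S.
  apply: (subring_M U0S); first apply: (subring_M U0S).
  - exact: U0c.
  - exact: U0X.
  - by do 2!apply: (subring_X U0S).
rewrite (bigD1 (Ordinal q_gt1)) //= expr1 big1 ?addr0 => [|i /negPf i1]; last first.
  by rewrite (_ : (i == 1 :> nat) = false) ?mul0r //; exact: i1.
have e : (X ^+ q) ^+ q * (iX ^+ q) ^+ q = 1 by rewrite -!exprMn XiX !expr1n.
by rewrite mulrAC -nD -mulrA e mulr1.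
Qed.

Let W_equation : W ^+ q = W + iX * iX ^+ q *
   (- 1 - D * (ck ^+ gap1 q * (X * y ^+ q) + ck ^+ gap2 q * (y * X ^+ q))).
Proof.
have e : X * X ^+ q * (iX * iX ^+ q) = 1.
  by rewrite mulrACA XiX -exprMn XiX expr1n mul1r.
rewrite -nW addrK (_ : _ * _ = X * X ^+ q * (iX * iX ^+ q) * (W ^+ q - W)); last by ring.
by rewrite e mul1r addrC subrK.
Qed.

(** [D] and [W] are integral over the unit ball [U0], by the normalised equations, so these
    are rings of polynomials of bounded degree in [D] and [W]. *)
Definition A1 := adjoin U0 D q.
Definition A0 := adjoin A1 W q.
Let A1S : is_subring A1. Proof. exact: (adjoin_subring U0S q0 D_integral). Qed.
Let U0A1 a : U0 a -> A1 a. Proof. exact: (adjoin_base U0S D q0). Qed.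
Let A1D : A1 D. Proof. exact: (adjoin_gen U0S q0 D_integral). Qed.

Let W_integral : exists2 b : nat -> A, forall i, A1 (b i) & W ^+ q = \sum_(i < q) b i * W ^+ i.
Proof.
pose d := iX * iX ^+ q * (- 1 - D * (ck ^+ gap1 q * (X * y ^+ q) + ck ^+ gap2 q * (y * X ^+ q))).
exists (fun i => if i == 1%N then 1 else if i == 0%N then d else 0) => [i|].
  case: eqP => _; first exact: (subring_1 A1S).
  case: eqP => _; last exact: subring_0 A1S.
  have A1k n : A1 (ck ^+ n) by apply: (subring_X A1S); apply/U0A1/U0c.
  repeat first [assumption | apply: A1k | apply: (subring_1 A1S) | exact: A1D
   | apply: U0A1; assumption | apply: (subring_B A1S) | apply: (subring_D A1S)
   | apply: (subring_N A1S) | apply: (subring_M A1S) | apply: (subring_X A1S)].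
have q2 : q = q.-2.+2 by case: q q_gt1 => [|[|]].
rewrite W_equation -/d q2 2!big_ord_recl /= !mulr1 expr1 mul1r big1 ?addr0 1?addrC //.
by move=> i _; rewrite mul0r.
Qed.

Lemma A0_subring : is_subring A0.
Proof. exact: (adjoin_subring A1S q0 W_integral). Qed.

Lemma A0_U0 a : U0 a -> A0 a.
Proof. by move=> /U0A1; apply: (adjoin_base A1S W q0). Qed.
Lemma A0_W : A0 W. Proof. exact: (adjoin_gen A1S q0 W_integral). Qed.
Let A0D : A0 D. Proof. exact: (adjoin_base A1S W q0 A1D). Qed.
Let A0k n : A0 (ck ^+ n). Proof. by apply: (subring_X A0_subring); apply/A0_U0/U0c. Qed.
Let A0P : A0 (c P). Proof. exact/A0_U0/U0c. Qed.
Let A0E : A0 E. Proof. by apply: A0_U0; apply: (subring_M U0S). Qed.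
Let iE : A := X * iV.
Let A0iE : A0 iE. Proof. by apply: A0_U0; apply: (subring_M U0S). Qed.
Let EiE : E * iE = 1.
Proof.
rewrite /ratioE /iE (_ : _ * _ = V * iV * (X * iX)); last by ring.
by rewrite ViV XiX mulr1.
Qed.

Ltac A0t := repeat first [assumption | exact: A0k | exact: A0_W | exact: A0D | exact: A0P | exact: A0E
  | exact: A0iE | exact: (subring_1 A0_subring) | apply: A0_U0; assumption
  | apply: (subring_B A0_subring) | apply: (subring_D A0_subring) | apply: (subring_N A0_subring)
  | apply: (subring_M A0_subring) | apply: (subring_X A0_subring)].

Definition J (a : A) := exists2 b, A0 b & a = c k * b.

Lemma J_ideal : is_ideal A0 J.
Proof.
split=> [a [b Ab ->]||a b [a' Aa ->] [b' Ab ->]|a b Aa [b' Ab ->]].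
- by apply: (subring_M A0_subring) => //; apply/A0_U0/U0c.
- by exists 0; [exact: subring_0 A0_subring|rewrite mulr0].
- by exists (a' - b'); [exact: (subring_B A0_subring)|rewrite mulrBr].
- by exists (a * b'); [exact: (subring_M A0_subring)|rewrite mulrCA].
Qed.

Let JX n a : (0 < n)%N -> A0 a -> J (ck ^+ n * a).
Proof.
case: n => // n _ Aa; exists (ck ^+ n * a); last by rewrite exprS mulrA.
by apply: (subring_M A0_subring).
Qed.

Let J_M a a' b b' : A0 a' -> A0 b -> J (a - b) -> J (a' - b') -> J (a * a' - b * b').
Proof.
move=> Aa Ab Jab Jab'.
have -> : a * a' - b * b' = a' * (a - b) + b * (a' - b') by ring.
by apply: (ideal_D J_ideal); apply: (ideal_M J_ideal).
Qed.

Let J_exp n a b : A0 a -> A0 b -> J (a - b) -> J (a ^+ n - b ^+ n).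
Proof.
move=> Aa Ab Jab; elim: n => [|n IHn].
  by rewrite !expr0 subrr; apply: (ideal_0 J_ideal).
by rewrite !exprS; apply: J_M => //; apply: (subring_X A0_subring).
Qed.

Let J_inv a a' b b' : a * a' = 1 -> b * b' = 1 -> A0 a' -> A0 b' -> J (a - b) -> J (a' - b').
Proof.
move=> aa bb Aa Ab Jab.
have -> : a' - b' = a' * (b * b') - b' * (a * a') by rewrite aa bb !mulr1.
have -> : a' * (b * b') - b' * (a * a') = - (a' * b') * (a - b) by ring.
by apply: (ideal_M J_ideal) => //; A0t.
Qed.

Let XJ : J (X - (y ^+ q) ^+ q).
Proof.
have -> : X - (y ^+ q) ^+ q = ck ^+ gap1 q * (U * y ^+ q) + ck ^+ gap4 q * (c P * y).
  by rewrite {1}nX; ring.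
by apply: (ideal_D J_ideal); apply: JX => //; A0t.
Qed.

Let iXJ : J (iX - (t ^+ q) ^+ q).
Proof.
apply: (J_inv XiX _ _ _ XJ); [|by A0t|by A0t].
by rewrite -!exprMn yt !expr1n.
Qed.

Lemma ratioE_root_of_unity : J (E ^+ q.-1 - 1).
Proof.
have -> : E ^+ q.-1 - 1 = iE * (ck ^+ wt_D q * D).
  have -> : ck ^+ wt_D q * D = E * (E ^+ q.-1 - 1).
    by rewrite mulrBr -exprS prednK // mulr1 frEq addrC addKr.
  by rewrite mulrA [iE * E]mulrC EiE mul1r.
apply: (ideal_M J_ideal) => //; apply: JX; last by A0t.
by rewrite /wt_D muln_gt0 expn_gt0 q0 /= muln_gt0 /= andbT -ltnS prednK.
Qed.

Lemma scaledW_artin_schreier : J (W ^+ q.-2.+2 - (W - t ^+ (q ^ 2 * q.+1))).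
Proof.
have -> : q.-2.+2 = q by case: q q_gt1 => [|[|]].
rewrite W_equation (_ : t ^+ _ = (t ^+ q) ^+ q * ((t ^+ q) ^+ q) ^+ q); last first.
  by rewrite -!exprM -exprD; congr (_ ^+ _); ring.
have -> (a b d e : A) : a + b * (-1 - d) - (a - e) = - (b - e) - b * d by ring.
apply: (ideal_B J_ideal).
  apply: (ideal_N J_ideal); apply: J_M; [by A0t|by A0t|exact: iXJ|].
  by apply: J_exp; [by A0t|by A0t|exact: iXJ].
rewrite mulrDr; apply: (ideal_M J_ideal); first by A0t.
have -> (a b d e f g h : A) : a * (b * (d * e)) + a * (f * (g * h)) =
  b * (a * (d * e)) + f * (a * (g * h)) by ring.
by apply: (ideal_D J_ideal); apply: JX => //; A0t.
Qed.

Variable z : 'I_q.-1 -> C.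
Hypotheses (zO : forall i, z i \in O) (zVO : forall i, (z i)^-1 \in O)
  (zq : forall i, z i ^+ q.-1 = 1) (z_inj : injective z).

(** Modulo [k], the idempotent of the locus where [E] reduces to [z i]. *)
Definition component (i : 'I_q.-1) : A := poly_eval c E (root_projector q (z i)).

Let A0_component i : A0 (component i).
Proof.
apply: (big_ind A0); [exact: subring_0 A0_subring|exact: (subring_D A0_subring)|move=> j _].
apply: (subring_M A0_subring); last by A0t.
apply/A0_U0/U0c; move: (nat_of_ord j) => {}j; apply/polyOverP: j.
exact: root_projector_over.
Qed.

Let component_sum : J (1 - \sum_i component i).
Proof.
have -> : \sum_i component i = 1; last by rewrite subrr; apply: (ideal_0 J_ideal).
by rewrite -raddf_sum root_projector_sum //= poly_evalC rmorph1.
Qed.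

Let component_E i : J (component i * E - c (z i) * component i).
Proof.
rewrite -poly_evalMX -poly_evalZ -raddfB root_projector_mulX //.
rewrite addrAC subrr sub0r raddfN /= poly_evalZ raddfB /= -['X^_]mul1r poly_evalMXn poly_evalC.
rewrite rmorph1 mul1r; apply: (ideal_N J_ideal); apply: (ideal_M J_ideal); last exact: ratioE_root_of_unity.
exact/A0_U0/U0c.
Qed.

Local Notation mult := (multiplier c O A0 J q.-2 component t W).
Let cA0 x : x \in O -> A0 (c x). Proof. by move=> Ox; apply/A0_U0/U0c. Qed.
Let MS : is_subring mult.
Proof. by apply: multiplier_subring; [exact: A0_subring|exact: J_ideal|exact: A0_U0]. Qed.
Let Mcongr a b : mult a -> J (b - a) -> mult b.
Proof. by apply: multiplier_congr; [exact: A0_subring|exact: J_ideal|exact: A0_U0]. Qed.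
Let McongrN a b : mult a -> J (a - b) -> mult b.
Proof. by move=> ma Jab; apply: (Mcongr ma); rewrite -opprB; apply: (ideal_N J_ideal). Qed.
Let Mc x : x \in O -> mult (c x).
Proof. by move=> Ox; apply: multiplier_rho; [exact: A0_subring|exact: J_ideal|exact: cA0|]. Qed.
Let Mt : mult t. Proof. by apply: multiplier_t; [exact: A0_subring|exact: J_ideal|exact: A0_U0]. Qed.
Let ty : t * y = 1. Proof. by rewrite mulrC. Qed.
Let My : mult y.
Proof. by apply: multiplier_y; [exact: A0_subring|exact: A0_U0|exact: ty]. Qed.
Let MW : mult W.
Proof. by apply: multiplier_w; [exact: A0_subring|exact: J_ideal|exact: cA0|exact: A0_component|exact: A0_U0|exact: A0_W|exact: scaledW_artin_schreier]. Qed.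
Let ME : mult E.
Proof.
by apply: multiplier_E; first [exact: A0_subring|exact: J_ideal|exact: cA0|exact: A0_component|exact: zO|exact: A0E|exact: component_E|exact: A0_W|exact: A0_U0].
Qed.
Let MJ a : J a -> mult a. Proof. by move=> Ja; apply: multiplierJ; [exact: J_ideal|]. Qed.

Ltac Mt := repeat first [assumption | exact: Mt | exact: My | exact: MW | exact: ME
  | exact: (subring_1 MS) | apply: Mc; assumption
  | apply: (subring_B MS) | apply: (subring_D MS) | apply: (subring_N MS)
  | apply: (subring_M MS) | apply: (subring_X MS)].

Let MX : mult X. Proof. by apply: (Mcongr _ XJ); Mt. Qed.
Let MiX : mult iX. Proof. by apply: (Mcongr _ iXJ); Mt. Qed.
Let MV : mult V. Proof. by rewrite VX; Mt. Qed.
Let MiE : mult iE.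
Proof.
apply: (@McongrN (E ^+ q.-2)); first by Mt.
have -> : E ^+ q.-2 - iE = iE * (E ^+ q.-1 - 1).
  rewrite mulrBr mulr1; congr (_ - _).
  have -> : q.-1 = q.-2.+1 by case: q q_gt1 => [|[|]].
  by rewrite exprS mulrA [iE * E]mulrC EiE mul1r.
by apply: (ideal_M J_ideal); last exact: ratioE_root_of_unity.
Qed.
Let MiV : mult iV.
Proof.
have -> : iV = iE * iX; last by Mt.
by rewrite /iE mulrAC XiX mul1r.
Qed.

Let HJ : J (H - E * y).
Proof.
have -> : H - E * y = ck ^+ (q.-1 * q.+1) * (X * W).
  rewrite -[LHS]mul1r -ckK -mulrA.
  have -> : ck * (H - E * y) = ck * (ck ^+ (q.-1 * q.+1) * (X * W)).
    rewrite mulrBr HW (_ : ck ^+ (q ^ 2) = ck * ck ^+ (q.-1 * q.+1)); first by ring.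
    by rewrite -exprS; congr (_ ^+ _); case: q q_gt1 => // s _ /=; ring.
  by rewrite mulrA ckK mul1r.
apply: JX; last by A0t.
by rewrite muln_gt0 /= andbT -ltnS prednK.
Qed.
Let MH : mult H. Proof. by apply: (Mcongr _ HJ); Mt. Qed.
Let MiH : mult iH.
Proof.
apply: (@Mcongr (iE * t)); first by Mt.
apply: (J_inv HiH _ _ _ HJ); [|by A0t|by A0t].
by rewrite mulrACA EiE yt mulr1.
Qed.

Let UJ : J (U - - ((X ^+ q) ^+ q * iX ^+ q)).
Proof.
have XiXq : X ^+ q * iX ^+ q = 1 by rewrite -exprMn XiX expr1n.
have -> : U - - ((X ^+ q) ^+ q * iX ^+ q) =
    ((X ^+ q) ^+ q + U * X ^+ q + ck ^+ gap3 q * (c P * X)) * iX ^+ q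
    - U * (X ^+ q * iX ^+ q - 1) - ck ^+ gap3 q * (c P * X * iX ^+ q) by ring.
rewrite nT XiXq subrr mulr0 mul0r subr0 sub0r.
by apply: (ideal_N J_ideal); apply: JX => //; A0t.
Qed.
Let MU : mult U. Proof. by apply: (Mcongr _ UJ); Mt. Qed.
Let MiU : mult iU.
Proof.
apply: (@Mcongr (- ((iX ^+ q) ^+ q * X ^+ q))); first by Mt.
apply: (J_inv UiU _ _ _ UJ); [|by A0t|by A0t].
have XiXq : X ^+ q * iX ^+ q = 1 by rewrite -exprMn XiX expr1n.
have XiXqq : (X ^+ q) ^+ q * (iX ^+ q) ^+ q = 1 by rewrite -exprMn XiXq expr1n.
have -> : forall a b d e : A, - (a * b) * - (d * e) = (e * b) * (a * d) by move=> *; ring.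
by rewrite XiXq XiXqq mulr1.
Qed.

Let MD : mult D.
Proof.
have ytq : (y ^+ q) ^+ q * (t ^+ q) ^+ q = 1 by rewrite -!exprMn yt !expr1n.
apply: (@Mcongr (- (((X ^+ q) ^+ q * (W ^+ q) ^+ q + U * (X ^+ q * W ^+ q)) * (t ^+ q) ^+ q))).
  by Mt.
pose r := ck ^+ gap3 q * (c P * X * W + D ^+ q * (y ^+ q) ^+ q) + ck ^+ gap1 q * (U * D * y ^+ q).
have Jr : J r by apply: (ideal_D J_ideal); apply: JX => //; A0t.
rewrite opprK -[D]mulr1 -{1}ytq (_ : _ + _ = - (t ^+ q) ^+ q * r).
  by apply: (ideal_M J_ideal) => //; A0t.
apply/eqP; rewrite -subr_eq0 -[X in _ == X](mulr0 ((t ^+ q) ^+ q)) -nDW /r; apply/eqP.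
by ring.
Qed.

Hypothesis U0_ind : forall G : A -> Prop, is_subring G -> (forall x, x \in O -> G (c x)) ->
  [/\ G U, G X, G V, G y & G H] -> [/\ G iU, G iX, G iV, G t & G iH] ->
  (forall a, U0 a -> G (c k * a)) -> forall a, U0 a -> G a.

(** Modulo [k] each generator of [A0] is a polynomial in [t], [y], [W] and [E], hence a
    multiplier. *)
Lemma A0_spanned a : A0 a -> spanned c O A0 J q.-2 component t W a.
Proof.
have MU0 b : U0 b -> mult b.
  apply: U0_ind => // b' Ub; apply: MJ; exists b' => //; exact: A0_U0.
have MA1 b : A1 b -> mult b.
  move=> [d Ud ->]; apply: (big_ind mult) => [||i _].
  - exact: (subring_0 MS).
  - exact: (subring_D MS).
  - by apply: (subring_M MS); [exact: MU0|exact: (subring_X MS)].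
move=> [d Ad ->]; apply: (multiplier_spanned A0_subring component_sum).
apply: (big_ind mult) => [||i _].
- exact: (subring_0 MS).
- exact: (subring_D MS).
- by apply: (subring_M MS); [exact: MA1|exact: (subring_X MS)].
Qed.

(** Recording [S] as an iterated adjunction is what yields its boundedness once [A] has a
    topology. *)
Theorem generated_subring : exists S : A -> Prop,
  [/\ is_subring S, forall a, U0 a -> S a, S W &
      exists d1 d2, S = adjoin (adjoin U0 d1 q) d2 q] /\
  [/\ exists2 b, S b & E ^+ q.-1 - 1 = c k * b,
      exists2 b, S b & W ^+ q - (W - t ^+ (q ^ 2 * q.+1)) = c k * b &
      forall a, S a ->
        spanned c O S (fun a => exists2 b, S b & a = c k * b) q.-2 component t W a].
Proof.
exists A0; split; split.
- exact: A0_subring.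
- exact: A0_U0.
- exact: A0_W.
- by exists D, W.
- exact: ratioE_root_of_unity.
- by have := scaledW_artin_schreier; have -> : q.-2.+2 = q by case: q q_gt1 => [|[|]].
- exact: A0_spanned.
Qed.
End Generators.

(** * Independence of the combinations *)

Section Independence.
Variables (R : realType) (C : fieldType) (v : valuation R C).
Variables (K : closedFieldType) (j : {rmorphism K -> C}) (vK : valuation R K).
Hypothesis vKj : forall x, vK x = v (j x).
Variables (p f q N : nat).
Hypotheses (pK : p \in [pchar K]) (q_def : q = (p ^ f)%N) (q_gt1 : (1 < q)%N).
Variable z : 'I_q.-1 -> K.
Hypotheses (z_inj : injective z) (zq : forall i, z i ^+ q.-1 = 1).
Local Notation O := (integral_elt v).
Local Notation m := (infinitesimal v).
Local Notation res := (res v).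

Let s0 : (0 < q.-1)%N. Proof. by rewrite -ltnS prednK // (ltnW q_gt1). Qed.
Let f0 : (0 < f)%N.
Proof. by move: q_gt1; rewrite q_def; case: f. Qed.

Let jO x : x \in integral_elt vK -> j x \in O.
Proof. by rewrite !integral_eltE vKj. Qed.
Let jm x : (j x \in m) = (x \in infinitesimal vK).
Proof. by rewrite !infinitesimalE vKj. Qed.

(** The difference of two fixed points is again a fixed point of the Frobenius, so it is [0]
    or a root of unity. *)
Lemma frobenius_fixed_residue n (a b : K) : (0 < n)%N ->
  a ^+ (p ^ n) = a -> b ^+ (p ^ n) = b ->
  [/\ a \in integral_elt vK & res (j a) = res (j b) -> a = b].
Proof.
move=> n0 an bn; have pp := pcharf_prime pK.
have pn1 : (1 < p ^ n)%N by rewrite -(exp1n n) ltn_exp2r // prime_gt1.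
have unitP x : x ^+ (p ^ n) = x -> x != 0 -> x \in vunit vK.
  move=> xn x0; apply: (@vunit_root_of_unity _ _ vK (p ^ n).-1).
    by rewrite -ltnS prednK // (ltnW pn1).
  by apply: (mulfI x0); rewrite -exprS prednK ?(ltnW pn1) // mulr1.
have intP x : x ^+ (p ^ n) = x -> x \in integral_elt vK.
  move=> xn; have [->|x0] := eqVneq x 0; first exact: rpred0.
  exact/vunit_integral/unitP.
split; first exact: intP.
move=> /eqP; rewrite res_eq ?jO ?intP // -rmorphB jm => mab.
apply/eqP; rewrite -subr_eq0; apply: contraT => ab0.
have abn : (a - b) ^+ (p ^ n) = a - b.
  have frp : {morph (fun x : K => x ^+ (p ^ n)) : x y / x + y}.
    by apply: (frobeniusD (erefl _)) => //; exact: pcharf0.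
  by rewrite (frB (ltnW pn1) frp) an bn.
by have := unitP _ abn ab0; rewrite vunitE mab andbF.
Qed.

(** Large finite subfields of [K] provide more roots than the degree of [P] allows. *)
Lemma poly_residue_eq0 (P : {poly residue_field v}) :
  (forall x : K, x \in vunit vK -> P.[res (j x)] = 0) -> P = 0.
Proof.
move=> Px; apply/eqP; apply: contraT => P0.
have pp := pcharf_prime pK.
have [s [us ss sP]] := @frobenius_roots K p (size P).+1 pK isT.
pose rs := [seq res (j x) | x <- s & x != 0].
have /(max_poly_roots P0) : all (root P) rs.
  apply/allP => _ /mapP[x + ->]; rewrite mem_filter => /andP[x0 xs].
  rewrite rootE Px // (@vunit_root_of_unity _ _ vK (p ^ (size P).+1).-1) //.
    by rewrite -ltnS prednK ?expn_gt0 ?prime_gt0 // -(exp1n (size P).+1) ltn_exp2r // prime_gt1.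
  by apply: (mulfI x0); rewrite -exprS prednK ?expn_gt0 ?prime_gt0 // mulr1 sP.
have -> : uniq rs.
  rewrite map_inj_in_uniq ?filter_uniq // => a b.
  rewrite !mem_filter => /andP[_ /sP an] /andP[_ /sP bn].
  by case: (frobenius_fixed_residue _ an bn).
move=> /(_ isT); rewrite ltnNge => /negP[].
have szs : (size s <= size [seq x <- s | x != 0%R] + 1)%N.
  rewrite -(count_predC (fun x => x != 0%R) s) size_filter leq_add2l.
  rewrite -size_filter (leq_trans _ (_ : size [:: (0 : K)%R] <= 1)%N) //.
  apply: uniq_leq_size; first exact: filter_uniq.
  by move=> x; rewrite mem_filter /= negbK inE => /andP[].
rewrite size_map -(leq_add2r 1) (leq_trans _ szs) // ss addn1.
exact: ltnW (ltn_expl _ (prime_gt1 pp)).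
Qed.

Lemma exists_artin_schreier M y0 : y0 \in vunit vK ->
  exists2 w0, w0 ^+ q = w0 - y0^-1 ^+ M & w0 \in integral_elt vK.
Proof.
move=> uy0; pose b := y0^-1 ^+ M.
have Ob : b \in integral_elt vK by rewrite vunit_integral // vunitX // vunitV.
have sF : (size ((b%:P - 'X)%R : {poly K}) < size ('X^q : {poly K})%R)%N.
  rewrite size_polyXn ltnS (leq_trans (size_polyD _ _)) // geq_max size_polyN size_polyX q_gt1 andbT.
  by rewrite (leq_trans (size_polyC_leq1 _)) // ltnW.
pose F : {poly K} := 'X^q + (b%:P - 'X).
have mF : F \is monic by rewrite monicE lead_coefDl // lead_coefXn.
have [||w Fw Ow] := @monic_integral_root _ _ vK F mF.
- by rewrite size_polyDl // size_polyXn ltnS (ltnW q_gt1).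
- by rewrite rpredD ?polyOverXn // rpredB ?polyOverX ?polyOverC.
exists w => //; move: Fw; rewrite /F !hornerE /= => /eqP; rewrite subr_eq0 => /eqP e.
by rewrite -[in RHS]e addrK.
Qed.

Variables (A : comPzRingType) (c : {rmorphism C -> A}) (E t W : A) (T : A -> Prop).

(** The points [ev] fill the residual curve.  Their exact position does not matter, because
    only residues are compared. *)
Definition enough_points := forall i (y0 w0 : K), y0 \in vunit vK ->
  w0 \in integral_elt vK -> w0 ^+ q = w0 - y0^-1 ^+ N ->
  exists ev : {rmorphism A -> C},
  [/\ forall x, ev (c x) = x, forall a, T a -> ev a \in m, ev E - j (z i) \in m,
      ev t - j (y0^-1) \in m & ev W - j w0 \in m].

Hypothesis points : enough_points.

Lemma morph_poly_eval (ev : {rmorphism A -> C}) (a : A) P : (forall x, ev (c x) = x) ->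
  ev (poly_eval c a P) = P.[ev a].
Proof.
move=> evc; rewrite /poly_eval rmorph_sum horner_coef; apply: eq_bigr => i _.
by rewrite rmorphM rmorphXn /= evc.
Qed.

Let e i := poly_eval c E (root_projector q (j (z i))).

(** At points with [E] near [z i] the combination reduces to its [i]-th summand.  For fixed
    [y0], that summand is a polynomial of degree less than [q] in [w], with the [q] solutions
    of the Artin-Schreier equation as roots; so its coefficients vanish at [y0], for all
    [y0]. *)
Theorem combination_independent (a : 'I_q.-1 -> nat -> {poly C}) :
  (forall i l, a i l \is a polyOver O) -> T (combination c q.-2 e t W a) ->
  forall i l, (l < q)%N -> forall n, (a i l)`_n \in m.
Proof.
move=> Oa Ta i; have q2 : q.-2.+2 = q by case: q q_gt1 => [|[|]].
suff H l : (l < q)%N -> map_poly res (a i l) = 0.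
  by move=> l lq; apply: res_polyP => //; apply: H.
move: l.
suff H y0 : y0 \in vunit vK -> forall l, (l < q)%N -> (map_poly res (a i l)).[res (j y0^-1)] = 0.
  move=> l lq; apply: poly_residue_eq0 => x ux.
  by rewrite -[x]invrK; apply: H => //; apply: vunitV.
move=> uy0.
have [w0 w0E Ow0] := exists_artin_schreier N uy0.
have [s [us ss sP]] := frobenius_roots pK f0.
pose G := \poly_(l < q) (map_poly res (a i l)).[res (j y0^-1)].
have G0 : G = 0.
  apply/eqP; apply: contraT => Gn0.
  pose rs := [seq res (j w0) + res (j x) | x <- s].
  have /(max_poly_roots Gn0) : all (root G) rs.
    apply/allP => _ /mapP[x xs ->]; rewrite rootE.
    have xq := sP x xs; have [Ox _] := frobenius_fixed_residue f0 xq xq.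
    have wxE : (w0 + x) ^+ q = (w0 + x) - y0^-1 ^+ N.
      have frK : {morph (fun g : K => g ^+ q) : g h / g + h}.
        by apply: (frobeniusD q_def); [exact: pcharf_prime pK|exact: pcharf0].
      by rewrite (frE frK) w0E q_def xq addrAC.
    have [ev [evc evT evE evt evW]] := points i uy0 (rpredD Ow0 Ox) wxE.
    have near_int g h : h \in O -> g - h \in m -> g \in O.
      by move=> Oh mgh; rewrite -(subrK h g) rpredD // infinitesimal_integral.
    have Oz k : j (z k) \in O.
      by rewrite jO // vunit_integral // (vunit_root_of_unity vK s0).
    have OzV k : (j (z k))^-1 \in O.
      by rewrite -fmorphV jO // vunit_integral // vunitV // (vunit_root_of_unity vK s0).
    have OE := near_int _ _ (Oz i) evE.
    have Ot := near_int _ _ (jO (vunit_integral (vunitV uy0))) evt.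
    have OW := near_int _ _ (jO (rpredD Ow0 Ox)) evW.
    have rE : res (ev E) = res (j (z i)) by apply/eqP; rewrite res_eq.
    have rt : res (ev t) = res (j y0^-1).
      by apply/eqP; rewrite res_eq // jO // vunit_integral // vunitV.
    have rW : res (ev W) = res (j w0) + res (j x).
      by rewrite -resD ?jO // -rmorphD; apply/eqP; rewrite res_eq // jO // rpredD.
    have Orp k := root_projector_over q (OzV k).
    have re k : res (root_projector q (j (z k))).[ev E] = (k == i)%:R.
      rewrite res_horner // rE -res_horner // root_projector_eval //.
      - by rewrite (inj_eq (fmorph_inj j)) (inj_eq z_inj); case: eqP => _; rewrite ?res1 ?res0.
      - by rewrite q_def natrX -(rmorph_nat j) (pcharf0 pK) rmorph0 expr0n eqn0Ngt f0.
      - by rewrite -rmorphXn zq rmorph1.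
      - by rewrite -rmorphXn zq rmorph1.
    have OaE k l : (a k l).[ev t] \in O by apply: integral_horner.
    have := evT _ Ta; rewrite rmorph_sum /= => mev.
    have : res (\sum_k (root_projector q (j (z k))).[ev E] *
        \sum_(l < q) ev W ^+ l * (a k l).[ev t]) = 0.
      apply/eqP; rewrite res_eq0; last first.
        rewrite rpred_sum // => k _; rewrite rpredM ?integral_horner //.
        by rewrite rpred_sum // => l _; rewrite rpredM ?rpredX.
      rewrite (eq_bigr (fun k => ev (e k * \sum_(l < q.-2.+2) W ^+ l * poly_eval c t (a k l)))) //.
      move=> k _; rewrite rmorphM /= morph_poly_eval // rmorph_sum q2; congr (_ * _).
      by apply: eq_bigr => l _; rewrite rmorphM rmorphXn /= morph_poly_eval.
    rewrite res_sum => [|k]; last first.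
      rewrite rpredM ?integral_horner // rpred_sum // => l _.
      by rewrite rpredM ?rpredX.
    rewrite (bigD1 i) //= [X in _ + X]big1 ?addr0 => [|k ki]; last first.
      rewrite resM ?integral_horner ?re ?(negPf ki) ?mul0r // rpred_sum // => l _.
      by rewrite rpredM ?rpredX.
    rewrite resM ?integral_horner ?re ?eqxx ?mul1r //; last first.
      by rewrite rpred_sum // => l _; rewrite rpredM ?rpredX.
    rewrite res_sum => [|l]; last by rewrite rpredM ?rpredX.
    move=> <-; apply/eqP; rewrite horner_poly; apply: eq_bigr => l _.
    by rewrite resM ?rpredX // resX // res_horner // rW rt mulrC.
  have -> : uniq rs.
    rewrite map_inj_in_uniq // => x1 x2 /sP x1q /sP x2q /addrI.
    by case: (frobenius_fixed_residue f0 x1q x2q).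
  by move=> /(_ isT); rewrite size_map ss -q_def ltnNge size_poly.
by move=> l lq; have := congr1 (fun P : {poly _} => P`_l) G0; rewrite coef0 coef_poly lq.
Qed.
End Independence.

(** * Points of the affinoid *)

Lemma morph_scaledW (A : comPzRingType) (C K : fieldType) (j : {rmorphism K -> C})
    (c : {rmorphism C -> A}) (ev : {rmorphism A -> C}) q (k E y H iX : K) (Va ya Ha iXa : A) :
  (forall x, ev (c x) = x) -> ev (ratioE Va iXa) = j E -> ev ya = j y -> ev Ha = j H ->
  ev iXa = j iX ->
  ev (scaledW c q (j k) Va ya Ha iXa) = j (k^-1 ^+ (q.-1 * q.+1) * (H - E * y) * iX).
Proof.
move=> evc eE ey eH eX.
rewrite /scaledW; move: (ratioE Va iXa) eE => Ea eE.
by rewrite !rmorphM !rmorphXn !rmorphB !rmorphM /= evc eE ey eH eX fmorphV.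
Qed.

Section CurvePoints.
Variables (R : realType) (C : fieldType) (v : valuation R C).
Variables (K : closedFieldType) (j : {rmorphism K -> C}) (vK : valuation R K).
Hypothesis vKj : forall x, vK x = v (j x).
Variables (p f q : nat).
Hypotheses (pK : p \in [pchar K]) (q_def : q = (p ^ f)%N) (q_gt1 : (1 < q)%N).
Variables (k P : K).
Let nu : R := (q%:R ^+ 3 * (q%:R ^+ 2 - 1))^-1.
Hypotheses (vk : vK k = nu%:E) (uP : P \in vunit vK).
Let pi := k ^+ wt_pi q * P.
Let pi2 := - k ^+ (q ^ 2 * q.+1).
Hypothesis LTpi2 : pi_LT q pi (pi_LT q pi pi2) = 0.
Hypothesis cpl : complete v.
Variable z : 'I_q.-1 -> K.
Hypotheses (zq : forall i, z i ^+ q.-1 = 1).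
Local Notation rad := (@Y31c_radius R q).
Local Notation gs := (laurent_rel v rad ++ Y31c_equations v q (j pi) (j pi2)).
Local Notation n_ := (ncoord v q (j pi) (j pi2) (j k)).
Local Notation ni_ := (ncoord_inv v q (j pi) (j pi2) (j k)).
Local Notation m := (infinitesimal v).

Let q0 : (0 < q)%N := ltnW q_gt1.
Let vjk : v (j k) = nu%:E. Proof. by rewrite -vKj. Qed.
Let k0 : k != 0.
Proof. by apply: contraTneq isT => e; have := vk; rewrite e val0. Qed.
Let jk0 : j k != 0. Proof. by rewrite fmorph_eq0. Qed.

Section AtPoint.
Variables (U X V y H : K).
Hypotheses (uU : U \in vunit vK) (uX : X \in vunit vK) (uV : V \in vunit vK)
  (uy : y \in vunit vK) (uH : H \in vunit vK).
Let u := k ^+ wt_u q * U.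
Hypotheses (h1 : k ^+ (q ^ 2) * X = pi_u q pi u (k * y))
  (h2 : k ^+ (q ^ 2) * V = pi_u q pi u (k * H)) (h3 : pi2_u q pi u (k * y) = 0)
  (h4 : pi2_u q pi u (k * H) = 0) (h5 : mu2 q pi u (k * y) (k * H) = pi2).

Let nb (i : nat) : K := nth 0 [:: U; X; V; y; H] i.
Let xb (i : nat) : K := k ^+ coord_weight q i * nb i.
Let pt (i : 'I_(5 + 5)) : C :=
  match fintype.split i with inl l => j (xb l) | inr l => (j (xb l))^-1 end.

Let unb (i : 'I_5) : nb i \in vunit vK.
Proof. by case: i => [[|[|[|[|[|]]]]]]. Qed.
Let xb0 (i : 'I_5) : j (xb i) != 0.
Proof. by rewrite fmorph_eq0 mulf_neq0 ?expf_neq0 // (vunit_neq0 (unb i)). Qed.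
Let vxb (i : 'I_5) : v (j (xb i)) = (rad i)%:E.
Proof.
rewrite rmorphM rmorphXn val_mul (val_coord_weight q_gt1 vjk).
by rewrite -vKj (eqP (unb i)) adde0.
Qed.
Let ptl i : pt (lshift 5 i) = j (xb i).
Proof. by rewrite /pt -[lshift 5 i]/(unsplit (inl i)) unsplitK. Qed.
Let ptr i : pt (rshift 5 i) = (j (xb i))^-1.
Proof. by rewrite /pt -[rshift 5 i]/(unsplit (inr i)) unsplitK. Qed.

Let pt_radius i : ((laurent_radius rad i)%:E <= v (pt i))%E.
Proof.
rewrite -[i]splitK; case: (fintype.split i) => l /=.
  by rewrite laurent_radiusl ptl vxb.
by rewrite laurent_radiusr ptr val_inv // vxb.
Qed.

Local Notation tev := (tate_eval cpl pt_radius).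

Let tev_coord i : tev (Defs.coord v rad i) = j (xb i).
Proof. by rewrite tate_eval_poly mevalXU ptl. Qed.
Let tev_coord_inv i : tev (coord_inv v rad i) = (j (xb i))^-1.
Proof. by rewrite tate_eval_poly mevalXU ptr. Qed.
Let tev_const a : tev (laurent_const v rad a) = a.
Proof. by rewrite tate_eval_poly mevalC. Qed.

Let gs_vanish h : h \in gs -> tev h = 0.
Proof.
have w1 l : (l < 5)%N -> tev (Defs.coord v rad (inord l)) = j (xb l).
  by move=> l5; rewrite tev_coord inordK.
rewrite mem_cat => /orP[/mapP[i _ ->]|].
  by rewrite rmorphB rmorphM rmorph1 /= tev_coord tev_coord_inv mulfV ?subrr.
have e0 : xb 0 = u by []. have e1 : xb 1 = k ^+ (q ^ 2) * X by [].
have e2 : xb 2 = k ^+ (q ^ 2) * V by []. have e3 : xb 3 = k * y by [].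
have e4 : xb 4 = k * H by [].
rewrite /Y31c_equations !inE => /or4P[/eqP->|/eqP->|/eqP->|/orP[/eqP->|/eqP->]].
- by rewrite rmorphB /= rmorph_pi_u /= !w1 // tev_const e0 e1 e3 -rmorph_pi_u -h1 subrr.
- by rewrite rmorphB /= rmorph_pi_u /= !w1 // tev_const e0 e2 e4 -rmorph_pi_u -h2 subrr.
- rewrite /pi2_u !rmorph_pi_u /= !w1 // tev_const e0 e3 -!rmorph_pi_u.
  by rewrite -[pi_u _ _ _ _]/(pi2_u q pi u (k * y)) h3 rmorph0.
- rewrite /pi2_u !rmorph_pi_u /= !w1 // tev_const e0 e4 -!rmorph_pi_u.
  by rewrite -[pi_u _ _ _ _]/(pi2_u q pi u (k * H)) h4 rmorph0.
- by rewrite rmorphB /= rmorph_mu2 /= !w1 // !tev_const e0 e3 e4 -rmorph_mu2 h5 subrr.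
Qed.

(** The five equations of the curve are hypotheses on the point, so evaluation of
    convergent series kills the ideal. *)
Lemma evaluation_at_point : exists ev : {rmorphism affinoid gs -> C},
  [/\ forall x, ev (affinoid_const gs x) = x,
      forall a, a \in @top_nilpotent R (affinoid gs) -> ev a \in m,
      forall l, (l < 5)%N -> ev (n_ (inord l)) = j (nb l)
    & forall l, (l < 5)%N -> ev (ni_ (inord l)) = (j (nb l))^-1].
Proof.
exists (affinoid_eval gs_vanish : {rmorphism _ -> _}); split=> [x|a|l l5|l l5].
- exact: affinoid_eval_const.
- exact: affinoid_eval_tn.
- rewrite /ncoord rmorphM /= affinoid_eval_const affinoid_evalE tev_coord inordK //.
  by rewrite /xb rmorphM rmorphXn mulKf // expf_neq0.
- rewrite /ncoord_inv rmorphM /= affinoid_eval_const affinoid_evalE tev_coord_inv inordK //.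
  by rewrite /xb rmorphM rmorphXn invfM mulrA mulfV ?mul1r // expf_neq0.
Qed.
End AtPoint.

Lemma Y31c_enough_points : enough_points v j vK (q ^ 2 * q.+1)%N z (affinoid_const gs)
  (ratioE (n_ (inord 2)) (ni_ (inord 1))) (ni_ (inord 3))
  (scaledW (affinoid_const gs) q (j k) (n_ (inord 2)) (n_ (inord 3)) (n_ (inord 4)) (ni_ (inord 1)))
  (fun a => a \in @top_nilpotent R (affinoid gs)).
Proof.
have jm x : (j x \in m) = (x \in infinitesimal vK) by rewrite !infinitesimalE vKj.
move=> i y0 w0 uy0 Ow0 w0E.
have s0 : (0 < q.-1)%N by rewrite -ltnS prednK.
have z0 : z i != 0.
  by apply: contra_eq_neq (zq i) => ->; rewrite expr0n gtn_eqF // eq_sym oner_eq0.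
have zqq : z i ^+ q = z i by rewrite -[in LHS](prednK q0) exprS zq mulr1.
have mk : k \in infinitesimal vK by rewrite infinitesimalE vk lte_fin; apply: nu_gt0.
have [U [X [V [y [H [E [W /= [[uV uH uy uX uU] [h1 h2 h3 h4 h5] [VE HW] [my mE mW]]]]]]]]] :=
  exists_point pK q_def q_gt1 mk k0 uP (erefl _) LTpi2 zqq z0 uy0 Ow0 w0E.
have [ev [evc evT evn evni]] := evaluation_at_point uU uX uV uy uH h1 h2 h3 h4 h5.
have X0 := vunit_neq0 uX.
have evE : ev (ratioE (n_ (inord 2)) (ni_ (inord 1))) = j E.
  by rewrite /ratioE rmorphM evn // evni //= -fmorphV -rmorphM VE mulfK.
exists ev; split=> //.
- by rewrite evE -rmorphB jm.
- rewrite evni //= -fmorphV -rmorphB jm.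
  have -> : y^-1 - y0^-1 = (y0 - y) * (y^-1 * y0^-1).
    by field; rewrite (vunit_neq0 uy) (vunit_neq0 uy0).
  by apply: infinitesimalMl; [rewrite -infinitesimalN opprB|rewrite vunit_integral // vunitM ?vunitV].
- rewrite (@morph_scaledW _ _ _ j _ _ q k E y H X^-1); [|done|done|by rewrite evn|by rewrite evn
    |by rewrite evni // fmorphV].
  rewrite (_ : _ * _ = W); last first.
    have kV : k^-1 ^+ (q.-1 * q.+1) = k / k ^+ (q ^ 2).
      have -> : k ^+ (q ^ 2) = k * k ^+ (q.-1 * q.+1).
        by rewrite -exprS; congr (_ ^+ _); case: q q_gt1 => // s _ /=; ring.
      by rewrite invfM mulVKf // exprVn.
    rewrite kV (_ : k / k ^+ (q ^ 2) * (H - E * y) / X = (k * H - E * (k * y)) / (k ^+ (q ^ 2) * X)).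
      by rewrite HW addrK mulrAC mulfV ?mul1r // mulf_neq0 ?expf_neq0.
    by field; rewrite X0 expf_neq0.
  by rewrite -rmorphB jm.
Qed.
End CurvePoints.

(** * The curve and the comparison map *)

Section QuotientLift.
Variables (A : comPzRingType) (I : ringIdeal A) (S : comPzRingType) (g : {rmorphism A -> S}).

Lemma ring_quot_lift : (forall a, a \in (I : {pred A}) -> g a = 0) ->
  exists h : {rmorphism ring_quot I -> S}, forall a, h (to_quot I a) = g a.
Proof.
move=> gI; pose h (b : ring_quot I) : S := g (quot_repr b).
have hE a : h (to_quot I a) = g a.
  apply/eqP; rewrite -subr_eq0 -rmorphB gI //.
  by rewrite -to_quotE quot_reprK.
have hB : zmod_morphism h.
  move=> a b; rewrite -[a]quot_reprK -[b]quot_reprK -rmorphB !hE.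
  exact: rmorphB.
have hM : monoid_morphism h.
  split; first by rewrite -(rmorph1 (to_quot I)) hE rmorph1.
  move=> a b; rewrite -[a]quot_reprK -[b]quot_reprK -rmorphM !hE.
  exact: rmorphM.
pose h' : {rmorphism ring_quot I -> S} := HB.pack h
  (GRing.isZmodMorphism.Build _ _ h hB) (GRing.isMonoidMorphism.Build _ _ h hM).
by exists h'.
Qed.
End QuotientLift.

(** Over the residue field every scalar is integral. *)
Definition all_scalars (k : fieldType) : {pred k} := predT.
Fact all_scalars_subring (k : fieldType) : subring_closed (@all_scalars k). Proof. by []. Qed.
HB.instance Definition _ (k : fieldType) := GRing.isSubringClosed.Build k (@all_scalars k) (@all_scalars_subring k).

Section ArtinSchreierForm.
Variables (k : fieldType) (B : comPzRingType) (rho : {rmorphism k -> B}) (q : nat).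
Variables (x y t w : B).
Hypotheses (q_gt1 : (1 < q)%N) (ty : t * y = 1) (wE : w = x * t ^+ (q ^ 2)).

Let tyn n : t ^+ n * y ^+ n = 1.
Proof. by rewrite -exprMn ty expr1n. Qed.

(** With [x = y ^+ (q ^ 2) * w] the equation of the curve becomes
    [y ^+ (q ^ 2 * q.+1) * (w - w ^+ q) = 1]. *)
Lemma artin_schreier_form : x * y ^+ (q ^ 3) - x ^+ q * y ^+ (q ^ 2) = 1 ->
  w ^+ q = w - t ^+ (q ^ 2 * q.+1).
Proof.
move=> xy; have e1 : t ^+ (q ^ 2 * q.+1) = t ^+ (q ^ 2) * t ^+ (q ^ 3).
  by rewrite -exprD; congr (_ ^+ _); ring.
rewrite wE exprMn -exprM -expnSr e1 -[t ^+ _ * t ^+ (q ^ 3)]mulr1 -xy.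
have -> : forall a b c d e : B, a * b * (c * d - e) = c * a * (b * d) - b * a * e by move=> *; ring.
rewrite tyn.
have -> : forall a b c d : B, a * b * (c * d) = c * a * (b * d) by move=> *; ring.
by rewrite tyn !mulr1; ring.
Qed.

Hypothesis wq : w ^+ q = w - t ^+ (q ^ 2 * q.+1).

(** The spanning argument, for the zero ideal and a single piece. *)
Lemma artin_schreier_spanned : exists M : B -> Prop,
  [/\ is_subring M, forall a, M (rho a), M x, M y & forall b, M b -> exists n (a : nat -> {poly k}),
    t ^+ n * b = \sum_(l < q.-2.+2) w ^+ l * poly_eval rho t (a l)].
Proof.
pose A0 (_ : B) := True; pose J (b : B) := b = 0.
have SA : is_subring A0 by [].
have IJ : is_ideal A0 J.
  split=> // [a b' -> ->|a b' _ ->]; rewrite /J; first exact: subrr.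
  exact: mulr0.
have e1 : J (1 - \sum_(i < 1) (1 : B)) by rewrite big_ord1 /J subrr.
have q2 : q.-2.+2 = q by case: q q_gt1 => [|[|]].
have wJ : J (w ^+ q.-2.+2 - (w - t ^+ (q ^ 2 * q.+1))).
  by rewrite q2 wq /J subrr.
pose M := multiplier rho (@all_scalars k) A0 J q.-2 (fun _ : 'I_1 => 1) t w.
have MS : is_subring M by apply: multiplier_subring; [exact: SA|exact: IJ|].
have My : M y by apply: multiplier_y; [exact: SA| |exact: ty].
have Mw : M w by apply: multiplier_w; first [exact: SA|exact: IJ|exact: wJ|done].
exists M; split=> // [a||b Mb].
- by apply: multiplier_rho; first [exact: SA|exact: IJ|done].
- have -> : x = w * y ^+ (q ^ 2) by rewrite wE -mulrA tyn mulr1.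
  by apply: (subring_M MS) => //; apply: (subring_X MS).
have [_ [n [a [_ /eqP]]]] := multiplier_spanned SA e1 Mb.
rewrite subr_eq0 /combination big_ord1 mul1r => /eqP e.
by exists n, (a ord0).
Qed.
End ArtinSchreierForm.

Section CurveRing.
Variables (k : fieldType) (q : nat).
Hypothesis q_gt1 : (1 < q)%N.
Local Notation B := (curve_ring k q).
Let cls : {rmorphism {mpoly k[2]} -> B} := to_quot (gen_ideal [:: curve_poly k q]).
Let rhoC : {rmorphism k -> B} := (cls \o @mpolyC 2 k)%FUN.

Definition curve_x : B := cls 'X_(inord 0).
Definition curve_y : B := cls 'X_(inord 1).
Local Notation x := curve_x.
Local Notation y := curve_y.

Lemma curve_poly_in_ideal : curve_poly k q \in gen_ideal [:: curve_poly k q].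
Proof.
apply/asboolP; exists (fun=> 1); rewrite big_ord_recl big_ord0 addr0 mul1r.
by [].
Qed.

Lemma curve_relation : x * y ^+ (q ^ 3) - x ^+ q * y ^+ (q ^ 2) = 1.
Proof.
have : cls (curve_poly k q) = 0.
  by rewrite -(rmorph0 cls); apply: to_quotP; rewrite subr0 curve_poly_in_ideal.
rewrite /curve_poly rmorphB rmorphD !rmorphM rmorphN !rmorphXn rmorph1 => /eqP.
by rewrite subr_eq0 addrC mulNr => /eqP.
Qed.

(** The inverse of [y], which the equation of the curve makes explicit. *)
Definition curve_t : B := x * y ^+ (q ^ 3).-1 - x ^+ q * y ^+ (q ^ 2).-1.
Local Notation t := curve_t.
Definition curve_w : B := x * t ^+ (q ^ 2).
Local Notation w := curve_w.

Lemma curve_ty : t * y = 1.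
Proof.
have q0 := ltnW q_gt1.
rewrite /curve_t mulrBl -!mulrA -!exprSr !prednK ?expn_gt0 ?q0 //.
exact: curve_relation.
Qed.

Lemma curve_wq : w ^+ q = w - t ^+ (q ^ 2 * q.+1).
Proof. by apply: (artin_schreier_form curve_ty); [|exact: curve_relation]. Qed.

Lemma curve_spanned (b : B) : exists n (a : nat -> {poly k}),
  t ^+ n * b = \sum_(l < q.-2.+2) w ^+ l * poly_eval rhoC t (a l).
Proof.
have [M [MS Mc Mx My Mspan]] := artin_schreier_spanned rhoC q_gt1 curve_ty (erefl w) curve_wq.
apply: Mspan; rewrite -[b]quot_reprK.
rewrite [quot_repr b]mpolyE -[to_quot _ _]/(cls _) rmorph_sum.
apply: (big_ind M) => [||m _]; [exact: (subring_0 MS)|exact: (subring_D MS)|].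
rewrite -mul_mpolyC rmorphM; apply: (subring_M MS); first exact: Mc.
rewrite mpolyXE_id rmorph_prod; apply: (big_ind M) => [||i _].
- exact: (subring_1 MS).
- exact: (subring_M MS).
- rewrite rmorphXn; apply: (subring_X MS).
  case: i => [[|[|]]] //= i2.
    by have -> : Ordinal i2 = inord 0; [apply: val_inj; rewrite /= inordK|].
  by have -> : Ordinal i2 = inord 1; [apply: val_inj; rewrite /= inordK|].
Qed.
End CurveRing.

Section CurveMorphism.
Variables (k : fieldType) (q : nat) (S : comPzRingType) (rho : {rmorphism k -> S}) (t y w : S).
Hypotheses (S1 : 1 != 0 :> S) (q_gt1 : (1 < q)%N) (ty : t * y = 1) (wq : w ^+ q = w - t ^+ (q ^ 2 * q.+1)).

Lemma morph_rho_poly_eval (B : comPzRingType) (rhoB : {rmorphism k -> B}) (psi : {rmorphism B -> S})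
    b p : (forall a, psi (rhoB a) = rho a) -> psi (poly_eval rhoB b p) = poly_eval rho (psi b) p.
Proof.
move=> pc; rewrite /poly_eval rmorph_sum; apply: eq_bigr => i _.
by rewrite rmorphM rmorphXn pc.
Qed.

(** The substitution [x = y ^+ (q ^ 2) * w] satisfies the equation of the curve. *)
Lemma curve_morphism : exists psi : {rmorphism curve_ring k q -> S},
  [/\ forall a, psi (curve_const q a) = rho a, psi (curve_t k q) = t & psi (curve_w k q) = w].
Proof.
pose h (i : 'I_2) := if i == inord 0 then y ^+ (q ^ 2) * w else y.
pose S' : comNzRingType := HB.pack S (GRing.PzSemiRing_isNonZero.Build S S1).
pose rho' : {rmorphism k -> S'} := rho.
pose ev : {rmorphism {mpoly k[2]} -> S} := (@mmap 2 k S' rho' h : {rmorphism {mpoly k[2]} -> S'}).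
have n10 : (inord 1 == inord 0 :> 'I_2) = false by rewrite -val_eqE /= !inordK.
have evx : ev 'X_(inord 0) = y ^+ (q ^ 2) * w by rewrite /= mmapX mmap1U /h eqxx.
have evy : ev 'X_(inord 1) = y by rewrite /= mmapX mmap1U /h n10.
have evC a : ev a%:MP = rho a by rewrite /= mmapC.
have tyn n : y ^+ n * t ^+ n = 1 by rewrite -exprMn mulrC ty expr1n.
have ev0 : ev (curve_poly k q) = 0.
  rewrite /curve_poly rmorphB rmorphD !rmorphM rmorphN !rmorphXn rmorph1 evx evy.
  rewrite exprMn wq.
  have -> : y ^+ (q ^ 2) ^+ q = y ^+ (q ^ 3) by rewrite -exprM -expnSr.
  have := tyn (q ^ 2 * q.+1)%N.
  have -> : (q ^ 2 * q.+1 = q ^ 3 + q ^ 2)%N by ring.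
  rewrite [y ^+ (_ + _)]exprD.
  move: (y ^+ (q ^ 3)) (y ^+ (q ^ 2)) (t ^+ (q ^ 3 + q ^ 2)) => Y3 Y2 T e.
  by rewrite -e; ring.
have evI p : p \in gen_ideal [:: curve_poly k q] -> ev p = 0.
  move=> /asboolP[d ->]; rewrite rmorph_sum big1 // => -[[|//] i0] _.
  by rewrite rmorphM [X in _ * X]ev0 mulr0.
have [psi psiE] := ring_quot_lift evI.
have psix : psi (curve_x k q) = y ^+ (q ^ 2) * w by rewrite -evx -psiE.
have psiy : psi (curve_y k q) = y by rewrite -evy -psiE.
have psit : psi (curve_t k q) = t.
  have := congr1 psi (curve_ty k q_gt1); rewrite rmorphM rmorph1 psiy => e.
  by rewrite -[LHS]mulr1 -ty mulrCA e mulr1.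
exists psi; split=> // [a|]; first by rewrite -evC -psiE.
by rewrite /curve_w rmorphM rmorphXn psit psix mulrAC tyn mul1r.
Qed.
End CurveMorphism.

Section ReductionIso.
Variables (k : fieldType) (q : nat) (S : comPzRingType) (rho : {rmorphism k -> S}).
Hypothesis S1 : 1 != 0 :> S.
Variables (E t y w : S) (z : 'I_q.-1 -> k).
Hypotheses (q_gt1 : (1 < q)%N) (qk : q%:R = 0 :> k).
Hypotheses (z_inj : injective z) (zq : forall i, z i ^+ q.-1 = 1).
Hypotheses (ty : t * y = 1) (Eq : E ^+ q.-1 = 1) (wq : w ^+ q = w - t ^+ (q ^ 2 * q.+1)).
Let e i := poly_eval rho E (root_projector q (z i)).
Hypothesis independent : forall a, combination rho q.-2 e t w a = 0 ->
  forall i l, (l < q)%N -> a i l = 0.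
Hypothesis spanning : forall x, exists M a, t ^+ M * x = combination rho q.-2 e t w a.
Local Notation B := (curve_ring k q).

Let eE i : e i * E = rho (z i) * e i.
Proof.
rewrite /e -poly_evalMX root_projector_mulX // raddfB /= !poly_evalZ raddfB /=.
rewrite -['X^_]mul1r poly_evalMXn !(poly_evalC rho E 1) rmorph1 mul1r Eq subrr.
by rewrite mulr0 subr0.
Qed.

Let e_poly i p : e i * poly_eval rho E p = rho p.[z i] * e i.
Proof.
have eX n : e i * E ^+ n = rho (z i) ^+ n * e i.
  elim: n => [|n IHn]; first by rewrite mulr1 mul1r.
  by rewrite exprSr mulrA IHn -mulrA eE mulrA -exprSr.
rewrite horner_coef rmorph_sum mulr_sumr mulr_suml; apply: eq_bigr => n _.
by rewrite mulrCA eX rmorphM rmorphXn /= mulrA.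
Qed.

Let ee i i' : e i * e i' = (i == i')%:R * e i.
Proof.
rewrite {2}/e e_poly root_projector_eval // (inj_eq z_inj) eq_sym.
by rewrite rmorph_nat.
Qed.

Let e_sum : \sum_i e i = 1.
Proof. by rewrite -raddf_sum root_projector_sum //= poly_evalC rmorph1. Qed.

(** The [e i] are orthogonal idempotents with sum [1], so the morphisms [psi] from the curve
    assemble to a morphism [Psi] from the product.  It matches normal forms on both sides:
    it is injective by independence and onto by spanning. *)
Theorem reduction_iso : exists phi : {rmorphism S -> prod_ring q.-1 B},
  bijective phi /\ forall a, phi (rho a) = fun=> curve_const q a.
Proof.
have q2 : q.-2.+2 = q by case: q q_gt1 => [|[|]].
have [psi [psiC psit psiw]] := curve_morphism rho S1 q_gt1 ty wq.
have tyn n : t ^+ n * y ^+ n = 1 by rewrite -exprMn ty expr1n.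
pose Psi (G : prod_ring q.-1 B) : S := \sum_i e i * psi (G i).
have ePsi i G : e i * Psi G = e i * psi (G i).
  rewrite mulr_sumr (bigD1 i) //= mulrA ee eqxx mul1r big1 ?addr0 // => i' /negPf ii'.
  by rewrite mulrA ee eq_sym ii' mul0r mul0r.
have PsiB : zmod_morphism Psi.
  by move=> F G; rewrite /Psi -sumrB; apply: eq_bigr => i _; rewrite rmorphB mulrBr.
have PsiM : monoid_morphism Psi.
  split; first by rewrite /Psi -e_sum; apply: eq_bigr => i _; rewrite rmorph1 mulr1.
  move=> F G; rewrite {2}/Psi mulr_suml; apply: eq_bigr => i _.
  by rewrite rmorphM mulrAC ePsi mulrA mulrAC.
pose Psi' : {rmorphism prod_ring q.-1 B -> S} := HB.pack Psi
  (GRing.isZmodMorphism.Build _ _ Psi PsiB) (GRing.isMonoidMorphism.Build _ _ Psi PsiM).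
pose cls : {rmorphism k -> B} := (to_quot (gen_ideal [:: curve_poly k q]) \o @mpolyC 2 k)%FUN.
have psi_poly p : psi (poly_eval cls (curve_t k q) p) = poly_eval rho t p.
  by rewrite -psit; apply: morph_rho_poly_eval => a; apply: psiC.
have Psi_inj : injective Psi.
  apply: (raddf_inj (f := Psi')) => F /= F0; apply/funext => i.
  have [M [a aE]] := curve_spanned q_gt1 (F i).
  have a0 l : (l < q)%N -> a l = 0.
    move=> lq; suff /independent/(_ i l lq) : combination rho q.-2 e t w
      (fun i' l => if i' == i then a l else 0) = 0 by rewrite eqxx.
    rewrite /combination (bigD1 i) //= [X in _ + X]big1 ?addr0 => [|i' ii']; last first.
      rewrite (negPf ii').
      by rewrite big1 ?mulr0 // => l' _; rewrite raddf0 mulr0.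
    rewrite eqxx.
    have -> : \sum_(l < q.-2.+2) w ^+ l * poly_eval rho t (a l) = t ^+ M * psi (F i).
      rewrite -[in RHS]psit -rmorphXn -rmorphM aE rmorph_sum; apply: eq_bigr => l' _.
      by rewrite rmorphM rmorphXn psiw psi_poly.
    by rewrite mulrCA -ePsi [Psi F]F0 !mulr0.
  have tF : curve_t k q ^+ M * F i = 0.
    rewrite aE big1 // => l _; rewrite a0 ?raddf0 ?mulr0 //.
    by rewrite -[X in (_ < X)%N]q2.
  transitivity (curve_y k q ^+ M * (curve_t k q ^+ M * F i)); last by rewrite tF mulr0.
  by rewrite mulrA -exprMn [curve_y k q * _]mulrC curve_ty // expr1n mul1r.
have Psi_surj x : exists F, Psi F = x.
  have [M [a aE]] := spanning x.
  pose G (i : 'I_q.-1) : B := \sum_(l < q.-2.+2) curve_w k q ^+ l * poly_eval cls (curve_t k q) (a i l).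
  exists (fun i => curve_y k q ^+ M * G i).
  have psiy : psi (curve_y k q) = y.
    have := congr1 psi (curve_ty k q_gt1); rewrite rmorphM rmorph1 psit => e1.
    by rewrite -[LHS]mul1r -ty mulrAC e1 mul1r.
  transitivity (y ^+ M * (t ^+ M * x)); last by rewrite mulrA [y ^+ M * _]mulrC tyn mul1r.
  rewrite aE mulr_sumr; apply: eq_bigr => i _; rewrite rmorphM rmorphXn psiy mulrCA.
  congr (_ * (_ * _)); rewrite rmorph_sum; apply: eq_bigr => l _.
  by rewrite rmorphM rmorphXn psiw psi_poly.
have [phi phiP] := choice Psi_surj.
have phiK : cancel Psi phi by move=> F; apply: Psi_inj.
pose phi' : {rmorphism S -> prod_ring q.-1 B} := HB.pack phi
  (GRing.isZmodMorphism.Build _ _ phi (can2_zmod_morphism (f := Psi') phiK phiP))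
  (GRing.isMonoidMorphism.Build _ _ phi (can2_monoid_morphism (f := Psi') phiK phiP)).
exists phi'; split; first by exists Psi.
move=> a; apply: Psi_inj; rewrite [LHS]phiP /Psi (eq_bigr (fun i => e i * rho a)) => [|i _].
  by rewrite -mulr_suml e_sum mul1r.
by rewrite psiC.
Qed.
End ReductionIso.

(** * Reductions of filtered algebras *)

Section ResidueClass.
Variables (R : realType) (A : filteredRing R).
Local Notation pb := (@power_bounded R A).
Local Notation tn := (@top_nilpotent R A).

(** Extended by the class of [0] outside the power-bounded elements, so as to be applicable
    without carrying proofs. *)
Definition red (a : A) : reduction A := reduce (insubd 0 a).

Lemma redE (x : power_bounded_type A) : red (pb_val x) = reduce x.
Proof. by rewrite /red -[pb_val x]/(val x) valKd. Qed.

Lemma redB a b : a \in pb -> b \in pb -> red (a - b) = red a - red b.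
Proof.
move=> pa pb'; rewrite -[a]/(pb_val (PowerBounded pa)) -[b]/(pb_val (PowerBounded pb')).
rewrite !redE -[RHS](rmorphB (to_quot (@top_nilpotent_ideal R A))).
exact: (redE (PowerBounded pa - PowerBounded pb')).
Qed.

Lemma redM a b : a \in pb -> b \in pb -> red (a * b) = red a * red b.
Proof.
move=> pa pb'; rewrite -[a]/(pb_val (PowerBounded pa)) -[b]/(pb_val (PowerBounded pb')).
rewrite !redE -[RHS](rmorphM (to_quot (@top_nilpotent_ideal R A))).
exact: (redE (PowerBounded pa * PowerBounded pb')).
Qed.

Lemma red1 : red 1 = 1.
Proof. exact: (redE 1). Qed.

Lemma red_eq0 a : a \in pb -> (red a == 0) = (a \in tn).
Proof.
move=> pa; rewrite -[a]/(pb_val (PowerBounded pa)) redE.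
have -> : (0 : reduction A) = to_quot (@top_nilpotent_ideal R A) 0 by rewrite raddf0.
by rewrite to_quotE subr0.
Qed.

Lemma red0 : red 0 = 0.
Proof. by apply/eqP; rewrite red_eq0 ?rpred0 // top_nilpotent0. Qed.

Lemma redX a n : a \in pb -> red (a ^+ n) = red a ^+ n.
Proof.
by move=> pa; elim: n => [|n IHn]; rewrite ?red1 // !exprS redM ?rpredX // IHn.
Qed.

Lemma redD a b : a \in pb -> b \in pb -> red (a + b) = red a + red b.
Proof.
by move=> pa pb'; rewrite -{1}[b]opprK redB ?rpredN // -[- b]sub0r redB ?rpred0 // red0 sub0r opprK.
Qed.

Lemma red_sum (I : Type) (r : seq I) (F : I -> A) :
  (forall i, F i \in pb) -> red (\sum_(i <- r) F i) = \sum_(i <- r) red (F i).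
Proof.
move=> OF; elim: r => [|i r IHr]; first by rewrite !big_nil red0.
by rewrite !big_cons redD ?IHr ?rpred_sum.
Qed.

Lemma red_surj (x : reduction A) : exists2 a, a \in pb & red a = x.
Proof.
by exists (pb_val (quot_repr x)); [exact: pb_valP|rewrite redE; apply: quot_reprK].
Qed.
End ResidueClass.

Section ReductionOfSpanned.
Variables (R : realType) (C : fieldType) (v : valuation R C) (A : filteredRing R).
Variable c : {rmorphism C -> A}.
Hypothesis c_fil : forall M x, (M%:E <= v x)%E -> @fil R A M (c x).
Local Notation pb := (@power_bounded R A).
Local Notation tn := (@top_nilpotent R A).
Local Notation O := (integral_elt v).
Local Notation m := (infinitesimal v).

Lemma const_pb x : x \in O -> c x \in pb.
Proof.
move=> Ox; apply/asboolP; exists 0 => n; rewrite -rmorphXn; apply: c_fil.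
exact: valX_ge0.
Qed.

Lemma const_tn x : x \in m -> c x \in tn.
Proof.
move=> mx; have [->|x0] := eqVneq x 0; first by rewrite rmorph0 top_nilpotent0.
apply: (@fil_tn _ _ (fine (v x))).
  by move: mx; rewrite infinitesimalE (val_fine v x0) lte_fin.
by apply: c_fil; rewrite -val_fine.
Qed.

(** Infinitesimal constants are topologically nilpotent, so constants act on the reduction
    through the residue field. *)
Lemma residue_scalars : exists rho : {rmorphism residue_field v -> reduction A},
  forall x, x \in O -> rho (res v x) = red (c x).
Proof.
pose g (x : valuation_ring v) := red (c (vr_val x)).
have gB : zmod_morphism g.
  by move=> x y; rewrite /g -redB ?const_pb ?vr_valP // -rmorphB.
have gM : monoid_morphism g.
  split; first by rewrite /g -[vr_val 1]/(1 : C) rmorph1 red1.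
  by move=> x y; rewrite /g -redM ?const_pb ?vr_valP // -rmorphM.
pose g' : {rmorphism valuation_ring v -> reduction A} := HB.pack g
  (GRing.isZmodMorphism.Build _ _ g gB) (GRing.isMonoidMorphism.Build _ _ g gM).
have [x mx|rho rhoE] := @ring_quot_lift _ (@maximal_ideal _ _ v) _ g'.
  by apply/eqP; rewrite red_eq0 ?const_pb ?vr_valP // const_tn.
exists rho => x Ox; rewrite -[x]/(vr_val (ValuationRing Ox)) resE.
exact: rhoE.
Qed.

Variables (n s : nat) (k : C) (A0 : A -> Prop) (e : 'I_n -> A) (t w : A).
Hypotheses (k0 : k != 0) (mk : k \in m).
Hypotheses (SA : is_subring A0) (bA : bounded A0) (A0fil : forall a, @fil R A 0 a -> A0 a).
Hypotheses (A0t : A0 t).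
Let J (a : A) := exists2 b, A0 b & a = c k * b.
Hypothesis A0_span : forall a, A0 a -> spanned c O A0 J s e t w a.
Hypothesis independent : forall a : 'I_n -> nat -> {poly C},
  (forall i l, a i l \is a polyOver O) -> combination c s e t w a \in tn ->
  forall i l, (l < s.+2)%N -> forall j, (a i l)`_j \in m.

Let A0pb a : A0 a -> a \in pb. Proof. exact: bounded_pb. Qed.
Let J_tn a : J a -> a \in tn.
Proof. by move=> [b Ab ->]; rewrite mulrC; apply: top_nilpotentM; [exact: A0pb|exact: const_tn]. Qed.

(** The error term of the spanning property is [c k] times an element of [A0], to which the
    property applies again. *)
Let A0_expansion N a : A0 a -> exists M d, integral_coefs O d /\
  exists2 b, A0 b & t ^+ M * a - combination c s e t w d = c k ^+ N.+1 * b.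
Proof.
elim: N a => [|N IHN] a Aa.
  by have [_ [M [d [Od [b Ab abE]]]]] := A0_span Aa; exists M, d; split=> //; exists b.
have [M [d [Od [b Ab abE]]]] := IHN a Aa.
have [_ [M' [d' [Od' [b' Ab' bE]]]]] := A0_span Ab.
exists (M' + M)%N, (fun i l => d i l * 'X^M' + k ^+ N.+1 *: d' i l); split=> [i l|].
  rewrite rpredD ?rpredM ?rpredX ?polyOverX // -mul_polyC rpredM ?polyOverC ?rpredX //.
  exact: infinitesimal_integral.
exists b' => //; rewrite combinationD combinationMXn combinationZ rmorphXn exprD opprD addrA.
have -> : forall a b c d f : A, a * b * c - a * d - f = a * (b * c - d) - f by move=> *; ring.
by rewrite abE [c k ^+ N.+2]exprSr -[RHS]mulrA -bE; move: (c k ^+ N.+1) => K; ring.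
Qed.

(** A multiple of [a] by a power of [k] lies in [A0]; expanding it to a precision beyond that
    power and dividing gives a combination, whose coefficients need not be integral a priori.
    The difference with [a] shows that the combination is power-bounded, and independence
    then makes the coefficients integral. *)
Lemma power_bounded_expansion a : a \in pb -> exists M d, integral_coefs O d /\
  t ^+ M * a - combination c s e t w d \in tn.
Proof.
move=> pa; have [K aK] := fil_ex a.
have nu0 : 0 < fine (v k) by move: mk; rewrite infinitesimalE (val_fine v k0) lte_fin.
have [N /(_ N (leqnn _)) KN] := fil_archimedean (- K) nu0.
have kN0 : k ^+ N != 0 by rewrite expf_neq0.
have A0a : A0 (c k ^+ N * a).
  apply: A0fil; rewrite -[0](subrr (- K)) opprK; apply: filM => //.
  by rewrite -rmorphXn; apply: c_fil; rewrite valXn.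
have [M [d0 [Od0 [b Ab abE]]]] := A0_expansion N A0a.
pose d i l := if (l < s.+2)%N then k ^- N *: d0 i l else 0.
have dE : combination c s e t w d = c (k ^- N) * combination c s e t w d0.
  rewrite -combinationZ /combination; apply: eq_bigr => i _; congr (_ * _).
  by apply: eq_bigr => l _; rewrite /d ltn_ord.
have abN : t ^+ M * a - combination c s e t w d = c k * b.
  have ckV : c (k ^- N) * c k ^+ N = 1 by rewrite -rmorphXn -rmorphM mulVf ?rmorph1.
  transitivity (c (k ^- N) * (t ^+ M * (c k ^+ N * a) - combination c s e t w d0)).
    rewrite dE; have -> : forall x y z r d : A, x * (y * (z * r) - d) = x * z * (y * r) - x * d.
      by move=> *; ring.
    by rewrite ckV mul1r.
  rewrite abE exprS; have -> : forall x y z r : A, x * (y * z * r) = x * z * (y * r).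
    by move=> *; ring.
  by rewrite ckV mul1r.
have tnab : t ^+ M * a - combination c s e t w d \in tn.
  by rewrite abN; apply: J_tn; exists b.
exists M, d; split=> //.
have pbd : combination c s e t w d \in pb.
  have -> : combination c s e t w d = t ^+ M * a - c k * b by rewrite -abN; ring.
  apply: rpredB; first by rewrite rpredM // rpredX // A0pb.
  by rewrite rpredM ?(A0pb Ab) // const_pb // infinitesimal_integral.
pose B := \max_(i < n) \max_(l < s.+2) size (d i l).
have dB i l r : (B <= r)%N -> (d i l)`_r = 0.
  move=> Br; rewrite nth_default //; have [ls|] := ltnP l s.+2; last first.
    by move=> sl; rewrite /d ltnNge sl size_poly0.
  rewrite (leq_trans _ Br) // (leq_trans _ (leq_bigmax i)) //.
  exact: (leq_bigmax (Ordinal ls)).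
suff H (x : 'I_n * 'I_s.+2 * 'I_B) : (d x.1.1 x.1.2)`_x.2 \in O.
  move=> i l; apply/polyOverP => r; have [ls|sl] := ltnP l s.+2; last first.
    by rewrite /d ltnNge sl coef0 rpred0.
  have [rB|/dB ->] := ltnP r B; last exact: rpred0.
  exact: (H (i, Ordinal ls, Ordinal rB)).
(* if the coefficient [lam] of least valuation is not integral, dividing by it gives an
   integral, topologically nilpotent combination with a coefficient [1] *)
pose F (x : 'I_n * 'I_s.+2 * 'I_B) := v (d x.1.1 x.1.2)`_x.2.
case: (@arg_minP _ _ _ x xpredT F isT) => y _ ymin.
have Ole x1 x2 : (v x1 <= v x2)%E -> x1 \in O -> x2 \in O.
  by rewrite !integral_eltE => le0 a0; apply: le_trans le0.
apply: (Ole _ _ (ymin x isT)); apply: contraT => nO.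
set lam := (d y.1.1 y.1.2)`_y.2 in nO.
have lam0 : lam != 0 by apply: contraNneq nO => ->; rewrite rpred0.
have mlam := integralV nO.
pose d' i l := lam^-1 *: d i l.
have Od' i l : d' i l \is a polyOver O.
  apply/polyOverP => r; rewrite coefZ.
  have [ls|sl] := ltnP l s.+2; last by rewrite /d ltnNge sl coef0 mulr0 rpred0.
  have [rB|/dB ->] := ltnP r B; last by rewrite mulr0 rpred0.
  have := ymin (i, Ordinal ls, Ordinal rB) isT; rewrite /F /= => le_v.
  rewrite integral_eltE val_mul val_inv //.
  have [->|dn0] := eqVneq (d i l)`_r 0; first by rewrite val0 addey // leey.
  move: le_v; rewrite -/lam (val_fine v lam0) (val_fine v dn0) lee_fin => le_v.
  by rewrite -EFinD lee_fin addrC subr_ge0.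
have := fun D => independent Od' D y.1.1 (ltn_ord y.1.2) y.2.
have -> : (d' y.1.1 y.1.2)`_y.2 = 1 by rewrite coefZ mulVf.
rewrite (negPf (infinitesimal1 v)); apply.
rewrite combinationZ mulrC; apply: top_nilpotentM => //.
exact: const_tn.
Qed.
End ReductionOfSpanned.

(** * Reductions with spanning and independent combinations *)

Section FilteredReduction.
Variables (R : realType) (C : fieldType) (v : valuation R C) (A : filteredRing R).
Variables (c : {rmorphism C -> A}) (q : nat) (k : C).
Hypothesis c_fil : forall M x, (M%:E <= v x)%E -> @fil R A M (c x).
Local Notation pb := (@power_bounded R A).
Local Notation tn := (@top_nilpotent R A).
Local Notation O := (integral_elt v).
Local Notation m := (infinitesimal v).
Local Notation res := (res v).
Hypotheses (q_gt1 : (1 < q)%N) (qC : q%:R = 0 :> C) (k0 : k != 0) (mk : k \in m).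
Variables (A0 : A -> Prop) (E t y w : A) (z : 'I_q.-1 -> C).
Let e i := poly_eval c E (root_projector q (z i)).
Hypotheses (SA : is_subring A0) (bA : bounded A0) (A0fil : forall a, @fil R A 0 a -> A0 a).
Hypotheses (A0E : A0 E) (A0t : A0 t) (A0y : A0 y) (A0w : A0 w).
Hypotheses (zq : forall i, z i ^+ q.-1 = 1) (z_inj : injective (fun i => res (z i))).
Hypotheses (ty : t * y = 1) (Eq : E ^+ q.-1 - 1 \in tn)
  (wq : w ^+ q - (w - t ^+ (q ^ 2 * q.+1)) \in tn).
Hypothesis A0_span : forall a, A0 a ->
  spanned c O A0 (fun a => exists2 b, A0 b & a = c k * b) q.-2 e t w a.
Hypothesis independent : forall a : 'I_q.-1 -> nat -> {poly C},
  (forall i l, a i l \is a polyOver O) -> combination c q.-2 e t w a \in tn ->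
  forall i l, (l < q)%N -> forall j, (a i l)`_j \in m.

Let A0pb a : A0 a -> a \in pb. Proof. exact: bounded_pb. Qed.
Let q2 : q.-2.+2 = q. Proof. by case: q q_gt1 => [|[|]]. Qed.
Let s0 : (0 < q.-1)%N. Proof. by rewrite -ltnS prednK // (ltnW q_gt1). Qed.
Let uz i : z i \in vunit v. Proof. exact: (vunit_root_of_unity v s0). Qed.
Let epoly i : root_projector q (z i) \is a polyOver O.
Proof. by apply: root_projector_over; rewrite vunit_integral // vunitV. Qed.

Lemma red_poly_eval (rho : {rmorphism residue_field v -> reduction A}) a (P : {poly C}) :
  (forall x, x \in O -> rho (res x) = red (c x)) -> a \in pb -> P \is a polyOver O ->
  poly_eval c a P \in pb /\ red (poly_eval c a P) = poly_eval rho (red a) (map_poly res P).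
Proof.
move=> rhoE pa /polyOverP OP.
have pt (i : nat) : c P`_i * a ^+ i \in pb by rewrite rpredM ?rpredX // (const_pb c_fil).
split; first by apply: rpred_sum => i _; apply: pt.
rewrite [RHS](@poly_evalE _ _ _ _ _ (size P)) ?size_poly // /poly_eval red_sum //.
apply: eq_bigr => i _; rewrite redM ?rpredX ?(const_pb c_fil) // redX //.
by rewrite coef_map_id0 ?res0 // rhoE.
Qed.

Lemma map_res_lift (P : {poly residue_field v}) : exists2 Q : {poly C},
  Q \is a polyOver O & map_poly res Q = P.
Proof.
have [F HF] := choice (fun x => (let: ex_intro2 x0 O0 E0 := res_surj x in
  ex_intro (fun x0 => x0 \in O /\ res x0 = x) x0 (conj O0 E0))).
exists (\poly_(i < size P) F P`_i).
  by apply/polyOverP => i; rewrite coef_poly; case: ifP => _; [case: (HF P`_i)|exact: rpred0].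
apply/polyP => i; rewrite coef_map_id0 ?res0 // coef_poly; case: ltnP => [_|sP].
  by case: (HF P`_i).
by rewrite res0 nth_default.
Qed.

Lemma map_res_root_projector i :
  map_poly res (root_projector q (z i)) = root_projector q (res (z i)).
Proof.
apply/polyP => l; rewrite coef_map_id0 ?res0 // /root_projector !coefN !coef_sum.
have Oz j : (z i)^-1 ^+ j \in O by rewrite rpredX // vunit_integral // vunitV.
have Ot (j : nat) : ((z i)^-1 ^+ j *: 'X^j : {poly C})`_l \in O.
  by rewrite coefZ coefXn rpredM // rpred_nat.
rewrite resN ?rpred_sum // res_sum //; congr (- _); apply: eq_bigr => j _.
rewrite !coefZ !coefXn resM ?rpred_nat // resX ?resV ?vunit_integral ?vunitV //.
by case: eqP; rewrite ?res1 ?res0.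
Qed.

(** Independence, spanning and the relations between [E], [t] and [w] pass from [A] to its
    reduction, where congruences become equalities. *)
Theorem filtered_reduction_iso :
  exists phi : {rmorphism reduction A -> prod_ring q.-1 (curve_ring (residue_field v) q)},
  bijective phi /\ forall x, x \in O -> phi (red (c x)) = fun=> curve_const q (res x).
Proof.
have [rho rhoE] := residue_scalars c_fil.
have pE := A0pb A0E; have pt := A0pb A0t; have pw := A0pb A0w; have py := A0pb A0y.
pose eb i := poly_eval rho (red E) (root_projector q (res (z i))).
have ebE i : e i \in pb /\ red (e i) = eb i.
  by have := red_poly_eval rhoE pE (epoly i); rewrite map_res_root_projector.
have red_comb a : (forall i l, a i l \is a polyOver O) ->
    combination c q.-2 e t w a \in pb /\ red (combination c q.-2 e t w a) =
    combination rho q.-2 eb (red t) (red w) (fun i l => map_poly res (a i l)).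
  move=> Oa; have pev i l := red_poly_eval rhoE pt (Oa i l).
  have pin i l : w ^+ l * poly_eval c t (a i l) \in pb by rewrite rpredM ?rpredX //; case: (pev i l).
  have pi i : \sum_(l < q.-2.+2) w ^+ l * poly_eval c t (a i l) \in pb by apply: rpred_sum.
  have pi' i : e i * (\sum_(l < q.-2.+2) w ^+ l * poly_eval c t (a i l)) \in pb.
    by rewrite rpredM //; case: (ebE i).
  split; first by apply: rpred_sum.
  rewrite /combination red_sum //; apply: eq_bigr => i _; have [pei rei] := ebE i.
  rewrite redM // rei; congr (_ * _); rewrite red_sum //; apply: eq_bigr => l _.
  by have [pl rl] := pev i l; rewrite redM ?rpredX // redX // rl.
have ND a : combination rho q.-2 eb (red t) (red w) a = 0 -> forall i l, (l < q)%N -> a i l = 0.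
  move=> a0.
  have [F HF] := choice (fun P => (let: ex_intro2 Q O0 E0 := map_res_lift P in
    ex_intro (fun Q => Q \is a polyOver O /\ map_poly res Q = P) Q (conj O0 E0))).
  have OF i l : F (a i l) \is a polyOver O by case: (HF (a i l)).
  have FE i l : map_poly res (F (a i l)) = a i l by case: (HF (a i l)).
  have [pF rF] := red_comb _ OF.
  have rF0 : red (combination c q.-2 e t w (fun i l => F (a i l))) = 0.
    rewrite rF -[RHS]a0 /combination; apply: eq_bigr => i _; congr (_ * _).
    by apply: eq_bigr => l _; rewrite FE.
  move/eqP: rF0; rewrite red_eq0 // => tF i l lq.
  have mF := independent OF tF i lq.
  apply/polyP => r; rewrite -FE coef_map_id0 ?res0 // coef0; apply/eqP.
  by rewrite res_eq0 //; apply/polyOverP.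
have SP x : exists M a, red t ^+ M * x = combination rho q.-2 eb (red t) (red w) a.
  have [a pa <-] := red_surj x.
  have ind' b : (forall i l, b i l \is a polyOver O) -> combination c q.-2 e t w b \in tn ->
      forall i l, (l < q.-2.+2)%N -> forall j, (b i l)`_j \in m.
    by move=> Ob Tb i l; rewrite q2; apply: (independent Ob Tb).
  have [M [d [Od td]]] := power_bounded_expansion c_fil k0 mk SA bA A0fil A0t A0_span ind' pa.
  have [pd rd] := red_comb d Od.
  exists M, (fun i l => map_poly res (d i l)).
  apply/eqP; rewrite -rd -redX // -redM ?rpredX // -subr_eq0 -redB ?rpredM ?rpredX //.
  by rewrite red_eq0 // rpredB ?rpredM ?rpredX.
have nz : (1 : reduction A) != 0.
  apply/eqP => e10; have := ND (fun _ _ => 1) _ (Ordinal s0) 0%N (ltnW q_gt1).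
  rewrite -[combination _ _ _ _ _ _]mul1r e10 mul0r => /(_ (erefl _)) /eqP.
  by rewrite oner_eq0.
have qk : q%:R = 0 :> residue_field v.
  have resn n : n%:R = res n%:R.
    elim: n => [|n IHn]; first by rewrite res0.
    by rewrite -!natr1 resD ?rpred_nat ?rpred1 // res1 IHn.
  by rewrite resn qC res0.
have zq' i : res (z i) ^+ q.-1 = 1 by rewrite -resX ?vunit_integral // zq res1.
have ty' : red t * red y = 1 by rewrite -redM // ty red1.
have Eq' : red E ^+ q.-1 = 1.
  apply/eqP; rewrite -subr_eq0 -redX // -red1 -redB ?rpredX ?rpred1 //.
  by rewrite red_eq0 // rpredB ?rpredX ?rpred1.
have wq' : red w ^+ q = red w - red t ^+ (q ^ 2 * q.+1).
  apply/eqP; rewrite -subr_eq0 -!redX // -!redB ?rpredX // ?rpredB ?rpredX //.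
  by rewrite red_eq0 // rpredB ?rpredX // rpredB ?rpredX.
have [phi [phi_bij phiC]] :=
  @reduction_iso _ q _ rho nz (red E) (red t) (red y) (red w) _ q_gt1 qk z_inj zq' ty' Eq' wq' ND SP.
exists phi; split=> // x Ox; rewrite -rhoE //.
Qed.
End FilteredReduction.

(** * The reduction of the affinoid *)

Section Y31cReduction.
Variables (R : realType) (C : fieldType) (v : valuation R C).
Variables (K : closedFieldType) (j : {rmorphism K -> C}) (vK : valuation R K).
Hypothesis vKj : forall x, vK x = v (j x).
Variables (p f q : nat).
Hypotheses (pK : p \in [pchar K]) (q_def : q = (p ^ f)%N) (q_gt1 : (1 < q)%N).
Variables (k P : K).
Hypotheses (vk : vK k = ((q%:R ^+ 3 * (q%:R ^+ 2 - 1))^-1)%:E) (uP : P \in vunit vK).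
Let pi := k ^+ wt_pi q * P.
Let pi2 := - k ^+ (q ^ 2 * q.+1).
Hypothesis LTpi2 : pi_LT q pi (pi_LT q pi pi2) = 0.
Hypothesis cpl : complete v.
Variable z : 'I_q.-1 -> K.
Hypotheses (z_inj : injective z) (zq : forall i, z i ^+ q.-1 = 1).
Local Notation rad := (@Y31c_radius R q).
Local Notation gs := (laurent_rel v rad ++ Y31c_equations v q (j pi) (j pi2)).
Local Notation A := (affinoid gs).
Local Notation c := (affinoid_const gs).
Local Notation n_ := (ncoord v q (j pi) (j pi2) (j k)).
Local Notation ni_ := (ncoord_inv v q (j pi) (j pi2) (j k)).
Local Notation O := (integral_elt v).
Local Notation m := (infinitesimal v).

Let q0 : (0 < q)%N := ltnW q_gt1.
Let s0 : (0 < q.-1)%N. Proof. by rewrite -ltnS prednK. Qed.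
Let vjk : v (j k) = ((q%:R ^+ 3 * (q%:R ^+ 2 - 1))^-1)%:E. Proof. by rewrite -vKj. Qed.
Let k0 : k != 0.
Proof. by apply: contraTneq isT => e; have := vk; rewrite e val0. Qed.
Let jk0 : j k != 0. Proof. by rewrite fmorph_eq0. Qed.
Let mjk : j k \in m. Proof. by rewrite infinitesimalE vjk lte_fin; apply: nu_gt0. Qed.
Let kn0 l : j k ^+ l != 0. Proof. exact: expf_neq0. Qed.
Let U0 : A -> Prop := @fil R A 0.

Lemma ncoord_fil0 i : U0 (n_ i).
Proof.
rewrite /U0 -[0](addNr (rad i)); apply: filM.
  apply: affinoid_fil_const; rewrite val_inv ?kn0 //.
  by rewrite (val_coord_weight q_gt1 vjk).
by have := @affinoid_fil_coord _ _ v _ (laurent_radius rad) gs (lshift 5 i); rewrite laurent_radiusl.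
Qed.

Lemma ncoord_inv_fil0 i : U0 (ni_ i).
Proof.
rewrite /U0 -[0](subrr (rad i)); apply: filM.
  by apply: affinoid_fil_const; rewrite (val_coord_weight q_gt1 vjk).
by have := @affinoid_fil_coord _ _ v _ (laurent_radius rad) gs (rshift 5 i); rewrite laurent_radiusr.
Qed.

Lemma ncoord_generate (G : A -> Prop) : is_subring G -> (forall x, x \in O -> G (c x)) ->
  (forall i, G (n_ i)) -> (forall i, G (ni_ i)) ->
  (forall a, U0 a -> G (c (j k) * a)) -> forall a, U0 a -> G a.
Proof.
move=> GS Gc Gn Gni Gk.
pose kap (i : 'I_(5 + 5)) : C := match fintype.split i with
  inl l => j k ^+ coord_weight q l | inr l => j k ^- coord_weight q l end.
have kapl i : kap (lshift 5 i) = j k ^+ coord_weight q i.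
  by rewrite /kap -[lshift 5 i]/(unsplit (inl i)) unsplitK.
have kapr i : kap (rshift 5 i) = j k ^- coord_weight q i.
  by rewrite /kap -[rshift 5 i]/(unsplit (inr i)) unsplitK.
apply: (@affinoid_fil0_ind _ _ v _ _ gs G kap (j k)) => //.
  move=> i; rewrite -[i]splitK; case: (fintype.split i) => l /=.
    by rewrite kapl laurent_radiusl (val_coord_weight q_gt1 vjk).
  by rewrite kapr laurent_radiusr val_inv ?kn0 // (val_coord_weight q_gt1 vjk).
move=> i; rewrite -[i]splitK; case: (fintype.split i) => l /=.
  by rewrite kapl; apply: Gn.
by rewrite kapr invrK; apply: Gni.
Qed.

(** The bounded ring is generated over the unit ball by [D] and [W]; independence comes from
    the points of the affinoid. *)
Theorem Y31c_reduction :
  exists phi : {rmorphism reduction A -> prod_ring q.-1 (curve_ring (residue_field v) q)},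
  bijective phi /\ forall x, x \in O -> phi (red (c x)) = fun=> curve_const q (res v x).
Proof.
have pC : p \in [pchar C] by rewrite (fmorph_pchar j).
have qC : q%:R = 0 :> C.
  have f0 : (0 < f)%N by move: q_gt1; rewrite q_def; case: f.
  by rewrite q_def natrX (pcharf0 pC) expr0n eqn0Ngt f0.
have pA : p%:R = 0 :> A by rewrite -(rmorph_nat c) (pcharf0 pC) rmorph0.
have frA : {morph (fun a : A => a ^+ q) : a b / a + b}.
  by apply: (frobeniusD q_def) => //; exact: pcharf_prime pK.
have uz i : z i \in vunit vK by exact: (vunit_root_of_unity vK s0).
have Oz i : j (z i) \in O by rewrite integral_eltE -vKj (eqP (uz i)).
have Ozv i : (j (z i))^-1 \in O.
  by rewrite -fmorphV integral_eltE -vKj (eqP (vunitV (uz i))).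
have jzq i : j (z i) ^+ q.-1 = 1 by rewrite -rmorphXn zq rmorph1.
have jz_inj : injective (fun i => j (z i)) by move=> a b /fmorph_inj/z_inj.
have rz_inj : injective (fun i => res v (j (z i))).
  have f0 : (0 < f)%N by move: q_gt1; rewrite q_def; case: f.
  have zf i : z i ^+ (p ^ f) = z i.
    by rewrite -q_def -[in LHS](prednK q0) exprS zq mulr1.
  move=> a b /(proj2 (frobenius_fixed_residue vKj pK f0 (zf a) (zf b))).
  exact: z_inj.
have OP : j P \in O by rewrite integral_eltE -vKj (eqP uP).
have piE : j pi = j k ^+ wt_pi q * j P by rewrite rmorphM rmorphXn.
have pi2E : j pi2 = - j k ^+ (q ^ 2 * q.+1) by rewrite rmorphN rmorphXn.
have [h1 h2 h3 h4 h5] := Y31c_relations vjk piE pi2E.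
have U0S : is_subring U0 := affinoid_fil0_subring gs.
have U0c x : x \in O -> U0 (c x) by move=> Ox; apply: affinoid_fil_const.
have Kx i : n_ i * ni_ i = 1 by apply: ncoordK.
have U0_ind (G : A -> Prop) : is_subring G -> (forall x, x \in O -> G (c x)) ->
  [/\ G (n_ (inord 0)), G (n_ (inord 1)), G (n_ (inord 2)), G (n_ (inord 3)) & G (n_ (inord 4))] ->
  [/\ G (ni_ (inord 0)), G (ni_ (inord 1)), G (ni_ (inord 2)), G (ni_ (inord 3)) & G (ni_ (inord 4))] ->
  (forall a, U0 a -> G (c (j k) * a)) -> forall a, U0 a -> G a.
  move=> GS Gc [G0 G1 G2 G3 G4] [I0 I1 I2 I3 I4]; apply: ncoord_generate => // i.
    rewrite -[i]inord_val; case: i => [[|[|[|[|[|]]]]]] //=.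
  by rewrite -[i]inord_val; case: i => [[|[|[|[|[|]]]]]] //=.
have Ojk : j k \in O := infinitesimal_integral mjk.
have [A0 [[A0S A0U A0W [d1 [d2 A0E]]] [[b1 Ab1 Eq] [b2 Ab2 Wq] A0span]]] :=
  generated_subring q_gt1 frA qC jk0 Ojk OP (Kx _) (Kx _) (Kx _) (Kx _) (Kx _)
   h1 h2 h3 h4 h5 U0S U0c (ncoord_fil0 _) (ncoord_fil0 _) (ncoord_fil0 _) (ncoord_fil0 _)
   (ncoord_inv_fil0 _) (ncoord_inv_fil0 _) (ncoord_inv_fil0 _) (ncoord_inv_fil0 _) (ncoord_inv_fil0 _)
   Oz Ozv jzq jz_inj U0_ind.
have bA0 : bounded A0.
  by rewrite A0E; apply: adjoin_bounded; apply: adjoin_bounded; exists 0.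
have cfil M x : (M%:E <= v x)%E -> @fil R A M (c x) by apply: affinoid_fil_const.
have tnk b : A0 b -> c (j k) * b \in @top_nilpotent R A.
  move=> Ab; rewrite mulrC; apply: top_nilpotentM; first exact: (bounded_pb A0S bA0).
  exact: (const_tn cfil mjk).
have ind a : (forall i l, a i l \is a polyOver O) ->
    combination c q.-2 (component c (n_ (inord 2)) (ni_ (inord 1)) (fun i => j (z i))) (ni_ (inord 3))
      (scaledW c q (j k) (n_ (inord 2)) (n_ (inord 3)) (n_ (inord 4)) (ni_ (inord 1))) a \in
      @top_nilpotent R A ->
  forall i l, (l < q)%N -> forall n, (a i l)`_n \in m.
  exact: (combination_independent vKj pK q_def q_gt1 z_inj zq
    (Y31c_enough_points vKj pK q_def q_gt1 vk uP LTpi2 cpl zq)).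
apply: (@filtered_reduction_iso R C v A c q (j k) cfil q_gt1 qC jk0 mjk A0
  (ratioE (n_ (inord 2)) (ni_ (inord 1))) (ni_ (inord 3)) (n_ (inord 3)) _ _ A0S bA0 A0U
  _ _ _ A0W jzq rz_inj _ _ _ A0span ind).
- by apply: (subring_M A0S); apply: A0U; [exact: ncoord_fil0|exact: ncoord_inv_fil0].
- by apply: A0U; exact: ncoord_inv_fil0.
- by apply: A0U; exact: ncoord_fil0.
- by rewrite mulrC; apply: Kx.
- by rewrite Eq; apply: tnk.
- by rewrite Wq; apply: tnk.
Qed.
End Y31cReduction.

(** * Constants and conclusion *)

Section LubinTateTorsion.
Variables (R : realType) (K : closedFieldType) (v : valuation R K) (q : nat) (pi b : K).
Hypotheses (q_gt1 : (1 < q)%N) (vpi : v pi = 1%:E).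
Hypotheses (bT : pi_LT q pi (pi_LT q pi b) = 0) (b1_neq0 : pi_LT q pi b != 0).

Let s0 : (0 < q.-1)%N. Proof. by rewrite -ltnS prednK // (ltnW q_gt1). Qed.
Lemma LT_generator_neq0 : b != 0.
Proof.
by apply: contraNneq b1_neq0 => ->; rewrite /pi_LT mulr0 expr0n gtn_eqF ?subrr // ltnW.
Qed.

(** [b' = pi_LT q pi b] satisfies [b' ^+ q.-1 = pi], and in [b ^+ q = pi * b - b'] the term
    [b'] dominates. *)
Lemma val_LT_generator2 : v b = (q%:R * (q%:R - 1))^-1%:E.
Proof.
have b0 := LT_generator_neq0; move: bT b1_neq0; set b' := pi_LT q pi b => bT' b'0.
pose B := fine (v b); pose B' := fine (v b').
have qR : 1 < q%:R :> R by rewrite ltr1n.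
have q1R : 0 < q%:R - 1 :> R by rewrite subr_gt0.
have pq : q.-1%:R = q%:R - 1 :> R by rewrite -[in RHS](prednK (ltnW q_gt1)) -natr1 addrK.
have b'E : b' ^+ q.-1 = pi.
  apply: (mulIf b'0); rewrite -exprSr prednK ?(ltnW q_gt1) //.
  by apply/esym/eqP; rewrite -subr_eq0; apply/eqP.
have B'E : B' * (q%:R - 1) = 1.
  by have := valXn v q.-1 b'0; rewrite b'E vpi -[fine _ *+ _]mulr_natr pq => -[].
have B'le1 : B' <= 1.
  have B'0 : 0 < B' by rewrite -(pmulr_lgt0 _ q1R) B'E ltr01.
  have : 1 <= q%:R - 1 :> R by rewrite -pq ler1n.
  by rewrite -(ler_pM2l B'0) B'E mulr1.
have vb : v b = B%:E := val_fine v b0.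
have vb' : v b' = B'%:E := val_fine v b'0.
have vpib : v (pi * b) = (1 + B)%:E by rewrite val_mul vpi vb.
have vbq : v (b ^+ q) = (q%:R * B)%:E by rewrite valXn // -[fine _ *+ _]mulr_natl.
have bqE : b ^+ q = pi * b - b' by rewrite /b' /pi_LT; ring.
have b'E' : b' = pi * b - b ^+ q by [].
suff qB : q%:R * B = B'.
  rewrite vb; congr (_%:E); apply: (mulfI (lt0r_neq0 (lt_trans ltr01 qR))).
  rewrite qB invfM mulrA mulfV ?lt0r_neq0 ?(lt_trans ltr01 qR) // mul1r.
  by apply: (mulIf (lt0r_neq0 q1R)); rewrite B'E mulVf ?lt0r_neq0.
have m1 := val_add v (pi * b) (- b'); rewrite -bqE valN vpib vb' vbq in m1.
have m2 := val_add v (pi * b) (- b ^+ q); rewrite -b'E' valN vpib vb' vbq in m2.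
have m3 := val_add v (b ^+ q) b'; rewrite bqE subrK vpib vb' -bqE vbq in m3.
move: m1 m2 m3; rewrite -!EFin_min !lee_fin => m1 m2 m3.
have [B1|B1] := ltP B' (1 + B).
  apply/eqP; rewrite eq_le; apply/andP; split.
    by move: m2; rewrite ge_min [1 + B <= _]leNgt B1.
  by move: m1; rewrite (min_r (ltW B1)).
have Bneg : B <= 0 by rewrite -(lerD2l 1) addr0 (le_trans B1).
have : q%:R * B <= B by rewrite -[leRHS]mul1r ler_wnM2r // ltW.
move: m1; rewrite (min_l B1) => le1 le2.
by have := le_trans le1 le2; rewrite gerDr leNgt ltr01.
Qed.

(** The valuation of [b] turns out to be such that the root has that of [X_2]. *)
Lemma exists_uniformising_root : exists k : K,
  [/\ - k ^+ (q ^ 2 * q.+1) = b, v k = ((q%:R ^+ 3 * (q%:R ^+ 2 - 1))^-1)%:E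
    & exists2 P, P \in vunit v & k ^+ wt_pi q * P = pi].
Proof.
have q0 : (0 < q)%N := ltnW q_gt1.
have n0 : (0 < q ^ 2 * q.+1)%N by rewrite muln_gt0 expn_gt0 q0.
have [k kE] := closed_root_exp (- b) n0.
have b0 := LT_generator_neq0.
have k0 : k != 0.
  by apply: contraNneq b0 => k0; rewrite -oppr_eq0 -kE k0 expr0n gtn_eqF.
have q0R : q%:R != 0 :> R by rewrite pnatr_eq0 -lt0n.
have q1R : q%:R - 1 != 0 :> R by rewrite subr_eq0 gt_eqF // ltr1n.
have q2R : q%:R + 1 != 0 :> R by rewrite natr1 pnatr_eq0.
have qq : q%:R ^+ 2 - 1 = (q%:R - 1) * (q%:R + 1) :> R by ring.
have pq : q.-1%:R = q%:R - 1 :> R by rewrite -[in RHS](prednK q0) -natr1 addrK.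
have vk : fine (v k) = (q%:R ^+ 3 * (q%:R ^+ 2 - 1))^-1.
  have := valXn v (q ^ 2 * q.+1) k0; rewrite kE valN val_LT_generator2 => -[].
  rewrite -[fine _ *+ _]mulr_natr natrM natrX -natr1 => e.
  have n0R : q%:R ^+ 2 * (q%:R + 1) != 0 :> R by rewrite mulf_neq0 ?expf_neq0.
  apply: (mulIf n0R); rewrite -e qq; field.
  by rewrite q0R q1R q2R.
exists k; split; first by rewrite kE opprK.
  by rewrite (val_fine v k0) vk.
have kw0 : k ^+ wt_pi q != 0 by rewrite expf_neq0.
exists (pi / k ^+ wt_pi q); last by rewrite mulrCA mulfV ?mulr1.
have wE : (wt_pi q)%:R = q%:R ^+ 3 * ((q%:R - 1) * (q%:R + 1)) :> R.
  by rewrite /wt_pi natrM natrX natrM pq natr1.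
apply: val_div => //; rewrite vpi valXn // vk -[_^-1 *+ _]mulr_natr wE -qq mulVf //.
by rewrite qq !mulf_neq0 ?expf_neq0.
Qed.
End LubinTateTorsion.

(** [P] already splits over [K]. *)
Lemma closed_subfield_root (K : closedFieldType) (C : fieldType) (j : {rmorphism K -> C})
    (P : {poly K}) x : P != 0 -> root (map_poly j P) x -> exists a, x = j a.
Proof.
move=> P0; have [s ->] := closed_field_poly_normal P.
rewrite map_polyZ rootZ ?fmorph_eq0 ?lead_coef_eq0 // rmorph_prod /=.
under eq_bigr => a _ do rewrite rmorphB /= map_polyX map_polyC.
rewrite -(big_map j xpredT (fun a => 'X - a%:P)) root_prod_XsubC => /mapP[a _ ->].
by exists a.
Qed.

(** [x] is a root of [P = pi_LT q pi (pi_LT q pi 'X)], which is not zero as [P.[1]] is a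
    unit. *)
Lemma LT_torsion_algebraic (R : realType) (K : closedFieldType) (vK : valuation R K)
    (C : fieldType) (j : {rmorphism K -> C}) q (pi : K) x : (1 < q)%N -> pi \in infinitesimal vK ->
  pi_LT q (j pi) (pi_LT q (j pi) x) = 0 -> exists a, x = j a.
Proof.
move=> q_gt1 mpi x0; pose P : {poly K} := pi_LT q pi%:P (pi_LT q pi%:P 'X).
have PE y : P.[y] = pi_LT q pi (pi_LT q pi y).
  by rewrite /P /pi_LT !(hornerE, horner_exp).
apply: (@closed_subfield_root K C j P); last first.
  apply/rootP; rewrite -[RHS]x0 /P /pi_LT.
  by rewrite !(rmorphB, rmorphM, rmorphXn) /= map_polyX map_polyC !(hornerE, horner_exp).
have q0 := ltnW q_gt1; have Opi := infinitesimal_integral mpi.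
apply: contraTneq (vunit1 vK) => P0; rewrite vunitE; apply/nandP; right; rewrite negbK.
have u1 : pi - 1 \in vunit vK by rewrite addrC vunitD // vunitN vunit1.
have : P.[1] \in vunit vK.
  rewrite PE /pi_LT mulr1 expr1n addrC vunitD // ?vunitN ?vunitX //.
  by rewrite mulrC infinitesimalMr // vunit_integral.
by rewrite P0 horner0 => /vunit_neq0; rewrite eqxx.
Qed.

(** These are the nonzero elements of the subfield with [q] elements. *)
Lemma frobenius_units (K : closedFieldType) (p f q : nat) : p \in [pchar K] -> (0 < f)%N ->
  q = (p ^ f)%N -> exists z : 'I_q.-1 -> K, injective z /\ forall i, z i ^+ q.-1 = 1.
Proof.
move=> pK f0 q_def; have [s [us ss sP]] := frobenius_roots pK f0.
have q0 : (0 < q)%N by rewrite q_def expn_gt0 prime_gt0 // (pcharf_prime pK).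
pose s' := [seq x <- s | x != 0].
have szs : (q.-1 <= size s')%N.
  rewrite -ltnS prednK // q_def -ss -addn1 -(count_predC (fun x => x != 0%R) s) size_filter leq_add2l.
  rewrite -size_filter (leq_trans _ (_ : size [:: (0 : K)%R] <= 1)%N) //.
  apply: uniq_leq_size; first exact: filter_uniq.
  by move=> x; rewrite mem_filter /= negbK inE => /andP[].
have lt_i (i : 'I_q.-1) : (i < size s')%N by apply: leq_trans szs.
exists (fun i => s'`_i); split=> [i i' /eqP|i].
  by rewrite nth_uniq ?filter_uniq // => /eqP/val_inj.
have := mem_nth 0 (lt_i i); rewrite mem_filter => /andP[z0 /sP]; rewrite -q_def => zq.
by apply: (mulIf z0); rewrite -exprSr prednK // mul1r.
Qed.

Section ResidueFieldCard.
Variables (R : realType) (F : fieldType) (vF : valuation R F) (p : nat).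

Lemma residue_field_pchar : p \in [pchar F] -> p \in [pchar (residue_field vF)].
Proof.
move=> pF; rewrite inE (pcharf_prime pF) /=.
have resn n : n%:R = res vF n%:R.
  elim: n => [|n IHn]; first by rewrite res0.
  by rewrite -!natr1 resD ?rpred_nat ?rpred1 // res1 IHn.
by rewrite resn (pcharf0 pF) res0.
Qed.
End ResidueFieldCard.

Section PullbackValuation.
Variables (R : realType) (K C : fieldType) (v : valuation R C) (j : {rmorphism K -> C}).

Definition pullback_valuation : valuation R K.
Proof.
refine (@Valuation R K (fun x => v (j x)) _ _ _ _) => [x|x|x y|x y].
- exact: val_neq_ninfty.
- rewrite val_eq_pinfty; split=> [/eqP|->]; last exact: rmorph0.
  by rewrite fmorph_eq0 => /eqP.
- by rewrite rmorphM; apply: val_mul.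
- by rewrite rmorphD; apply: val_add.
Defined.
End PullbackValuation.

Theorem proposition4p7 (R : realType) (p q : nat)
    (F : fieldType) (vF : valuation R F) (pi : F)
    (Fbar : closedFieldType) (iota : {rmorphism F -> Fbar})
    (C : fieldType) (v : valuation R C) (j : {rmorphism Fbar -> C})
    (pi2 : C) :
  local_field vF p q pi ->
  completed_closure vF iota v j ->
  LT_generator2 q (j (iota pi)) pi2 ->
  exists phi : {rmorphism reduction (Y31c v q (j (iota pi)) pi2) ->
                  prod_ring q.-1 (curve_ring (residue_field v) q)},
    bijective phi /\
    forall c : valuation_ring v,
      phi (Y31c_scalar q (j (iota pi)) pi2 c) = fun=> curve_const q (residue c).
Proof.
move=> [pF _ _ vpi [s [us ss sP]]] [_ vE cpl _] [gen0 gen1].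
have [f f0 sf] := finite_field_card (residue_field_pchar vF pF) us sP.
have q_def : q = (p ^ f)%N by rewrite -ss.
have pK : p \in [pchar Fbar] by rewrite (fmorph_pchar iota).
have q_gt1 : (1 < q)%N.
  by rewrite q_def -(exp1n f) ltn_exp2r // prime_gt1 // (pcharf_prime pK).
pose vK := pullback_valuation v j.
have vpiK : vK (iota pi) = 1%:E by rewrite /= vE.
have mpi : iota pi \in infinitesimal vK by rewrite infinitesimalE vpiK lte_fin ltr01.
have [b bE] := LT_torsion_algebraic q_gt1 mpi gen0.
have jLT x : j (pi_LT q (iota pi) x) = pi_LT q (j (iota pi)) (j x).
  by rewrite rmorphB rmorphM rmorphXn.
have bT : pi_LT q (iota pi) (pi_LT q (iota pi) b) = 0.
  by apply/eqP; rewrite -(fmorph_eq0 j) !jLT -bE gen0.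
have b1 : pi_LT q (iota pi) b != 0 by rewrite -(fmorph_eq0 j) jLT -bE; apply/eqP.
have [k [kb vk [P uP piE]]] := exists_uniformising_root q_gt1 vpiK bT b1.
have [z [z_inj zq]] := frobenius_units pK f0 q_def.
rewrite -kb -piE in bT.
have vKj x : vK x = v (j x) by [].
have := Y31c_reduction vKj pK q_def q_gt1 vk uP bT cpl z_inj zq.
rewrite kb piE -bE => -[phi [phi_bij phiC]].
exists phi; split=> // c.
have <- : red (affinoid_const (laurent_rel v (@Y31c_radius R q) ++
   Y31c_equations v q (j (iota pi)) pi2) (vr_val c)) = Y31c_scalar q (j (iota pi)) pi2 c.
  exact: (redE (pb_const _ c)).
by rewrite phiC ?vr_valP // resE.
Qed.
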